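(* Suppose $S$ is a simple $V_1(\mathfrak{gl}(1|1))$-module with projective cover $P_S$ in $\mathcal O_1^{fin}$ such that $\mathcal F(S)$ is an object of $\mathrm{Rep}^0\,V_{-\frac12}(\mathfrak{sl}(2|1))$. Then $\mathcal F(P_S)$ is a projective cover of $\mathcal F(S)$ in $\mathrm{Rep}^0\,V_{-\frac12}(\mathfrak{sl}(2|1))$.
   Context: **Algebra.** $\mathfrak{gl}(1|1)$ has even basis $N,E$ and odd basis $\psi^\pm$; nonzero brackets $[N,\psi^\pm]=\pm\psi^\pm$, $\{\psi^+,\psi^-\}=E$; invariant form $\kappa(N,E)=\kappa(E,N)=1$, $\kappa(\psi^+,\psi^-)=-\kappa(\psi^-,\psi^+)=1$, zero on other pairs of basis elements. $\widehat{\mathfrak{gl}(1|1)}$ is the affinization, $[a_r,b_s]=[a,b]_{r+s}+r\kappa(a,b)\delta_{r+s,0}\mathbf{k}$. $V_1(\mathfrak{gl}(1|1))$ is the level-$1$ module induced from the trivial $\mathfrak{gl}(1|1)$-module, a vertex operator superalgebra with conformal vector $\omega=\frac12(N_{-1}E_{-1}+E_{-1}N_{-1}-\psi^+_{-1}\psi^-_{-1}+\psi^-_{-1}\psi^+_{-1})\mathbf 1+\frac12E_{-1}^2\mathbf 1$. **Modules (level 1).** $V_{n,e}$ is the 2-dimensional Verma $\mathfrak{gl}(1|1)$-module with highest-weight vector $v$, $Nv=(n+\frac12)v$, $Ev=ev$, $\psi^+v=0$; $A_n$ is 1-dimensional with $N=n$, $E=\psi^\pm=0$. $\widehat V_{n,e}$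 is the level-1 induced module from $V_{n,e}$ (irreducible iff $e\notin\mathbb Z$); $\widehat A_{n,0}$ is induced from $A_n$; for $\ell\in\mathbb{Z}\setminus\{0\}$, $\widehat A_{n,\ell}$ is the unique irreducible quotient of $\widehat V_{n,\ell}$. The simple (grading-restricted) $V_1(\mathfrak{gl}(1|1))$-modules are the $\widehat V_{n,e}$, $e\notin\mathbb{Z}$, and $\widehat A_{n,\ell}$, $\ell\in\mathbb{Z}$; each has a projective cover in $\mathcal O_1^{fin}$. **Categories.** $\mathcal O_1^{fin}$ is the supercategory of finite-length grading-restricted generalized $V_1(\mathfrak{gl}(1|1))$-modules on which $N_0,E_0$ act semisimply; it is a braided tensor supercategory with the vertex algebraic (Huang–Lepowsky–Zhang) tensor product $\boxtimes$. $\mathrm{Ind}(\mathcal O_1^{fin})$ is the category of generalized $V_1(\mathfrak{gl}(1|1))$-modules that are unions of submodules in $\mathcal O_1^{fin}$, with the extended braided tensor structure. **The extension.** $V_{-\frac12}(\mathfrak{sl}(2|1))$, the simple affine vertex operator superalgebra of $\mathfrak{sl}(2|1)$ at level $-\frac12$, is (a known result) a simple current extension $V_{-\frac12}(\mathfrak{sl}(2|1))=\bigoplus_{m\in\mathbb{Z}}\widehat A_{m-\varepsilon(m),-2m}$ of $V_1(\mathfrak{gl}(1|1))$, where $\varepsilon(m)=\frac12,0,-\frac12$ for $m>0,m=0,m<0$. Hence it is a supercommutative algebra $A$ in $\mathrm{Ind}(\mathcal O_1^{fin})$. $\mathrm{Rep}\,V_{-\frac12}(\mathfrak{sl}(2|1))$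 is the category of objects $X$ of $\mathrm{Ind}(\mathcal O_1^{fin})$ with an associative unital even action $\mu_X:A\boxtimes X\to X$; $\mathrm{Rep}^0$ is the full subcategory of local ones, i.e. $\mu_X\circ\mathcal M_{A,X}=\mu_X$ with $\mathcal M$ the double braiding (equivalently, generalized $V_{-\frac12}(\mathfrak{sl}(2|1))$-modules lying in $\mathrm{Ind}(\mathcal O_1^{fin})$). $\mathcal F:\mathcal O_1^{fin}\to\mathrm{Rep}\,V_{-\frac12}(\mathfrak{sl}(2|1))$ is the induction functor $\mathcal F(W)=A\boxtimes W$. **Projective cover.** A projective cover of $S$ is a projective object $P$ with a surjection $\pi:P\to S$ such that for every surjection $q:Q\to S$ with $Q$ projective there is a surjection $\widetilde q:Q\to P$ with $q=\pi\circ\widetilde q$. *)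

(* Defs.v *)
(* The ground field is the field of complex numbers C = R[i], R : realType. *)
From mathcomp Require Import all_boot all_order all_algebra finmap.
From mathcomp Require Import all_classical all_reals all_analysis.
From mathcomp Require Import complex.

Set Implicit Arguments.
Unset Strict Implicit.
Unset Printing Implicit Defensive.

Import Order.TTheory GRing.Theory Num.Theory.
Local Open Scope classical_set_scope.
Local Open Scope ring_scope.
Local Open Scope complex_scope.

Section Scalars.
Context {R : realType}.
Local Notation C := R[i].

Definition cexp (z : C) : C :=
  (expR (complex.Re z))%:C * (cos (complex.Im z) +i* sin (complex.Im z)).

(* Generalized binomial coefficient (l choose i), l of either sign. *)
Definition gbin (l : int) (i : nat) : C :=
  (\prod_(j < i) (l%:~R - j%:R)) / (i`!)%:R.

(* Unconditional (equivalently, absolute) summability of a family of complex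
   numbers, with sum s. *)
Definition abs_sum (I : choiceType) (f : I -> C) (s : C) : Prop :=
  forall e : C, 0 < e -> exists J0 : {fset I}, forall J : {fset I},
    (J0 `<=` J)%fset -> `|\sum_(i <- J) f i - s| < e.

Definition lin_map (U W : lmodType C) (f : U -> W) : Prop :=
  forall c u v, f (c *: u + v) = c *: f u + f v.

(* A superspace, encoded as a vector space with its parity involution:
   the even (odd) vectors are those with par w = w (par w = - w). *)
Record sspace := SSpace {
  scar :> lmodType C;
  par : scar -> scar;
  par_lin : lin_map par;
  parK : involutive par }.

Definition homog (W : sspace) (b : bool) (w : W) : Prop :=
  par w = (-1) ^+ b *: w.

(* parb b w = (-1)^{b |w|} w *)
Definition parb (W : sspace) (b : bool) (w : W) : W := if b then par w else w.

End Scalars.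

Arguments sspace : clear implicits.

Section VertexSuperalgebras.
Context {R : realType}.
Local Notation C := R[i].

(* Y v n w is the mode v_n w of Y(v,x) w = \sum_n v_n w x^(-n-1).
   In the Borcherds identity all sums are finite by truncation: both sides are
   eventually constant in the cutoff K. *)
Record vmod_ax (V W : sspace R) (vac : V) (YV : V -> int -> V -> V)
    (Y : V -> int -> W -> W) : Prop := VmodAx {
  vm_linl : forall n w, lin_map (fun v => Y v n w);
  vm_linr : forall v n, lin_map (Y v n);
  vm_par : forall v n w, par (Y v n w) = Y (par v) n (par w);
  vm_trunc : forall v w, exists n0 : int, forall n, n0 <= n -> Y v n w = 0;
  vm_vac : forall n w, Y vac n w = if n == -1 then w else 0;
  vm_borcherds : forall (b : bool) (u v : V) (w : W) (l m n : int),
    homog b u ->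
    exists K0 : nat, forall K : nat, (K0 <= K)%N ->
      \sum_(i < K) gbin m i *: Y (YV u (l + i%:Z) v) (m + n - i%:Z) w =
      \sum_(i < K) ((-1) ^+ i * gbin l i) *:
        (Y u (m + l - i%:Z) (Y v (n + i%:Z) w)
         - (-1) ^ l *: Y (parb b v) (n + l - i%:Z) (Y u (m + i%:Z) w)) }.

Record is_vsa (V : sspace R) (vac : V) (Y : V -> int -> V -> V) : Prop := IsVsa {
  vsa_mod : vmod_ax vac Y Y;
  vsa_create : forall v, Y v (-1) vac = v;
  vsa_create0 : forall v (n : int), 0 <= n -> Y v n vac = 0 }.

Record submod (I : Type) (W : sspace R) (Y : I -> int -> W -> W)
    (U : set W) : Prop := Submod {
  sm_0 : U 0;
  sm_lin : forall (c : C) u v, U u -> U v -> U (c *: u + v);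
  sm_par : forall u, U u -> U (par u);
  sm_act : forall v n u, U u -> U (Y v n u) }.

Definition irred (I : Type) (W : sspace R) (Y : I -> int -> W -> W) : Prop :=
  (exists w : W, w <> 0) /\
  forall U : set W, submod Y U -> U = [set 0] \/ U = setT.

Definition finite_length (I : Type) (W : sspace R) (Y : I -> int -> W -> W) :
    Prop :=
  exists (n : nat) (U : nat -> set W),
    [/\ U 0%N = [set 0], U n = setT, forall i, submod Y (U i) &
     forall i, (i < n)%N ->
       [/\ U i `<=` U i.+1, U i <> U i.+1 &
        forall U', submod Y U' -> U i `<=` U' -> U' `<=` U i.+1 ->
          U' = U i \/ U' = U i.+1]].

End VertexSuperalgebras.

Inductive gl11 := gN | gE | gP | gM. (* N, E, psi^+, psi^- *)

Definition godd (a : gl11) : bool :=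
  match a with gN | gE => false | _ => true end.

Section AffineGl11.
Context {R : realType}.
Local Notation C := R[i].

(* The superbracket of two basis elements is a multiple c *: d of a basis
   element d; gbr returns (c, d). *)
Definition gbr (a b : gl11) : C * gl11 :=
  match a, b with
  | gN, gP => (1, gP) | gP, gN => (-1, gP)
  | gN, gM => (-1, gM) | gM, gN => (1, gM)
  | gP, gM | gM, gP => (1, gE)
  | _, _ => (0, gE)
  end.

Definition gform (a b : gl11) : C :=
  match a, b with
  | gN, gE | gE, gN => 1
  | gP, gM => 1 | gM, gP => -1
  | _, _ => 0
  end.

(* Modules of level 1 for the affinization: act a r is the action of a_r.
   No parity on M is needed to state the relations. *)
Record is_aff1 (M : lmodType C) (act : gl11 -> int -> M -> M) : Prop := IsAff1 {
  aff_lin : forall a n, lin_map (act a n);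
  aff_rel : forall a b (r s : int) (w : M),
    act a r (act b s w) - (-1) ^+ (godd a && godd b) *: act b s (act a r w) =
    (gbr a b).1 *: act (gbr a b).2 (r + s) w
    + (if r + s == 0 then (r%:~R * gform a b) *: w else 0) }.

(* v satisfies the relations of the generator of A_n ... *)
Definition rel_A (n : C) (M : lmodType C) (act : gl11 -> int -> M -> M) (v : M) :=
  [/\ forall a (r : int), 0 < r -> act a r v = 0, act gN 0 v = n *: v,
      act gE 0 v = 0, act gP 0 v = 0 & act gM 0 v = 0].

(* ... resp. of the highest-weight vector of the Verma module V_{n,e}, with
   the positive modes acting by zero. *)
Definition rel_V (n e : C) (M : lmodType C) (act : gl11 -> int -> M -> M) (v : M) :=
  [/\ forall a (r : int), 0 < r -> act a r v = 0, act gN 0 v = (n + 2^-1) *: v,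
      act gE 0 v = e *: v & act gP 0 v = 0].

Definition aff_hom (M M' : lmodType C) (act : gl11 -> int -> M -> M)
    (act' : gl11 -> int -> M' -> M') (f : M -> M') : Prop :=
  lin_map f /\ forall a r w, f (act a r w) = act' a r (f w).

(* (M, v) is the level-1 module induced from the module presented by rel:
   the universal level-1 module with a vector satisfying rel. *)
Definition induced
    (rel : forall M : lmodType C, (gl11 -> int -> M -> M) -> M -> Prop)
    (M : lmodType C) (act : gl11 -> int -> M -> M) (v : M) : Prop :=
  [/\ is_aff1 act, rel M act v &
   forall (M' : lmodType C) (act' : gl11 -> int -> M' -> M') (v' : M'),
     is_aff1 act' -> rel M' act' v' ->
     exists! f : M -> M', aff_hom act act' f /\ f v = v'].

(* V_1(gl(1|1)): the vertex superalgebra generated by the fields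
   gi a (x) = \sum_n a_n x^(-n-1) which, as a module for the affine Lie
   superalgebra, is induced from the trivial module A_0. *)
Record V1gl11 := MkV1gl11 {
  vcar :> sspace R;
  vac : vcar;
  vY : vcar -> int -> vcar -> vcar;
  vP : is_vsa vac vY;
  gi : gl11 -> vcar;
  gi_par : forall a, homog (godd a) (gi a);
  gi_0 : forall a b, vY (gi a) 0 (gi b) = (gbr a b).1 *: gi (gbr a b).2;
  gi_1 : forall a b, vY (gi a) 1 (gi b) = gform a b *: vac;
  gi_2 : forall a b (n : int), 2 <= n -> vY (gi a) n (gi b) = 0;
  gi_ind : induced (rel_A 0) (fun a => vY (gi a)) vac }.

Definition omega (V : V1gl11) : V :=
  let q a b := vY (gi V a) (-1) (vY (gi V b) (-1) (vac V)) in
  2^-1 *: (q gN gE + q gE gN - q gP gM + q gM gP) + 2^-1 *: q gE gE.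

End AffineGl11.

Arguments V1gl11 : clear implicits.

Section Modules.
Context {R : realType} (V : V1gl11 R).
Local Notation C := R[i].

(* Generalized V-modules: the L_0 = omega_1 generalized eigenspaces span.
   gpr h is the projection to the generalized eigenspace of eigenvalue h (it is
   determined by the action). *)
Record gmod := GMod {
  gcar :> sspace R;
  gY : V -> int -> gcar -> gcar;
  gax : vmod_ax (vac V) (@vY _ V) gY;
  gpr : C -> gcar -> gcar;
  gpr_lin : forall h, lin_map (gpr h);
  gpr_wt : forall h w, exists n : nat,
    iter n (fun u => gY (omega V) 1 u - h *: u) (gpr h w) = 0;
  gpr_id : forall h w (n : nat),
    iter n (fun u => gY (omega V) 1 u - h *: u) w = 0 -> gpr h w = w;
  gpr_sum : forall w, exists J : {fset C},
    (forall h, h \notin J -> gpr h w = 0) /\ w = \sum_(h <- J) gpr h w }.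

Definition Lm1 (W : gmod) (w : W) : W := gY (omega V) 0 w.
Definition gact (W : gmod) (a : gl11) (n : int) (w : W) : W := gY (gi V a) n w.

(* Morphisms of the supercategory: arbitrary sums of even and odd maps.  For f
   of parity |f| the condition reads f (v_n w) = (-1)^{|f||v|} v_n (f w). *)
Record ghom (W X : gmod) := GHom {
  hfun :> W -> X;
  hlin : lin_map hfun;
  hcomm : forall (b : bool) (v : V) n w, homog b v ->
    hfun (gY v n w) = gY v n (parb b (hfun (parb b w))) }.

Definition hpar (W X : gmod) (b : bool) (f : W -> X) : Prop :=
  forall w, f (par w) = (-1) ^+ b *: par (f w).
Definition heven (W X : gmod) (f : W -> X) : Prop := hpar false f.

Definition hcomp (W X : sspace R) (b : bool) (f : W -> X) (w : W) : X :=
  2^-1 *: (f w + (-1) ^+ b *: par (f (par w))).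

Definition surj (A B : Type) (f : A -> B) : Prop := forall y, exists x, f x = y.

Lemma hid_comm (W : gmod) (b : bool) (v : V) n (w : W) : homog b v ->
  gY v n w = gY v n (parb b (parb b w)).
Proof. by case: b => _ //=; rewrite parK. Qed.

Definition hid (W : gmod) : ghom W W :=
  @GHom W W (fun w => w) (fun _ _ _ => erefl) (@hid_comm W).

Lemma hcompose_lin (W X Z : gmod) (g : ghom X Z) (f : ghom W X) :
  lin_map (fun w => g (f w)).
Proof. by move=> c u v; rewrite hlin hlin. Qed.

Lemma hcompose_comm (W X Z : gmod) (g : ghom X Z) (f : ghom W X)
  (b : bool) (v : V) n w : homog b v ->
  g (f (gY v n w)) = gY v n (parb b (g (f (parb b w)))).
Proof.
by move=> hv; rewrite (hcomm f n w hv) (hcomm g n _ hv); case: b hv => //= _; rewrite parK.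
Qed.

Definition hcompose (W X Z : gmod) (g : ghom X Z) (f : ghom W X) : ghom W Z :=
  GHom (hcompose_lin g f) (hcompose_comm g f).

Definition diagonalizable_op (W : sspace R) (f : W -> W) : Prop :=
  forall w, exists s : seq (C * W),
    w = \sum_(p <- s) p.2 /\ forall p, p \in s -> f p.2 = p.1 *: p.2.

Definition grading_restricted (W : gmod) : Prop :=
  (forall h, exists s : seq W, forall w, exists c : nat -> C,
     gpr h w = \sum_(i < size s) c i *: nth 0 s i) /\
  (forall h, exists n0 : nat, forall n : nat, (n0 <= n)%N ->
     forall w : W, gpr (h - n%:R) w = 0).

Definition simple_mod (W : gmod) : Prop := irred (@gY W).

Record O1fin (W : gmod) : Prop := IsO1fin {
  O1_gr : grading_restricted W;
  O1_len : finite_length (@gY W);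
  O1_N : diagonalizable_op (@gact W gN 0);
  O1_E : diagonalizable_op (@gact W gE 0) }.

(* W is the union of its submodules in O_1^fin. *)
Definition in_ind (W : gmod) : Prop :=
  forall w : W, exists (X : gmod) (f : ghom X W),
    [/\ O1fin X, heven f, injective f & exists x, f x = w].

Lemma O1fin_ind (W : gmod) : O1fin W -> in_ind W.
Proof.
move=> hW w; exists W, (hid W); split => //; last by exists w.
by move=> u /=; rewrite expr0 scale1r.
Qed.

Record indO := IndO { iobj :> gmod; iP : in_ind iobj }.
Record finO := FinO { fobj :> gmod; fP : O1fin fobj }.
Definition fin_ind (W : finO) : indO := IndO (O1fin_ind (fP W)).

(* \hat A_{n,l}: induced from A_n for l = 0; for l != 0 the irreducible
   quotient of \hat V_{n,l}. *)
Definition is_Ahat (n : C) (l : int) (W : gmod) : Prop :=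
  if l == 0 then exists v : W, induced (rel_A n) (@gact W) v
  else simple_mod W /\
    exists (M : gmod) (p : ghom M W),
      (exists v : M, induced (rel_V n l%:~R) (@gact M) v) /\ surj p.

End Modules.

Section IntertwiningOperators.
Context {R : realType} {V : V1gl11 R}.
Local Notation C := R[i].

(* I w1 h k w2 is the coefficient of x^(-h-1) (log x)^k in I(w1,x) w2. *)
Definition coefs (A B D : Type) := A -> C -> nat -> B -> D.

(* Even (logarithmic) intertwining operators of type (W3 over W1 W2).  The
   Jacobi identity is given in components; its sums are finite. *)
Record intertwining (W1 W2 W3 : gmod V) (I : coefs W1 W2 W3) : Prop := Intw {
  it_linl : forall h k w2, lin_map (fun w1 => I w1 h k w2);
  it_linr : forall w1 h k, lin_map (I w1 h k);
  it_par : forall w1 h k w2, par (I w1 h k w2) = I (par w1) h k (par w2);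
  it_trunc : forall w1 w2 h, exists m0 : nat, forall m k : nat,
    (m0 <= m)%N -> I w1 (h + m%:R) k w2 = 0;
  it_log : forall w1 w2 h, exists k0 : nat, forall k : nat,
    (k0 <= k)%N -> I w1 h k w2 = 0;
  it_jacobi : forall (b : bool) (v : V) (w1 : W1) (w2 : W2) (l m : int) (h : C)
      (k : nat), homog b v ->
    exists K0 : nat, forall K : nat, (K0 <= K)%N ->
      \sum_(i < K) gbin m i *:
        I (gY v (l + i%:Z) w1) (m%:~R + h - i%:R) k w2 =
      \sum_(i < K) ((-1) ^+ i * gbin l i) *:
        (gY v (m + l - i%:Z) (I w1 (h + i%:R) k w2)
         - (-1) ^ l *: I (parb b w1) (h + l%:~R - i%:R) k (gY v (m + i%:Z) w2));
  (* I(L_{-1} w1, x) = d/dx I(w1, x) *)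
  it_deriv : forall w1 h k w2,
    I (Lm1 w1) h k w2 =
      - h *: I w1 (h - 1) k w2 + k.+1%:R *: I w1 (h - 1) k.+1 w2 }.

(* The weight-g component of I(w1,z) w2 for a real number z > 0, with the real
   branch of log z; the sum has finite support. *)
Definition ival (W1 W2 W3 : gmod V) (I : coefs W1 W2 W3) (z : R)
    (w1 : W1) (w2 : W2) (g : C) : W3 :=
  \sum_(p \in [set: (C * nat)%type])
    (cexp (- (p.1 + 1) * (ln z)%:C) * (ln z)%:C ^+ p.2)
      *: gpr g (I w1 p.1 p.2 w2).

(* The coefficients of e^{x L_{-1}} J(w2, e^{pi i} x) w1, as a function of w1
   and w2; the sum has finite support. *)
Definition skew (W1 W2 : Type) (W3 : gmod V) (J : coefs W2 W1 W3) : coefs W1 W2 W3 :=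
  fun w1 h k w2 =>
  \sum_(p \in [set: (nat * nat)%type])
    (cexp (- ('i * pi%:C) * (h + p.1%:R + 1)) * ('C(k + p.2, k))%:R
       * ('i * pi%:C) ^+ p.2 / (p.1`!)%:R)
      *: iter p.1 (@Lm1 _ _ W3) (J w2 (h + p.1%:R) (k + p.2)%N w1).

(* A formal series with integral powers of x only and no logarithms, viewed as
   a logarithmic series. *)
Definition int_modes (A B : Type) (D : lmodType C) (Y : A -> int -> B -> D) :
    coefs A B D :=
  fun a h k b =>
  if k is 0%N then
    match pselect (exists m : int, m%:~R = h) with
    | left e => Y a (projT1 (cid e)) b
    | right _ => 0
    end
  else 0.

End IntertwiningOperators.

(* The braided tensor supercategory structure on Ind(O_1^fin) with the vertex
   algebraic tensor product. *)
Section TensorStructure.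
Context {R : realType} (V : V1gl11 R).
Local Notation C := R[i].
Local Notation obj := (indO V).

Record HLZ := MkHLZ {
  tens : obj -> obj -> obj;
  tY : forall W1 W2 : obj, @coefs R W1 W2 (tens W1 W2);
  tY_intw : forall W1 W2, intertwining (@tY W1 W2);
  tY_univ : forall (W1 W2 W3 : obj) (I : @coefs R W1 W2 W3), intertwining I ->
    exists f : ghom (tens W1 W2) W3,
      [/\ heven f, forall w1 h k w2, f (tY w1 h k w2) = I w1 h k w2 &
       forall g : ghom (tens W1 W2) W3, heven g ->
         (forall w1 h k w2, g (tY w1 h k w2) = I w1 h k w2) ->
         forall t, g t = f t];
  tens_fin : forall W1 W2 : obj, O1fin W1 -> O1fin W2 -> O1fin (tens W1 W2);
  (* (f (x) g)(tY(w1,x) w2) = (-1)^{|g||w1|} tY(f w1,x)(g w2) *)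
  tmap : forall W1 W2 X1 X2 : obj,
    ghom W1 X1 -> ghom W2 X2 -> ghom (tens W1 W2) (tens X1 X2);
  tmapE : forall (W1 W2 X1 X2 : obj) (f : ghom W1 X1) (g : ghom W2 X2) w1 h k w2,
    tmap f g (tY w1 h k w2) =
    \sum_(b : bool) tY (f (parb b w1)) h k (hcomp b g w2);
  (* the unit object is V, identified with its underlying object by tu *)
  tone : obj;
  tu : V -> tone;
  tu_lin : lin_map tu;
  tu_bij : bijective tu;
  tu_par : forall v, tu (par v) = par (tu v);
  tuY : forall v n u, tu (vY v n u) = gY v n (tu u);
  tone_fin : O1fin tone;
  tl : forall W, ghom (tens tone W) W;
  tl_bij : forall W, bijective (tl W);
  tlE : forall (W : obj) v h k (w : W),
    tl W (tY (tu v) h k w) = int_modes (@gY _ _ W) v h k w;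
  (* tr(tY(w,x) v) = (-1)^{|v||w|} e^{x L_{-1}} Y(v, e^{pi i} x) w *)
  tr : forall W, ghom (tens W tone) W;
  tr_bij : forall W, bijective (tr W);
  trE : forall (W : obj) b (w : W) h k v, homog b w ->
    tr W (tY w h k (tu v)) =
    skew (int_modes (@gY _ _ W)) w h k (parb b v);
  ta : forall W1 W2 W3, ghom (tens W1 (tens W2 W3)) (tens (tens W1 W2) W3);
  taV : forall W1 W2 W3, ghom (tens (tens W1 W2) W3) (tens W1 (tens W2 W3));
  taK : forall W1 W2 W3, cancel (ta W1 W2 W3) (taV W1 W2 W3);
  taVK : forall W1 W2 W3, cancel (taV W1 W2 W3) (ta W1 W2 W3);
  (* a(tY(w1,z1) tY(w2,z2) w3) = tY(tY(w1,z1-z2) w2,z2) w3 for real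
     z1 > z2 > z1 - z2 > 0, paired with an arbitrary element w' of the graded
     dual (a functional on the space of weight g); intermediate weights are
     summed over. *)
  taE : forall (W1 W2 W3 : obj) (w1 : W1) (w2 : W2) (w3 : W3) (z1 z2 : R) (g : C)
      (w' : tens (tens W1 W2) W3 -> C),
    z2 < z1 -> z1 - z2 < z2 -> 0 < z1 - z2 -> lin_map (w' : _ -> C^o) ->
    exists s : C,
      abs_sum (fun h : C =>
        w' (ta W1 W2 W3
          (ival (@tY W1 (tens W2 W3)) z1 w1 (ival (@tY W2 W3) z2 w2 w3 h) g))) s /\
      abs_sum (fun h : C =>
        w' (ival (@tY (tens W1 W2) W3) z2
          (ival (@tY W1 W2) (z1 - z2) w1 w2 h) w3 g)) s;
  (* R(tY(w1,x) w2) = (-1)^{|w1||w2|} e^{x L_{-1}} tY(w2, e^{pi i} x) w1, R the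
     braiding *)
  tR : forall W1 W2, ghom (tens W1 W2) (tens W2 W1);
  tR_bij : forall W1 W2, bijective (tR W1 W2);
  tRE : forall (W1 W2 : obj) b (w1 : W1) h k (w2 : W2), homog b w1 ->
    tR W1 W2 (tY w1 h k w2) = skew (@tY W2 W1) w1 h k (parb b w2);
  tl_even : forall W, heven (tl W);
  tr_even : forall W, heven (tr W);
  ta_even : forall W1 W2 W3, heven (ta W1 W2 W3);
  tR_even : forall W1 W2, heven (tR W1 W2);
  tmap_id : forall (W1 W2 : obj) t, tmap (hid W1) (hid W2) t = t;
  tmap_comp : forall (W1 W2 X1 X2 Z1 Z2 : obj) (f' : ghom X1 Z1) (g' : ghom X2 Z2)
      (f : ghom W1 X1) (g : ghom W2 X2) (p q : bool) t,
    hpar p g' -> hpar q f ->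
    tmap f' g' (tmap f g t) =
    (-1) ^+ (p && q) *: tmap (hcompose f' f) (hcompose g' g) t;
  tl_nat : forall (W X : obj) (f : ghom W X) t,
    tl X (tmap (hid tone) f t) = f (tl W t);
  tr_nat : forall (W X : obj) (f : ghom W X) t,
    tr X (tmap f (hid tone) t) = f (tr W t);
  ta_nat : forall (W1 W2 W3 X1 X2 X3 : obj)
      (f1 : ghom W1 X1) (f2 : ghom W2 X2) (f3 : ghom W3 X3) t,
    ta X1 X2 X3 (tmap f1 (tmap f2 f3) t) = tmap (tmap f1 f2) f3 (ta W1 W2 W3 t);
  tR_nat : forall (W1 W2 X1 X2 : obj) (f : ghom W1 X1) (g : ghom W2 X2)
      (p q : bool) t, hpar p f -> hpar q g ->
    tR X1 X2 (tmap f g t) = (-1) ^+ (p && q) *: tmap g f (tR W1 W2 t);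
  triangle : forall (W X : obj) t,
    tmap (tr W) (hid X) (ta W tone X t) = tmap (hid W) (tl X) t;
  pentagon : forall (W1 W2 W3 W4 : obj) t,
    tmap (ta W1 W2 W3) (hid W4)
      (ta W1 (tens W2 W3) W4 (tmap (hid W1) (ta W2 W3 W4) t)) =
    ta (tens W1 W2) W3 W4 (ta W1 W2 (tens W3 W4) t);
  hexagon1 : forall (W1 W2 W3 : obj) t,
    tR W1 (tens W2 W3) t =
    ta W2 W3 W1 (tmap (hid W2) (tR W1 W3)
      (taV W2 W1 W3 (tmap (tR W1 W2) (hid W3) (ta W1 W2 W3 t))));
  hexagon2 : forall (W1 W2 W3 : obj) t,
    tR (tens W1 W2) W3 t =
    taV W3 W1 W2 (tmap (tR W1 W3) (hid W2)
      (ta W1 W3 W2 (tmap (hid W1) (tR W2 W3) (taV W1 W2 W3 t)))) }.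

End TensorStructure.

(* V_{-1/2}(sl(2|1)); sl(2|1) consists of the 3 x 3 supermatrices of
   supertrace zero, with even indices 0, 1 and odd index 2. *)
Section Sl21.
Context {R : realType}.
Local Notation C := R[i].

Definition modd (i : 'I_3) : bool := i == ord_max.
Definition str (X : 'M[C]_3) : C := \sum_i (-1) ^+ modd i * X i i.
Definition mhomog (b : bool) (X : 'M[C]_3) : Prop :=
  forall i j, modd i (+) modd j != b -> X i j = 0.
(* the superbracket of X, Y of parities b, c *)
Definition sbr (b c : bool) (X Y : 'M[C]_3) : 'M[C]_3 :=
  X *m Y - (-1) ^+ (b && c) *: (Y *m X).

(* The embedding gl(1|1) -> sl(2|1) for which -1/2 str restricts to gform. *)
Definition gmat (a : gl11) : 'M[C]_3 :=
  let d i j : 'M[C]_3 := delta_mx (inord i) (inord j) in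
  match a with
  | gN => - d 1%N 1%N - d 2%N 2%N
  | gE => (-2) *: (d 0%N 0%N + d 2%N 2%N)
  | gP => d 0%N 2%N
  | gM => (-2) *: d 2%N 0%N
  end.

Definition eps (m : int) : C :=
  if 0 < m then 2^-1 else if m == 0 then 0 else - 2^-1.

(* V_{-1/2}(sl(2|1)) as an extension of V = V_1(gl(1|1)): a simple vertex
   superalgebra generated by the fields si X (x), X in sl(2|1), at level -1/2,
   together with the inclusion of V; its underlying V-module is
   the direct sum of the \hat A_{m-eps(m),-2m}.  (The values of si outside
   sl(2|1) are irrelevant.) *)
Record sl21_ext (V : V1gl11 R) := MkSl21Ext {
  acar :> indO V;
  avac : acar;
  aY : acar -> int -> acar -> acar;
  aP : is_vsa avac aY;
  si : 'M[C]_3 -> acar;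
  si_lin : lin_map si;
  si_par : forall b X, str X = 0 -> mhomog b X -> homog b (si X);
  si_0 : forall b c X Y, str X = 0 -> str Y = 0 -> mhomog b X -> mhomog c Y ->
    aY (si X) 0 (si Y) = si (sbr b c X Y);
  si_1 : forall X Y, str X = 0 -> str Y = 0 ->
    aY (si X) 1 (si Y) = (- 2^-1 * str (X *m Y)) *: avac;
  si_2 : forall X Y (n : int), str X = 0 -> str Y = 0 -> 2 <= n ->
    aY (si X) n (si Y) = 0;
  si_gen : forall U : set acar, U avac ->
    (forall (c : C) u v, U u -> U v -> U (c *: u + v)) ->
    (forall X n u, str X = 0 -> U u -> U (aY (si X) n u)) -> U = setT;
  a_simple : irred aY;
  aj : V -> acar;
  aj_lin : lin_map aj;
  aj_par : forall v, aj (par v) = par (aj v);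
  aj_vac : aj (vac V) = avac;
  aj_Y : forall u n v, aj (vY u n v) = aY (aj u) n (aj v);
  aj_gi : forall a, aj (gi V a) = si (gmat a);
  aj_act : forall v n u, gY v n u = aY (aj v) n u;
  a_decomp : exists (B : int -> gmod V) (i : forall m, ghom (B m) acar),
    [/\ forall m, is_Ahat (m%:~R - eps m) (-2 * m) (B m),
        forall x, exists (s : seq int) (y : forall m, B m),
          x = \sum_(m <- s) i m (y m) &
        forall (s : seq int) (y : forall m, B m), uniq s ->
          \sum_(m <- s) i m (y m) = 0 -> forall m, m \in s -> y m = 0] }.

End Sl21.

Section RepCategories.
Context {R : realType} {V : V1gl11 R} (T : HLZ V) (A : sl21_ext V).
Local Notation C := R[i].
Local Notation "W ** X" := (tens T W X) (at level 40).

(* The algebra structure of A in Ind(O_1^fin) corresponding to its vertex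
   operator. *)
Record alg_struct := AlgStruct {
  mu : ghom (A ** A) A;
  mu_even : heven mu;
  muE : forall a h k b, mu (tY T a h k b) = int_modes (@aY _ _ A) a h k b;
  unitA : ghom (tone T) A;
  unitAE : forall v, unitA (tu T v) = aj A v;
  mu_assoc : forall t, mu (tmap T mu (hid A) (ta T A A A t)) = mu (tmap T (hid A) mu t);
  mu_unit : forall t, mu (tmap T unitA (hid A) t) = tl T A t;
  mu_comm : forall t, mu (tR T A A t) = mu t }.

Context (M : alg_struct).

Record repobj := RepObj { rX : indO V; rmu : ghom (A ** rX) rX }.

Record is_rep (X : repobj) : Prop := IsRep {
  rep_even : heven (rmu X);
  rep_assoc : forall t : A ** (A ** rX X),
    rmu X (tmap T (mu M) (hid (rX X)) (ta T A A (rX X) t)) =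
    rmu X (tmap T (hid A) (rmu X) t);
  rep_unit : forall t, rmu X (tmap T (unitA M) (hid (rX X)) t) = tl T (rX X) t }.

Definition is_local (X : repobj) : Prop :=
  forall t, rmu X (tR T (rX X) A (tR T A (rX X) t)) = rmu X t.

Definition in_rep0 (X : repobj) : Prop := is_rep X /\ is_local X.

Definition rep_mor (X Z : repobj) (f : rX X -> rX Z) : Prop :=
  exists F : ghom (rX X) (rX Z), (F : _ -> _) = f /\
    forall t, F (rmu X t) = rmu Z (tmap T (hid A) F t).

Definition indF (W : finO V) : repobj :=
  @RepObj (A ** fin_ind W)
    (hcompose (tmap T (mu M) (hid (fin_ind W))) (ta T A A (fin_ind W))).

End RepCategories.

(* Projective covers in a category whose objects are the X : Ob with mem X and
   whose morphisms are the functions between carriers satisfying mor. *)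
Section ProjectiveCovers.
Context {Ob : Type} {carr : Ob -> Type} (mem : Ob -> Prop)
  (mor : forall X Y, (carr X -> carr Y) -> Prop).

Definition surjection X Y (q : carr X -> carr Y) : Prop :=
  mor q /\ forall y, exists x, q x = y.

Definition projective (P : Ob) : Prop :=
  mem P /\ forall X Y (p : carr X -> carr Y) (f : carr P -> carr Y),
    mem X -> mem Y -> surjection p -> mor f ->
    exists g : carr P -> carr X, mor g /\ forall u, p (g u) = f u.

Definition projective_cover (P S : Ob) : Prop :=
  mem S /\ projective P /\
  exists pi : carr P -> carr S, surjection pi /\
    forall (Q : Ob) (q : carr Q -> carr S), projective Q -> surjection q ->
      exists q' : carr Q -> carr P, surjection q' /\ forall u, q u = pi (q' u).

End ProjectiveCovers.

Section Covers.
Context {R : realType} {V : V1gl11 R}.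

Definition projective_cover_O1fin (P S : finO V) : Prop :=
  @projective_cover (finO V) (fun W => W) (fun _ => True)
    (fun W X f => exists F : ghom W X, (F : _ -> _) = f) P S.

Definition projective_cover_rep0 (T : HLZ V) (A : sl21_ext V)
    (M : alg_struct T A) (P S : repobj T A) : Prop :=
  @projective_cover (repobj T A) (fun X => rX X) (in_rep0 M)
    (@rep_mor R V T A) P S.

End Covers.

(* Main.v *)
(* Conjugating odd maps by a square root of the parity makes every supermorphism
   commute strictly with the modes, so signs disappear. By exactness of induction and
   Frobenius reciprocity, F(P_S) is projective among all modules over the algebra A
   and surjects onto F(S). The point is locality. For m <> 0 the summand of A with
   E_0 = e = -2m is generated by a spectral flow a of the vacuum with N_0 a = n a,
   for which L_{-1} a = h_{-1} a with h = e N + n E, and e n <> 0. Hence tY(a, x) w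
   solves a Knizhnik-Zamolodchikov equation: it has no logarithms and its powers of x
   lie in l + Z when h_0 w = l w. Since A is simple, tY(a, x) does not vanish on S,
   so locality of F(S) forces integral eigenvalues of h_0 on S. The operators N_0 and
   E_0 are semisimple on P_S, and the vectors of the E_0-weight of S on which h_0 has
   integral eigenvalues span a submodule mapping onto S; the cover being essential,
   it is all of P_S. So A and P_S have trivial monodromy. Finally, a submodule of
   F(P_S) mapping onto F(S) contains, by the E_0-grading, vectors of P_S mapping onto
   S, so it is everything. *)
From HB Require Import structures.
From mathcomp Require Import all_boot all_order all_algebra finmap.
From mathcomp Require Import all_classical all_reals all_analysis.
From mathcomp Require Import complex.
From mathcomp Require Import ring lra zify.
Require Import Defs.

Set Implicit Arguments.
Unset Strict Implicit.
Unset Printing Implicit Defensive.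

Import Order.TTheory GRing.Theory Num.Theory.
Local Open Scope classical_set_scope.
Local Open Scope ring_scope.
Local Open Scope complex_scope.

(** * Linear maps, subspaces and diagonalizable operators *)

(** Parity is the obstacle. Morphisms need not be homogeneous, so kernels and images of the
    conjugated maps are stable under V but not under [par], while [simple_mod], [finite_length] and
    the objects know graded submodules only. On modules with N_0 diagonalizable, a substitute parity
    [tau] is read off the N_0-weights. It preserves every submodule, so each submodule carries an
    object structure; finite length becomes a bounded, strictly monotone rank on all submodules.

    The role of e n <> 0: the commutator of h_r and h_{-r} is 2 r e n, so the modes of h form a
    nondegenerate Heisenberg algebra, and every h_0-eigenvector is reached from vectors killed by
    the positive modes, where the equation is solved coefficient by coefficient. The vector a arises
    from a highest-weight vector by applying odd modes down to index -|e|. The odd part of omega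
    then contributes - e E_{-1} a, which the term E_{-1}^2 / 2 compensates; this leaves L_{-1} a =
    h_{-1} a.

    Locality of F(S), restricted to the vectors 1 (x) s, says that A and S have trivial
    monodromy. *)

Section LinearAlgebra.
Context {R : realType}.
Local Notation C := R[i].

Section LinMap.
Variables (U W : lmodType C) (f : U -> W).
Hypothesis fL : lin_map f.

Lemma lmD u v : f (u + v) = f u + f v.
Proof. by have := fL 1 u v; rewrite !scale1r. Qed.

Lemma lm0 : f 0 = 0.
Proof. by have := lmD 0 0; rewrite addr0 => /eqP; rewrite -subr_eq subrr => /eqP <-. Qed.

Lemma lmZ c u : f (c *: u) = c *: f u.
Proof. by have := fL c u 0; rewrite !addr0 lm0 addr0. Qed.

Lemma lmN u : f (- u) = - f u.
Proof. by rewrite -scaleN1r lmZ scaleN1r. Qed.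

Lemma lmB u v : f (u - v) = f u - f v.
Proof. by rewrite lmD lmN. Qed.

Lemma lm_sum (I : Type) (r : seq I) (P : pred I) (F : I -> U) :
  f (\sum_(i <- r | P i) F i) = \sum_(i <- r | P i) f (F i).
Proof.
elim: r => [|x r IH]; first by rewrite !big_nil lm0.
by rewrite !big_cons; case: ifP => _; rewrite ?lmD IH.
Qed.

End LinMap.

Lemma lin_comp (U W Z : lmodType C) (f : W -> Z) (g : U -> W) :
  lin_map f -> lin_map g -> lin_map (fun x => f (g x)).
Proof. by move=> fL gL c u v; rewrite gL fL. Qed.

Lemma lin_add (U W : lmodType C) (f g : U -> W) :
  lin_map f -> lin_map g -> lin_map (fun x => f x + g x).
Proof. by move=> fL gL c u v; rewrite fL gL scalerDr addrACA. Qed.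

Lemma lin_scale (U W : lmodType C) (a : C) (f : U -> W) :
  lin_map f -> lin_map (fun x => a *: f x).
Proof.
by move=> fL c u v; rewrite fL scalerDr !scalerA mulrC.
Qed.

Lemma lin_iter (U : lmodType C) (f : U -> U) n : lin_map f -> lin_map (iter n f).
Proof. by move=> fL; elim: n => [|n IH] c u v //=; rewrite IH fL. Qed.

Record subsp (W : lmodType C) (U : set W) : Prop := Subsp {
  ss0 : U 0;
  ssl : forall c u v, U u -> U v -> U (c *: u + v) }.

Section Subsp.
Variables (W : lmodType C) (U : set W).
Hypothesis hU : subsp U.

Lemma ssD u v : U u -> U v -> U (u + v).
Proof. by move=> *; rewrite -[u]scale1r; apply: ssl. Qed.

Lemma ssZ c u : U u -> U (c *: u).
Proof. by move=> *; rewrite -[_ *: _]addr0; apply: ssl => //; apply: ss0. Qed.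

Lemma ssN u : U u -> U (- u).
Proof. by rewrite -scaleN1r; apply: ssZ. Qed.

Lemma ssB u v : U u -> U v -> U (u - v).
Proof. by move=> *; apply: ssD => //; apply: ssN. Qed.

Lemma ss_sum (I : eqType) (r : seq I) (P : pred I) (F : I -> W) :
  (forall i, i \in r -> P i -> U (F i)) -> U (\sum_(i <- r | P i) F i).
Proof.
elim: r => [|x r IH] h; first by rewrite big_nil; apply: ss0.
rewrite big_cons; have IH' : U (\sum_(j <- r | P j) F j).
  by apply: IH => i ir; apply: h; rewrite inE ir orbT.
by case: ifP => Px //; apply: ssD => //; apply: h => //; rewrite inE eqxx.
Qed.

End Subsp.

Lemma subsp_preim (U W : lmodType C) (f : U -> W) (A : set W) :
  lin_map f -> subsp A -> subsp (fun x => A (f x)).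
Proof.
move=> fL hA; split; first by rewrite lm0 //; apply: ss0.
by move=> c u v Au Av; rewrite fL; apply: ssl.
Qed.

Lemma subsp_eq0 (W : lmodType C) : subsp [set (0 : W)].
Proof. by split=> // c u v -> ->; rewrite scaler0 addr0. Qed.

Lemma subspI (W : lmodType C) (A B : set W) : subsp A -> subsp B -> subsp (A `&` B).
Proof.
by move=> hA hB; split=> [|c u v [Au Bu] [Av Bv]]; split;
  by [apply: ss0|apply: ssl].
Qed.

Definition sumset (W : lmodType C) (A B : set W) : set W :=
  [set x | exists a b, [/\ A a, B b & x = a + b]].

Lemma sumset_l (W : lmodType C) (A B : set W) : subsp B -> A `<=` sumset A B.
Proof. by move=> hB x Ax; exists x, 0; rewrite addr0; split=> //; apply: ss0. Qed.

Lemma sumset_r (W : lmodType C) (A B : set W) : subsp A -> B `<=` sumset A B.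
Proof. by move=> hB x Ax; exists 0, x; rewrite add0r; split=> //; apply: ss0. Qed.

Lemma subsp_sumset (W : lmodType C) (A B : set W) :
  subsp A -> subsp B -> subsp (sumset A B).
Proof.
move=> hA hB; split; first by apply: sumset_l => //; apply: ss0.
move=> c _ _ [a [b [Aa Bb ->]]] [a' [b' [Aa' Bb' ->]]].
exists (c *: a + a'), (c *: b + b'); split; try by apply: ssl.
by rewrite scalerDr addrACA.
Qed.

Definition spanset (W : lmodType C) (G : set W) : set W :=
  [set x | exists s : seq (C * W), x = \sum_(p <- s) p.1 *: p.2 /\
    forall p, p \in s -> G p.2].

Lemma span_sub (W : lmodType C) (G : set W) : G `<=` spanset G.
Proof.
move=> x Gx; exists [:: (1, x)]; rewrite big_seq1 scale1r; split=> //.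
by move=> p; rewrite inE => /eqP ->.
Qed.

Lemma subsp_span (W : lmodType C) (G : set W) : subsp (spanset G).
Proof.
split; first by exists [::]; rewrite big_nil.
move=> c _ _ [s [-> hs]] [t [-> ht]].
exists ([seq (c * p.1, p.2) | p <- s] ++ t); split.
  rewrite big_cat big_map /= scaler_sumr; congr (_ + _).
  by apply: eq_bigr => p _; rewrite scalerA.
move=> p; rewrite mem_cat => /orP[/mapP[q qs ->] /=|]; by [apply: hs|apply: ht].
Qed.

Lemma span_min (W : lmodType C) (G U : set W) :
  subsp U -> G `<=` U -> spanset G `<=` U.
Proof.
move=> hU GU _ [s [-> hs]]; apply: ss_sum => // p ps _.
by apply: ssZ => //; apply/GU/hs.
Qed.

Lemma span_eq (W Z : lmodType C) (G : set W) (f g : W -> Z) :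
  lin_map f -> lin_map g -> (forall x, G x -> f x = g x) ->
  forall x, spanset G x -> f x = g x.
Proof.
move=> fL gL fg x [s [-> hs]]; rewrite !lm_sum //.
rewrite !big_seq; apply: eq_bigr => p ps.
by rewrite !lmZ // fg //; apply: hs.
Qed.

Definition inspan (W : lmodType C) (s : seq W) (w : W) : Prop :=
  exists c : nat -> C, w = \sum_(i < size s) c i *: nth 0 s i.

Lemma inspan_cons (W : lmodType C) (x : W) s w :
  inspan (x :: s) w <-> exists a v, inspan s v /\ w = a *: x + v.
Proof.
split=> [[c ->]|[a [v [[c ->] ->]]]].
  exists (c 0%N), (\sum_(i < size s) c i.+1 *: nth 0 s i).
  by split; [exists (fun i => c i.+1)|rewrite /= big_ord_recl].
exists (fun i => if i is j.+1 then c j else a).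
by rewrite /= big_ord_recl.
Qed.

Lemma inspan_nil (W : lmodType C) (w : W) : inspan [::] w <-> w = 0.
Proof.
by split=> [[c ->]|->]; [rewrite big_ord0|exists (fun=> 0); rewrite big_ord0].
Qed.

Lemma subsp_inspan (W : lmodType C) (s : seq W) : subsp (inspan s).
Proof.
split; first by exists (fun=> 0); rewrite big1 // => i _; rewrite scale0r.
move=> a _ _ [c ->] [d ->]; exists (fun i => a * c i + d i).
rewrite scaler_sumr -big_split /=; apply: eq_bigr => i _.
by rewrite scalerA scalerDl.
Qed.

Lemma inspan_cat (W : lmodType C) (s t : seq W) u v :
  inspan s u -> inspan t v -> inspan (s ++ t) (u + v).
Proof.
elim: s u => [|x s IH] u.
  by move/inspan_nil->; rewrite add0r.
move=> /inspan_cons[a [u' [hu ->]]] hv; apply/inspan_cons.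
by exists a, (u' + v); split; [apply: IH|rewrite addrA].
Qed.

Lemma inspan_map (U W : lmodType C) (f : U -> W) s w :
  lin_map f -> inspan s w -> inspan (map f s) (f w).
Proof.
move=> fL; elim: s w => [|x s IH] w.
  by move=> /inspan_nil ->; apply/inspan_nil; rewrite lm0.
move=> /inspan_cons[a [v [hv ->]]]; apply/inspan_cons.
by exists a, (f v); split; [apply: IH|rewrite fL].
Qed.

(** Elimination along the spanning list: a vector of K with nonzero x-coefficient is a pivot that
    removes x from the others; without one, K lies in the span of the tail. Weight spaces of a
    submodule thus get a spanning list inside the submodule. *)
Lemma fin_dim_sub (W : lmodType C) (s : seq W) (K : set W) :
  subsp K -> (forall w, K w -> inspan s w) ->
  exists t : seq W, (forall x, x \in t -> K x) /\ forall w, K w -> inspan t w.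
Proof.
elim: s K => [|x s IH] K hK Ks; first by exists [::]; split.
have [||t [tK tS]] := IH (K `&` inspan s).
- by apply: subspI => //; apply: subsp_inspan.
- by move=> w [].
have [[k [a [v [Kk hv a0 ek]]]]|nk] :=
    pselect (exists k a v, [/\ K k, inspan s v, a != 0 & k = a *: x + v]).
  exists (k :: t); split=> [y|w Kw].
    by rewrite inE => /orP[/eqP -> //|/tK []].
  have /inspan_cons[b [u [hu ew]]] := Ks _ Kw.
  apply/inspan_cons; exists (b / a), (w - (b / a) *: k); split; last by rewrite addrC subrK.
  apply: tS; split; first by apply: ssB => //; apply: ssZ.
  rewrite ew ek scalerDr scalerA divfK // opprD addrACA subrr add0r.
  by apply: ssB => //; [exact: subsp_inspan|apply: ssZ => //; exact: subsp_inspan].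
exists t; split=> [y /tK []//|w Kw]; apply: tS; split=> //.
have /inspan_cons[b [u [hu ew]]] := Ks _ Kw.
have [b0|b0] := eqVneq b 0; first by rewrite ew b0 scale0r add0r.
by case: nk; exists w, b, u.
Qed.

(** * Generalized eigenspaces and functional calculus *)

Section Eigen.
Variables (W : lmodType C) (T : W -> W).
Hypothesis TL : lin_map T.

Lemma lin_shift h : lin_map (fun u => T u - h *: u).
Proof.
move=> c u v; rewrite TL !scalerDr opprD addrACA !scalerA mulrC; congr (_ + _).
by rewrite scalerN scalerA mulrC.
Qed.

Lemma shiftC h h' u :
  T (T u - h *: u) - h' *: (T u - h *: u) = T (T u - h' *: u) - h *: (T u - h' *: u).
Proof.
rewrite !(lmB TL) !(lmZ TL) !scalerBr !scalerA !opprB mulrC.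
by rewrite addrACA [RHS]addrACA [- _ - _]addrC.
Qed.

(** On a generalized h-eigenvector, (h - h0) w is the difference of (T - h0) w and (T - h) w, and
    the latter lies in U by induction on the nilpotency order. *)
Lemma shift_invertible (U : set W) h h0 k w : subsp U -> (forall u, U u -> U (T u)) ->
  h != h0 -> iter k (fun u => T u - h *: u) w = 0 -> U (T w - h0 *: w) -> U w.
Proof.
move=> hU UT hh; elim: k w => [|k IH] w; first by move=> /= -> _; apply: ss0.
rewrite iterSr => hk hw.
have h1 : U (T w - h *: w).
  apply: IH => //; rewrite shiftC.
  by apply: ssB => //; [apply: UT|apply: ssZ].
have : U ((h - h0)^-1 *: ((T w - h0 *: w) - (T w - h *: w))).
  by apply: ssZ => //; apply: ssB.
rewrite opprB [X in _ *: X]addrC addrA subrK.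
by rewrite -scalerBl scalerA mulVf ?scale1r // subr_eq0.
Qed.

Lemma shift_iter_inv (U : set W) h h0 n k w : subsp U -> (forall u, U u -> U (T u)) ->
  h != h0 -> iter k (fun u => T u - h *: u) w = 0 ->
  U (iter n (fun u => T u - h0 *: u) w) -> U w.
Proof.
move=> hU UT hh; elim: n w => [|n IH] w // hk; rewrite iterSr => hn.
apply: (shift_invertible hU UT hh hk); apply: IH hn.
elim: k w hk => [|k IHk] w; first by move=> /= ->; rewrite lm0 // scaler0 subrr.
by rewrite !iterSr => hk; rewrite shiftC; apply: IHk.
Qed.

Lemma shift_comm h h' n w :
  iter n (fun u => T u - h *: u) (T w - h' *: w) =
  T (iter n (fun u => T u - h *: u) w) - h' *: iter n (fun u => T u - h *: u) w.
Proof. by elim: n => //= n ->; rewrite shiftC. Qed.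

Lemma shift_iter_comm h h' n m w :
  iter n (fun u => T u - h *: u) (iter m (fun u => T u - h' *: u) w) =
  iter m (fun u => T u - h' *: u) (iter n (fun u => T u - h *: u) w).
Proof. by elim: m => //= m IH; rewrite shift_comm IH. Qed.

(** A power of T - h_j removes the j-th term and is invertible on the others, so induction recovers
    these inside U. For U = 0 this is the independence of generalized eigenspaces. *)
Lemma gen_eig_sub (U : set W) (I : eqType) (r : seq I) (h : I -> C) (w : I -> W) :
  subsp U -> (forall u, U u -> U (T u)) -> uniq (map h r) ->
  (forall i, i \in r -> exists n, iter n (fun u => T u - h i *: u) (w i) = 0) ->
  U (\sum_(i <- r) w i) -> forall i, i \in r -> U (w i).
Proof.
move=> hU UT; elim: r w => [|j r IH] w //= /andP[hj ur] hw.
rewrite big_cons => hs.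
have [n hn] := hw j (mem_head _ _).
have Ur i : i \in r -> U (w i).
  move=> ir; have [|k hk] := hw i; first by rewrite inE ir orbT.
  apply: (@shift_iter_inv U (h i) (h j) n k) => //.
    by apply: contraNneq hj => <-; apply: map_f.
  move: i ir {k hk}; apply: IH => // [i ir|].
    have [|k hk] := hw i; first by rewrite inE ir orbT.
    exists k; rewrite shift_iter_comm hk.
    by rewrite (lm0 (lin_iter _ (lin_shift _))).
  have : U (iter n (fun u => T u - h j *: u) (w j + \sum_(i <- r) w i)).
    move: (_ + _) hs => x; elim: n {hn} => //= n IHn hx.
    by apply: ssB => //; [apply: UT|apply: ssZ => //]; apply: IHn.
  by rewrite (lmD (lin_iter _ (lin_shift _))) hn add0r (lm_sum (lin_iter _ (lin_shift _))).
move=> i; rewrite inE => /orP[/eqP ->|]; last exact: Ur.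
rewrite -[w j](addrK (\sum_(i <- r) w i)); apply: ssB => //.
by apply: ss_sum => // k /Ur.
Qed.

Definition eigdec (w : W) (s : seq (C * W)) : Prop :=
  w = \sum_(p <- s) p.2 /\ forall p, p \in s -> T p.2 = p.1 *: p.2.

(** The terms of s may share eigenvalues and lie outside U; only their sums over a common eigenvalue
    are in U, and [phi] is constant on each of these groups. *)
Lemma eigdec_group (U : set W) (phi : C -> C) (s : seq (C * W)) : subsp U ->
  (forall u, U u -> U (T u)) -> (forall p, p \in s -> T p.2 = p.1 *: p.2) ->
  U (\sum_(p <- s) p.2) -> U (\sum_(p <- s) phi p.1 *: p.2).
Proof.
move=> hU UT hs; set r := undup (map fst s).
have grp (F : C * W -> W) : \sum_(p <- s) F p = \sum_(h <- r) \sum_(p <- s | p.1 == h) F p.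
  rewrite (exchange_big_dep xpredT) //= !big_seq; apply: eq_bigr => p ps.
  rewrite -big_filter (bigD1_seq p.1) ?mem_filter ?eqxx ?mem_undup ?map_f ?filter_uniq ?undup_uniq //=.
  by rewrite big_filter_cond big1 ?addr0 // => h /andP[/eqP -> /eqP].
rewrite !grp => hsum; apply: ss_sum => // h hr _.
rewrite (eq_bigr (fun p : C * W => phi h *: p.2)); last by move=> p /eqP ->.
rewrite -scaler_sumr; apply: ssZ => //.
apply: (@gen_eig_sub U _ r id _ hU UT _ _ hsum) => //.
  by rewrite map_id undup_uniq.
move=> k _; exists 1%N; rewrite /= (lm_sum TL) scaler_sumr -sumrB.
rewrite big_seq_cond big1 // => p /andP[ps /eqP <-].
by rewrite hs // subrr.
Qed.

Definition diagz := forall w, exists s, eigdec w s.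

(** The operator phi(T), computed from a chosen eigendecomposition of w; the default 0 covers
    vectors without one. *)
Definition fcalc (phi : C -> C) (w : W) : W :=
  if pselect (exists s, eigdec w s) is left e
  then \sum_(p <- projT1 (cid e)) phi p.1 *: p.2 else 0.

(** Two decompositions of w differ by a decomposition of 0, to which [eigdec_group] applies with U =
    0. *)
Lemma fcalcE phi w s : eigdec w s -> fcalc phi w = \sum_(p <- s) phi p.1 *: p.2.
Proof.
move=> hs; rewrite /fcalc; case: pselect => [e|[]]; last by exists s.
case: (cid e) => /= s' [es' hs'].
pose t := s' ++ [seq (p.1, - p.2) | p <- s].
have e1 : \sum_(p <- t) p.2 = 0.
  by rewrite big_cat big_map /= sumrN -es'; case: (hs) => <- _; rewrite subrr.
have e2 : \sum_(p <- t) phi p.1 *: p.2 =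
   \sum_(p <- s') phi p.1 *: p.2 - \sum_(p <- s) phi p.1 *: p.2.
  rewrite big_cat big_map /= -sumrN; congr (_ + _).
  by apply: eq_bigr => p _; rewrite scalerN.
apply/eqP; rewrite -subr_eq0 -e2; apply/eqP.
apply: (@eigdec_group [set 0] phi t (subsp_eq0 W)) => //.
  by move=> u ->; exact: lm0.
move=> p; rewrite mem_cat => /orP[|/mapP[q qs -> /=]]; first exact: hs'.
by rewrite lmN // (hs.2 _ qs) scalerN.
Qed.

Lemma eigdec_lin c u v s t : eigdec u s -> eigdec v t ->
  eigdec (c *: u + v) ([seq (p.1, c *: p.2) | p <- s] ++ t).
Proof.
move=> [-> hs] [-> ht]; split; first by rewrite big_cat big_map /= scaler_sumr.
move=> p; rewrite mem_cat => /orP[/mapP[q qs ->]|] /=; last exact: ht.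
by rewrite lmZ // hs // !scalerA mulrC.
Qed.

Lemma eigdec1 (l : C) w : T w = l *: w -> eigdec w [:: (l, w)].
Proof. by move=> h; split; [rewrite big_seq1|move=> p; rewrite inE => /eqP ->]. Qed.

Lemma fcalc_eig phi l w : T w = l *: w -> fcalc phi w = phi l *: w.
Proof. by move=> /eigdec1 h; rewrite (fcalcE _ h) big_seq1. Qed.

Lemma fcalc_sub (U : set W) phi w : diagz -> subsp U -> (forall u, U u -> U (T u)) ->
  U w -> U (fcalc phi w).
Proof.
move=> dT hU UT Uw; have [s hs] := dT w; rewrite (fcalcE _ hs).
by apply: (eigdec_group phi hU UT hs.2); rewrite -hs.1.
Qed.

Lemma fcalc_lin phi : diagz -> lin_map (fcalc phi).
Proof.
move=> dT c u v; have [s hs] := dT u; have [t ht] := dT v.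
rewrite (fcalcE _ (eigdec_lin c hs ht)) (fcalcE _ hs) (fcalcE _ ht).
rewrite big_cat big_map /= scaler_sumr; congr (_ + _).
by apply: eq_bigr => p _; rewrite !scalerA mulrC.
Qed.

End Eigen.

(** The shift c covers morphisms (c = 0) as well as odd modes, which move N_0-weights by 1 or -1. *)
Lemma fcalc_comm (W Z : lmodType C) (T : W -> W) (T' : Z -> Z) (f : W -> Z) phi psi c :
  lin_map T -> lin_map T' -> diagz T -> diagz T' -> lin_map f ->
  (forall l w, T w = l *: w -> T' (f w) = (l + c) *: f w) ->
  (forall l, phi (l + c) = psi l) ->
  forall w, fcalc T' phi (f w) = f (fcalc T psi w).
Proof.
move=> TL TL' dT dT' fL hf hphi w; have [s [-> hs]] := dT w.
rewrite !lm_sum //; try exact: fcalc_lin.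
rewrite !big_seq; apply: eq_bigr => p ps.
rewrite (fcalc_eig TL _ (hs _ ps)) (fcalc_eig TL' _ (hf _ _ (hs _ ps))).
by rewrite hphi lmZ.
Qed.

(** The range of f is T-stable, hence contains the part of f z at each eigenvalue; injectivity
    carries these parts back. *)
Lemma eigdec_pull (W Z : lmodType C) (T : W -> W) (T' : Z -> Z) (f : Z -> W) z s :
  lin_map T -> lin_map T' -> lin_map f -> injective f ->
  (forall z, f (T' z) = T (f z)) -> eigdec T (f z) s -> exists t, eigdec T' z t.
Proof.
move=> TL TL' fL fI fT [es hs].
pose r := undup (map fst s).
pose F h := \sum_(p <- s | p.1 == h) p.2.
have TF h : T (F h) = h *: F h.
  rewrite lm_sum // scaler_sumr big_seq_cond [RHS]big_seq_cond.
  by apply: eq_bigr => p /andP[ps /eqP <-]; apply: hs.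
have eF : f z = \sum_(h <- r) F h.
  rewrite es (exchange_big_dep xpredT) //= !big_seq; apply: eq_bigr => p ps.
  rewrite -big_filter (bigD1_seq p.1) ?mem_filter ?eqxx ?mem_undup ?map_f ?filter_uniq ?undup_uniq //=.
  by rewrite big_filter_cond big1 ?addr0 // => h /andP[/eqP -> /eqP].
have rf : subsp (range f).
  split; first by exists 0 => //; rewrite lm0.
  by move=> c _ _ [u _ <-] [v _ <-]; exists (c *: u + v) => //; rewrite fL.
have FU h : h \in r -> range f (F h).
  apply: (@gen_eig_sub W T TL (range f) _ r id F rf).
  - by move=> _ [u _ <-]; exists (T' u).
  - by rewrite map_id undup_uniq.
  - by move=> k _; exists 1%N; rewrite /= TF subrr.
  - by rewrite -eF; exists z.
pose g h := if pselect (exists x, f x = F h) is left e then projT1 (cid e) else 0.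
have fg h : h \in r -> f (g h) = F h.
  move=> /FU[x _ ex]; rewrite /g; case: pselect => [e|[]]; last by exists x.
  by case: (cid e).
exists [seq (h, g h) | h <- r]; split.
  apply: fI; rewrite big_map lm_sum // eF !big_seq; apply: eq_bigr => h hr.
  by rewrite fg.
move=> p /mapP[h hr ->] /=; apply: fI.
by rewrite fT fg // lmZ // fg.
Qed.

End LinearAlgebra.

(** * Parity and signs *)

Section SubLmodule.
Context {R : realType} (W : lmodType R[i]).

(** A [set] that is a subspace becomes a subtype with its own [lmodType], so that submodules can be
    fed to universal properties and turned into objects. *)
Record subs := Subs { sset :> set W; subsP : subsp sset }.

Definition subs_pred (S : subs) : {pred W} := fun w => `[< sset S w >].

Lemma subs_predE S w : (w \in subs_pred S) = `[< sset S w >].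
Proof. by []. Qed.

Lemma subs_closed (S : subs) : submod_closed (subs_pred S).
Proof.
split; first by rewrite subs_predE; apply/asboolP; exact: (ss0 (subsP S)).
move=> c u v; rewrite !subs_predE => /asboolP Su /asboolP Sv; apply/asboolP.
exact: (ssl (subsP S)).
Qed.

HB.instance Definition _ (S : subs) :=
  GRing.isSubmodClosed.Build R[i] W (subs_pred S) (subs_closed S).

Record subs_of (S : subs) := SubsOf { sv : W; _ : sv \in subs_pred S }.

HB.instance Definition _ (S : subs) := [isSub for @sv S].
HB.instance Definition _ (S : subs) := [Choice of subs_of S by <:].
HB.instance Definition _ (S : subs) := [SubChoice_isSubLmodule of subs_of S by <:].

Lemma sv_lin S : lin_map (@sv S : subs_of S -> W).
Proof. by []. Qed.

Lemma sv_in S (x : subs_of S) : sset S (sv x).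
Proof. by case: x => x /= /asboolP. Qed.

Lemma sv_inj S : injective (@sv S).
Proof. exact: val_inj. Qed.

Definition mksv (S : subs) w (h : sset S w) : subs_of S := SubsOf (asboolT h).

Lemma sv_lin_ker S (U : lmodType R[i]) (f : U -> subs_of S) :
  lin_map (fun u => sv (f u)) -> lin_map f.
Proof. by move=> h c u v; apply: sv_inj; rewrite h. Qed.

End SubLmodule.

HB.lock Definition pev {R : realType} {W : sspace R} (w : W) : W := 2^-1 *: (w + par w).
HB.lock Definition pod {R : realType} {W : sspace R} (w : W) : W := 2^-1 *: (w - par w).

(* Conjugation by [J 'i] turns the sign rule of supermorphisms into strict
   commutation with all modes. *)
HB.lock Definition J {R : realType} (z : R[i]) {W : sspace R} (w : W) : W :=
  pev w + z *: pod w.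

Section Parity.
Context {R : realType}.
Local Notation C := R[i].

Lemma parD (W : sspace R) (u v : W) : par (u + v) = par u + par v.
Proof. by rewrite (lmD (@par_lin _ W)). Qed.

Lemma parZ (W : sspace R) c (u : W) : par (c *: u) = c *: par u.
Proof. by rewrite (lmZ (@par_lin _ W)). Qed.

Lemma parN (W : sspace R) (u : W) : par (- u) = - par u.
Proof. by rewrite (lmN (@par_lin _ W)). Qed.

Lemma pevE (W : sspace R) (w : W) : pev w = 2^-1 *: (w + par w).
Proof. by rewrite pev.unlock. Qed.

Lemma podE (W : sspace R) (w : W) : pod w = 2^-1 *: (w - par w).
Proof. by rewrite pod.unlock. Qed.

Lemma half2 (W : lmodType C) (w : W) : (2^-1 : C) *: (w + w) = w.
Proof.
rewrite scalerDr -scalerDl (_ : 2^-1 + 2^-1 = 1 :> C) ?scale1r //.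
by rewrite [RHS]splitr mul1r.
Qed.

Lemma pev_lin (W : sspace R) : lin_map (@pev R W).
Proof. rewrite pev.unlock. apply: lin_scale; apply: lin_add => //; exact: par_lin. Qed.

Lemma pod_lin (W : sspace R) : lin_map (@pod R W).
Proof.
rewrite pod.unlock; apply: lin_scale; apply: lin_add => // c u v.
by rewrite parD parZ opprD scalerN.
Qed.

Lemma pevpod (W : sspace R) (w : W) : pev w + pod w = w.
Proof. by rewrite pevE podE -scalerDr addrACA subrr addr0 half2. Qed.

Lemma par_pev (W : sspace R) (w : W) : par (pev w) = pev w.
Proof. by rewrite !pevE parZ parD parK addrC. Qed.

Lemma par_pod (W : sspace R) (w : W) : par (pod w) = - pod w.
Proof. by rewrite !podE parZ parD parN parK -scalerN opprB addrC. Qed.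

Lemma pev_fix (W : sspace R) (w : W) : par w = w -> pev w = w.
Proof. by rewrite !pevE => ->; rewrite half2. Qed.

Lemma pev_odd (W : sspace R) (w : W) : par w = - w -> pev w = 0.
Proof. by rewrite !pevE => ->; rewrite subrr scaler0. Qed.

Lemma pod_fix (W : sspace R) (w : W) : par w = w -> pod w = 0.
Proof. by rewrite !podE => ->; rewrite subrr scaler0. Qed.

Lemma pod_odd (W : sspace R) (w : W) : par w = - w -> pod w = w.
Proof. by rewrite !podE => ->; rewrite opprK half2. Qed.

Lemma pev_pev (W : sspace R) (w : W) : pev (pev w) = pev w.
Proof. exact/pev_fix/par_pev. Qed.
Lemma pev_pod (W : sspace R) (w : W) : pev (pod w) = 0.
Proof. exact/pev_odd/par_pod. Qed.
Lemma pod_pev (W : sspace R) (w : W) : pod (pev w) = 0.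
Proof. exact/pod_fix/par_pev. Qed.
Lemma pod_pod (W : sspace R) (w : W) : pod (pod w) = pod w.
Proof. exact/pod_odd/par_pod. Qed.

Lemma homogP (W : sspace R) b (w : W) : homog b w <-> par w = if b then - w else w.
Proof. by rewrite /homog; case: b; rewrite ?expr1 ?scaleN1r ?expr0 ?scale1r. Qed.

Lemma homog_pev (W : sspace R) (w : W) : homog false (pev w).
Proof. by apply/homogP/par_pev. Qed.
Lemma homog_pod (W : sspace R) (w : W) : homog true (pod w).
Proof. by apply/homogP/par_pod. Qed.

Lemma parb_lin (W : sspace R) b : lin_map (@parb _ W b).
Proof. by case: b => //; apply: par_lin. Qed.

Lemma parb_homog (W : sspace R) b b' (w : W) :
  homog b w -> parb b' w = (-1) ^+ (b && b') *: w.
Proof.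
move/homogP; case: b b' => [] [] //= hw; rewrite ?hw ?expr1 ?scaleN1r ?expr0 ?scale1r //.
Qed.

Lemma pev_comm (W X : sspace R) (f : W -> X) : lin_map f ->
  (forall w, f (par w) = par (f w)) -> forall w, pev (f w) = f (pev w).
Proof. by move=> fL fp w; rewrite !pevE (lmZ fL) (lmD fL) fp. Qed.

Lemma pod_comm (W X : sspace R) (f : W -> X) : lin_map f ->
  (forall w, f (par w) = par (f w)) -> forall w, pod (f w) = f (pod w).
Proof. by move=> fL fp w; rewrite !podE (lmZ fL) (lmB fL) fp. Qed.

Lemma JE z (W : sspace R) (w : W) : J z w = pev w + z *: pod w.
Proof. by rewrite J.unlock. Qed.

Lemma J_lin z (W : sspace R) : lin_map (@J R z W).
Proof. rewrite J.unlock; by apply: lin_add; [exact: pev_lin|apply: lin_scale; exact: pod_lin]. Qed.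

Lemma J_J z z' (W : sspace R) (w : W) : J z (J z' w) = J (z * z') w.
Proof.
have hv (u v : W) c : pev (u + c *: v) = pev u + c *: pev v.
  by rewrite (lmD (@pev_lin W)) (lmZ (@pev_lin W)).
have ho (u v : W) c : pod (u + c *: v) = pod u + c *: pod v.
  by rewrite (lmD (@pod_lin W)) (lmZ (@pod_lin W)).
rewrite !JE hv ho pev_pev pev_pod pod_pev pod_pod.
by rewrite scaler0 addr0 add0r scalerA.
Qed.

Lemma J1 (W : sspace R) (w : W) : J 1 w = w.
Proof. by rewrite !JE scale1r pevpod. Qed.

Lemma sqri : ('i * 'i : C) = -1.
Proof. by rewrite -expr2 sqr_i. Qed.

Lemma J_K (W : sspace R) : cancel (@J R 'i W) (@J R (- 'i) W).
Proof. by move=> w; rewrite J_J mulNr sqri opprK J1. Qed.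

Lemma J_VK (W : sspace R) : cancel (@J R (- 'i) W) (@J R 'i W).
Proof. by move=> w; rewrite J_J mulrN sqri opprK J1. Qed.

Definition conjJ (z : C) (W X : sspace R) (f : W -> X) : W -> X :=
  fun w => J z (f (J (- z) w)).

Lemma conjJ_lin z (W X : sspace R) (f : W -> X) : lin_map f -> lin_map (conjJ z f).
Proof. by move=> fL; apply: lin_comp; [exact: J_lin|apply: lin_comp => //; exact: J_lin]. Qed.

Lemma conjJK (W X : sspace R) (f : W -> X) w : conjJ (- 'i) (conjJ 'i f) w = f w.
Proof. by rewrite /conjJ !opprK !J_K. Qed.

Lemma conjJVK (W X : sspace R) (f : W -> X) w : conjJ 'i (conjJ (- 'i) f) w = f w.
Proof. by rewrite /conjJ !opprK !J_VK. Qed.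

Lemma conjJ_comp (W X Z : sspace R) (g : X -> Z) (f : W -> X) w :
  conjJ 'i (fun x => g (f x)) w = conjJ 'i g (conjJ 'i f w).
Proof. by rewrite /conjJ J_K. Qed.

Lemma J_comm z (W X : sspace R) (f : W -> X) : lin_map f ->
  (forall w, f (par w) = par (f w)) -> forall w, J z (f w) = f (J z w).
Proof. by move=> fL fp w; rewrite !JE (pev_comm fL fp) (pod_comm fL fp) addrC -fL addrC. Qed.

Lemma conjJ_even z (W X : sspace R) (f : W -> X) w : z * z = -1 -> lin_map f ->
  (forall w, f (par w) = par (f w)) -> conjJ z f w = f w.
Proof. by move=> hz fL fp; rewrite /conjJ (J_comm _ fL fp) J_J mulrN hz opprK J1. Qed.

Section OneOp.
Variable V : sspace R.
Variables (A B : sspace R) (op : V -> A -> B).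
Hypothesis opl : forall v, lin_map (op v).
Hypothesis opv : forall a, lin_map (op ^~ a).
Hypothesis opp : forall v a, par (op v a) = op (par v) (par a).

Lemma J_op_even z v a : homog false v -> J z (op v a) = op v (J z a).
Proof. by move=> /homogP hv; rewrite (J_comm _ (opl v)) // => x; rewrite opp hv. Qed.

Lemma J_op_odd z v a : homog true v -> J z (op v a) = op v (pod a + z *: pev a).
Proof.
move=> /homogP hv; rewrite !JE [pod a + _]addrC opl addrC; congr (_ *: _ + _); last first.
  by rewrite podE (lmZ (opl v)) (lmB (opl v)) pevE opp hv (lmN (opv _)).
by rewrite pevE (lmZ (opl v)) (lmD (opl v)) podE opp hv (lmN (opv _)) opprK.
Qed.

Lemma J_op_oddE z v a : z * z = -1 -> homog true v ->
  J z (op v a) = op v (z *: J (- z) a).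
Proof.
move=> hz hv; rewrite J_op_odd //; congr (op v _).
by rewrite !JE scalerDr scalerA mulrN hz opprK scale1r addrC.
Qed.
End OneOp.

Lemma par_J z (A : sspace R) (a : A) : par (J z a) = J (- z) a.
Proof. by rewrite !JE parD parZ par_pev par_pod scalerN scaleNr. Qed.

Lemma J_par z (A : sspace R) (a : A) : J z (par a) = J (- z) a.
Proof. by rewrite -par_J (J_comm _ (@par_lin _ A)). Qed.

Section Transfer.
Variables (V W W' X X' : sspace R) (opW : V -> W -> W') (opX : V -> X -> X').
Hypothesis opWl : forall v, lin_map (opW v).
Hypothesis opXl : forall v, lin_map (opX v).
Hypothesis opWv : forall w, lin_map (opW ^~ w).
Hypothesis opXv : forall x, lin_map (opX ^~ x).
Hypothesis opWp : forall v w, par (opW v w) = opW (par v) (par w).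
Hypothesis opXp : forall v x, par (opX v x) = opX (par v) (par x).

(** The map f on arguments and the map F on values are kept apart: for modes of a module they
    coincide, for the coefficients of a tensor product they do not. *)
Definition supercomm (f : W -> X) (F : W' -> X') := forall b v w, homog b v ->
  F (opW v w) = opX v (parb b (f (parb b w))).
Definition strictcomm (f : W -> X) (F : W' -> X') := forall v w, F (opW v w) = opX v (f w).

Variables (f : W -> X) (F : W' -> X').
Hypothesis fL : lin_map f.
Hypothesis FL : lin_map F.

(** Moving [J z] past an odd v turns it into [z *: J (- z)]. The two parity twists in [supercomm]
    restore the sign inside [J], and the two scalars multiply to - z^2 = 1. *)
Lemma supercomm_strict z : z * z = -1 -> supercomm f F ->
  strictcomm (conjJ z f) (conjJ z F).
Proof.
move=> hz h v w; have hz' : - z * - z = -1 by rewrite mulrNN.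
have hev u : homog false u -> conjJ z F (opW u w) = opX u (conjJ z f w).
  by move=> hu; rewrite /conjJ (J_op_even opWl) // (h false) //= (J_op_even opXl).
have hod u : homog true u -> conjJ z F (opW u w) = opX u (conjJ z f w).
  move=> hu; rewrite /conjJ (J_op_oddE opWl) // opprK (h true) //= (J_op_oddE opXl) //.
  rewrite J_par opprK !parZ par_J (lmZ fL) (lmZ (@J_lin _ _)) scalerA mulrN hz.
  by rewrite opprK scale1r.
rewrite -[v]pevpod (lmD (opWv _)) (lmD (opXv _)) (lmD (conjJ_lin _ FL)).
by rewrite hev ?hod //; [exact: homog_pod|exact: homog_pev].
Qed.

Lemma strict_supercomm z : z * z = -1 -> strictcomm f F ->
  supercomm (conjJ z f) (conjJ z F).
Proof.
move=> hz h [] v w hv /=; have hz' : - z * - z = -1 by rewrite mulrNN.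
  rewrite /conjJ (J_op_oddE opWl) // opprK h (J_op_oddE opXl) //.
  rewrite par_J J_par opprK (lmZ fL) (lmZ (@J_lin _ _)) scalerA mulrN hz.
  by rewrite opprK scale1r.
by rewrite /conjJ (J_op_even opWl) // h (J_op_even opXl).
Qed.

End Transfer.
End Parity.

(** * The action of the affine Lie superalgebra *)

Section Binomials.
Context {R : realType}.
Local Notation C := R[i].

Lemma gbin0 (l : int) : gbin l 0 = 1 :> C.
Proof. by rewrite /gbin big_ord0 fact0 divr1. Qed.

Lemma gbinS (l : int) i : gbin l i.+1 = gbin l i * (l%:~R - i%:R) / i.+1%:R :> C.
Proof.
rewrite /gbin big_ord_recr /= factS mulnC natrM invfM !mulrA.
by rewrite -!mulrA; congr (_ * _); rewrite mulrCA.
Qed.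

Lemma gbin0S i : gbin 0 i.+1 = 0 :> C.
Proof.
elim: i => [|i IH]; rewrite gbinS ?IH ?mul0r //.
by rewrite subrr mulr0 mul0r.
Qed.

Lemma gbinN1 i : gbin (-1) i = (-1) ^+ i :> C.
Proof.
elim: i => [|i IH]; first by rewrite gbin0.
rewrite gbinS IH exprS.
have -> : (-1)%:~R - i%:R = - i.+1%:R :> C by rewrite rmorphN1 -opprD -natr1 addrC.
by rewrite mulN1r mulrN mulNr mulfK // pnatr_eq0.
Qed.

Lemma gbinN2 i : gbin (-2) i = (-1) ^+ i * i.+1%:R :> C.
Proof.
elim: i => [|i IH]; first by rewrite gbin0 mulr1.
rewrite gbinS IH exprS.
have -> : (-2)%:~R - i%:R = - i.+2%:R :> C.
  by rewrite mulrNz -opprD -[in RHS]addn2 natrD addrC.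
rewrite mulN1r mulrN !mulNr; congr (- _); rewrite mulrAC mulfK // pnatr_eq0 //.
Qed.

Lemma gbin11 : gbin 1 1 = 1 :> C.
Proof. by rewrite gbinS gbin0 subr0 mul1r divr1. Qed.

Lemma gbin1S i : gbin 1 i.+2 = 0 :> C.
Proof.
elim: i => [|i IH]; rewrite gbinS ?IH ?mul0r //.
by rewrite gbin11 subrr mulr0 mul0r.
Qed.

End Binomials.

Section VMod.
Context {R : realType} (V : V1gl11 R) (W : sspace R) (Y : V -> int -> W -> W).
Hypothesis hY : vmod_ax (vac V) (@vY _ V) Y.
Local Notation C := R[i].
Local Notation YV := (@vY _ V).

Let Yl n w := vm_linl hY n w.
Let Yr v n := vm_linr hY v n.

Lemma vm_comm b u v w (m n : int) : homog b u ->
  exists K0, forall K, (K0 <= K)%N ->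
    Y u m (Y v n w) - Y (parb b v) n (Y u m w) =
    \sum_(i < K) gbin m i *: Y (YV u i%:Z v) (m + n - i%:Z) w.
Proof.
move=> hu; have [K0 hK] := vm_borcherds hY v w 0 m n hu.
exists K0.+1 => K; case: K => // K le; have := hK K.+1 (ltnW le).
under eq_bigr do rewrite add0r.
move=> ->; rewrite big_ord_recl big1 ?addr0; last first.
  by move=> i _; rewrite gbin0S mulr0 scale0r.
by rewrite gbin0 expr0 mulr1 scale1r /= expr0z scale1r ?addr0 ?subr0.
Qed.

Lemma vm_iter b u v w (l n : int) : homog b u ->
  exists K0, forall K, (K0 <= K)%N ->
    Y (YV u l v) n w =
    \sum_(i < K) ((-1) ^+ i * gbin l i) *:
      (Y u (l - i%:Z) (Y v (n + i%:Z) w)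
       - (-1) ^ l *: Y (parb b v) (n + l - i%:Z) (Y u i%:Z w)).
Proof.
move=> hu; have [K0 hK] := vm_borcherds hY v w l 0 n hu.
exists K0.+1 => K; case: K => // K le; have := hK K.+1 (ltnW le).
under [X in _ = X]eq_bigr do rewrite !add0r.
move=> <-; rewrite big_ord_recl big1 ?addr0; last first.
  by move=> i _; rewrite gbin0S scale0r.
by rewrite gbin0 scale1r /= ?addr0 ?add0r ?subr0.
Qed.

Lemma par_gi a : par (gi V a) = (-1) ^+ godd a *: gi V a.
Proof. exact: gi_par. Qed.

Lemma vm_aff : is_aff1 (fun a => Y (gi V a)).
Proof.
split=> [a n|a b r s w]; first exact: Yr.
have [K0 hK] := vm_comm (gi V b) w r s (@gi_par _ V a).
have := hK K0.+2; rewrite -addn2 => /(_ (leq_addr _ _)).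
rewrite (parb_homog _ (@gi_par _ V b)) (lmZ (Yl _ _)) andbC => ->.
rewrite addn2 !big_ord_recl big1 ?addr0; last first.
  by move=> i _; rewrite gi_2 // (lm0 (Yl _ _)) scaler0.
rewrite gbin0 scale1r /= gi_0 gi_1 ?subr0 !(lmZ (Yl _ _)) (vm_vac hY).
rewrite (_ : (r + s - 1 == -1) = (r + s == 0)); last first.
  by rewrite -[-1]add0r (can_eq (addrK _)).
congr (_ + _); case: ifP => _; last by rewrite !scaler0.
by rewrite gbinS gbin0 mul1r subr0 divr1 scalerA.
Qed.

End VMod.

(** * Generation of V and of induced modules by the currents *)

Section Generation.
Context {R : realType}.
Local Notation C := R[i].

(** Universality maps the induced module to its submodule U; followed by the inclusion, this is an
    endomorphism fixing v, hence the identity by uniqueness. *)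
Lemma induced_gen
    (rel : forall M : lmodType C, (gl11 -> int -> M -> M) -> M -> Prop)
    (M : lmodType C) (act : gl11 -> int -> M -> M) (v : M) (U : set M) :
  (forall (S : subs M) (act' : gl11 -> int -> subs_of S -> subs_of S) (v' : subs_of S),
     (forall a n x, sv (act' a n x) = act a n (sv x)) -> sv v' = v -> rel M act v ->
     rel _ act' v') ->
  induced rel act v -> subsp U -> U v ->
  (forall a n u, U u -> U (act a n u)) -> forall x, U x.
Proof.
move=> hrel [aA rA univ] hU Uv Ua x.
pose S := Subs hU.
pose act' a n (y : subs_of S) : subs_of S :=
  mksv (Ua a n (sv y) (sv_in y) : sset S _).
pose v' : subs_of S := mksv (Uv : sset S v).
have aA' : is_aff1 act'.
  split=> [a n|a b r s y].
    by apply: sv_lin_ker => c u w /=; rewrite (aff_lin aA).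
  apply: sv_inj => /=; have := aff_rel aA a b r s (sv y).
  by case: ifP => _ <-.
have rA' : rel _ act' v' by apply: hrel.
have [f [[[fL fa] fv] _]] := univ _ _ _ aA' rA'.
have [g [_ gU]] := univ _ _ _ aA rA.
have e1 : g = id by apply: gU; split=> //; split.
have e2 : g = (fun x => sv (f x)).
  by apply: gU; split; [split=> [c u w|a n w]; rewrite ?fL ?fa|rewrite fv].
by rewrite -[x]/(id x) -e1 e2; apply: (sv_in (f x)).
Qed.

Lemma rel_A_sub n (M : lmodType C) act v (S : subs M)
    (act' : gl11 -> int -> subs_of S -> subs_of S) (v' : subs_of S) :
  (forall a n x, sv (act' a n x) = act a n (sv x)) -> sv v' = v -> rel_A n act v ->
  rel_A n act' v'.
Proof.
move=> ha hv [h1 h2 h3 h4 h5]; split=> [a r r0||||]; apply: sv_inj;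
  by rewrite ha hv ?h2 ?h3 ?h4 ?h5 ?h1 // ?(lmZ (@sv_lin _ _ S)) ?(lm0 (@sv_lin _ _ S)) ?hv.
Qed.

Lemma rel_V_sub n e (M : lmodType C) act v (S : subs M)
    (act' : gl11 -> int -> subs_of S -> subs_of S) (v' : subs_of S) :
  (forall a n x, sv (act' a n x) = act a n (sv x)) -> sv v' = v -> rel_V n e act v ->
  rel_V n e act' v'.
Proof.
move=> ha hv [h1 h2 h3 h4]; split=> [a r r0|||]; apply: sv_inj;
  by rewrite ha hv ?h2 ?h3 ?h4 ?h1 // ?(lmZ (@sv_lin _ _ S)) ?(lm0 (@sv_lin _ _ S)) ?hv.
Qed.

Variable V : V1gl11 R.

Lemma gi_gen (U : set V) : subsp U -> U (vac V) ->
  (forall a n u, U u -> U (vY (gi V a) n u)) -> forall v, U v.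
Proof.
move=> hU Uv Ua v; refine (induced_gen _ (gi_ind V) hU Uv Ua v).
by move=> S act' v' ha hv; apply: (rel_A_sub ha hv).
Qed.

Lemma par_vac : par (vac V) = vac V.
Proof.
have hV := vsa_mod (vP V).
rewrite -(vsa_create (vP V) (par (vac V))) -[X in vY _ _ X]parK -(vm_par hV).
by rewrite (vm_vac hV) eqxx parK.
Qed.

Lemma parb_vac b : parb b (vac V) = vac V.
Proof. by case: b; rewrite //= par_vac. Qed.

Lemma parbC (W : sspace R) b c (w : W) : parb b (parb c w) = parb c (parb b w).
Proof. by case: b c => [] []. Qed.

Lemma parb_add (W : sspace R) b c (w : W) : parb b (parb c w) = parb (b (+) c) w.
Proof. by case: b c => [] [] //=; rewrite parK. Qed.

Lemma vY_parb c u n (v : V) : parb c (vY u n v) = vY (parb c u) n (parb c v).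
Proof. by case: c => //=; rewrite (vm_par (vsa_mod (vP V))). Qed.

(* [c = true] allows a map which twists the action by the parity of V. *)
Lemma vhom_ext (W X : sspace R) (Y : V -> int -> W -> W) (Z : V -> int -> X -> X)
    (f : W -> X) (c : bool) :
  vmod_ax (vac V) (@vY _ V) Y -> vmod_ax (vac V) (@vY _ V) Z -> lin_map f ->
  (forall a n w, f (Y (gi V a) n w) = Z (parb c (gi V a)) n (f w)) ->
  forall v n w, f (Y v n w) = Z (parb c v) n (f w).
Proof.
move=> hY hZ fL hg.
(* The twists [parb b] are built into the induction because the iterate formula for a_l v involves
   the parity twist of v. *)
pose U := [set v : V | forall b n w, f (Y (parb b v) n w) = Z (parb c (parb b v)) n (f w)].
suff hU : forall v, U v by move=> v n w; apply: (hU v false).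
apply: gi_gen.
- split=> [b n w|k u v Uu Uv b n w].
    by rewrite !(lm0 (parb_lin _)) (lm0 (vm_linl hY _ _)) (lm0 (vm_linl hZ _ _)) lm0.
  by rewrite !parb_lin (vm_linl hY) (vm_linl hZ) fL Uu Uv.
- move=> b n w.
  rewrite !parb_vac.
  by rewrite (vm_vac hY) (vm_vac hZ); case: ifP; rewrite ?lm0.
move=> a l v Uv b n w; rewrite vY_parb (parb_homog b (@gi_par _ V a)).
rewrite (lmZ (vm_linl (vsa_mod (vP V)) _ _)) (lmZ (parb_lin c)).
rewrite (lmZ (vm_linl hY _ _)) (lmZ (vm_linl hZ _ _)) (lmZ fL); congr (_ *: _).
have hgc : homog (godd a) (parb c (gi V a)).
  rewrite (parb_homog c (@gi_par _ V a)) /homog parZ par_gi.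
  by rewrite !scalerA mulrC.
rewrite vY_parb.
have [K1 h1] := vm_iter hY (parb b v) w l n (@gi_par _ V a).
have [K2 h2] := vm_iter hZ (parb c (parb b v)) (f w) l n hgc.
rewrite (h1 (maxn K1 K2)) ?leq_maxl // (h2 (maxn K1 K2)) ?leq_maxr //.
rewrite (lm_sum fL); apply: eq_bigr => i _; rewrite (lmZ fL) (lmB fL) (lmZ fL).
rewrite !hg Uv -hg [parb _ (parb c _)]parbC.
congr (_ *: (_ - _ *: _)).
have -> : parb (godd a) (parb b v) = parb (godd a (+) b) v.
  exact: parb_add.
by rewrite Uv.
Qed.

Lemma vstable_ext (W : sspace R) (Y : V -> int -> W -> W) (U : set W) :
  vmod_ax (vac V) (@vY _ V) Y -> subsp U ->
  (forall a n w, U w -> U (Y (gi V a) n w)) ->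
  forall v n w, U w -> U (Y v n w).
Proof.
move=> hY hU hg.
pose U' := [set v : V | forall b n w, U w -> U (Y (parb b v) n w)].
suff hU' : forall v, U' v by move=> v n w; apply: (hU' v false).
apply: gi_gen.
- split=> [b n w|k u v Uu Uv b n w Uw].
    by rewrite !(lm0 (parb_lin _)) (lm0 (vm_linl hY _ _)) => _; apply: ss0.
  by rewrite !parb_lin (vm_linl hY); apply: ssl => //; [apply: Uu|apply: Uv].
- move=> b n w Uw.
  rewrite parb_vac.
  by rewrite (vm_vac hY); case: ifP => // _; apply: ss0.
move=> a l v Uv b n w Uw; rewrite vY_parb (parb_homog b (@gi_par _ V a)).
rewrite (lmZ (vm_linl (vsa_mod (vP V)) _ _)).
rewrite (lmZ (vm_linl hY _ _)); apply: ssZ => //.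
have [K1 h1] := vm_iter hY (parb b v) w l n (@gi_par _ V a).
rewrite (h1 K1) //; apply: ss_sum => // i _ _; apply: ssZ => //; apply: ssB => //.
  by apply: hg; apply: Uv.
apply: ssZ => //.
have -> : parb (godd a) (parb b v) = parb (godd a (+) b) v.
  exact: parb_add.
by apply: Uv; apply: hg.
Qed.

End Generation.

(** * The conformal vector and spectral flows of the vacuum *)

Section Omega.
Context {R : realType} (V : V1gl11 R) (W : sspace R) (Y : V -> int -> W -> W).
Hypothesis hY : vmod_ax (vac V) (@vY _ V) Y.
Local Notation C := R[i].
Local Notation Yg a := (Y (gi V a)).

Let Yl n w := vm_linl hY n w.
Let Yr v n := vm_linr hY v n.

Definition qv (a b : gl11) : V := vY (gi V a) (-1) (vY (gi V b) (-1) (vac V)).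

Lemma q_mode a b n w : exists K0, forall K, (K0 <= K)%N ->
  Y (qv a b) n w = \sum_(i < K)
    (Yg a (-1 - i%:Z) (Yg b (n + i%:Z) w)
     + (-1) ^+ (godd a && godd b) *: Yg b (n - 1 - i%:Z) (Yg a i%:Z w)).
Proof.
rewrite /qv (vsa_create (vP V)).
have [K0 hK] := vm_iter hY (gi V b) w (-1) n (@gi_par _ V a).
exists K0 => K /hK ->; apply: eq_bigr => i _.
rewrite gbinN1 -exprD addnn -signr_odd odd_double expr0 scale1r.
rewrite (parb_homog _ (@gi_par _ V b)) (lmZ (Yl _ _)) andbC.
by rewrite exprN1 invrN1 scaleN1r opprK.
Qed.

Lemma omega_mode n w : Y (omega V) n w =
  2^-1 *: (Y (qv gN gE) n w + Y (qv gE gN) n w - Y (qv gP gM) n w + Y (qv gM gP) n w)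
  + 2^-1 *: Y (qv gE gE) n w.
Proof.
have h := Yl n w.
by rewrite (lmD h) !(lmZ h) !(lmD h) (lmN h).
Qed.

(** The boolean s selects which of psi^+ and psi^- plays the role of x, the other being y, so that
    both signs of e are treated at once. *)
Lemma aff_anti (s : bool) (r t : int) w :
  Yg (if s then gP else gM) r (Yg (if s then gM else gP) t w) =
  Yg gE (r + t) w + (if r + t == 0 then (r%:~R * (-1) ^+ (~~ s)) *: w else 0)
  - Yg (if s then gM else gP) t (Yg (if s then gP else gM) r w).
Proof.
have := aff_rel (vm_aff hY) (if s then gP else gM) (if s then gM else gP) r t w.
case: s => /=; rewrite !expr1 scaleN1r opprK scale1r => /(canRL (addrK _)) ->.
  by rewrite expr0.
by [].
Qed.

Lemma aff_sq (s : bool) (r : int) w :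
  Yg (if s then gP else gM) r (Yg (if s then gP else gM) r w) = 0.
Proof.
set x := if s then gP else gM.
have := aff_rel (vm_aff hY) x x r r w.
have -> : (-1) ^+ (godd x && godd x) = -1 :> C by rewrite /x; case: (s).
rewrite scaleN1r opprK => h.
rewrite -[LHS]half2 h /x; case: (s) => /=; rewrite scale0r add0r mulr0 scale0r;
  by case: ifP; rewrite scaler0.
Qed.

Lemma aff_cartan (g b : gl11) (r s : int) w : ~~ godd g ->
  Yg g r (Yg b s w) = Yg b s (Yg g r w)
   + ((@gbr R g b).1 *: Yg (@gbr R g b).2 (r + s) w
     + (if r + s == 0 then (r%:~R * gform g b) *: w else 0)).
Proof.
move=> hg; have := aff_rel (vm_aff hY) g b r s w.
by rewrite (negPf hg) expr0 scale1r => <-; rewrite addrC subrK.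
Qed.

(* A spectral flow of the vacuum. *)
Record vaclike (s : bool) (j : nat) (n e : C) (a : W) : Prop := Vaclike {
  vl_N : forall r : int, 0 < r -> Yg gN r a = 0;
  vl_E : forall r : int, 0 < r -> Yg gE r a = 0;
  vl_N0 : Yg gN 0 a = n *: a;
  vl_E0 : Yg gE 0 a = e *: a;
  vl_x : forall r : int, - j%:Z <= r -> Yg (if s then gP else gM) r a = 0;
  vl_y : forall r : int, j%:Z <= r -> Yg (if s then gM else gP) r a = 0 }.

(** In the mode sum for x y only the terms with i < j survive, each giving E_{-1} a once x_{-1-i} is
    moved past y_i; the remaining terms vanish by the annihilation conditions. *)
Lemma vaclike_q s j n e a : vaclike s j n e a ->
  [/\ Y (qv gN gE) 0 a = e *: Yg gN (-1) a + n *: Yg gE (-1) a,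
      Y (qv gE gN) 0 a = e *: Yg gN (-1) a + n *: Yg gE (-1) a,
      Y (qv gE gE) 0 a = e *: Yg gE (-1) a + e *: Yg gE (-1) a,
      Y (qv gP gM) 0 a = ((-1) ^+ (~~ s) * j%:R) *: Yg gE (-1) a &
      Y (qv gM gP) 0 a = ((-1) ^+ s * j%:R) *: Yg gE (-1) a].
Proof.
move=> h; have X0 := vl_x h; have Y0 := vl_y h; have hq c d l l' : ~~ godd c -> (forall r : int, 0 < r -> Yg c r a = 0) ->
    (forall r : int, 0 < r -> Yg d r a = 0) ->
    Yg c 0 a = l *: a -> Yg d 0 a = l' *: a ->
    Y (qv c d) 0 a = l' *: Yg c (-1) a + l *: Yg d (-1) a.
  move=> hc c0 d0 cl dl; have [K0 /(_ K0.+1 (leqnSn _)) ->] := q_mode c d 0 a.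
  rewrite big_ord_recl big1 ?addr0 /=; last first.
    by move=> i _; rewrite c0 ?d0 ?(lm0 (Yr _ _)) ?scaler0 ?addr0.
  by rewrite ?addr0 ?subr0 cl dl (negPf hc) expr0 scale1r !(lmZ (Yr _ _)) ?add0r ?subr0.
have xq : Y (qv (if s then gP else gM) (if s then gM else gP)) 0 a = j%:R *: Yg gE (-1) a.
  have [K0 hK] := q_mode (if s then gP else gM) (if s then gM else gP) 0 a.
  rewrite (hK (maxn K0 j)) ?leq_maxl //.
  rewrite (bigID (fun i : 'I_ _ => (i < j)%N)) /= [X in _ + X]big1 ?addr0; last first.
    move=> i; rewrite -leqNgt => ij.
    rewrite add0r Y0 ?lez_nat // (X0) ?(lm0 (Yr _ _)) ?scaler0 ?addr0 //.
    by lia.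
  rewrite (eq_bigr (fun=> Yg gE (-1) a)); last first.
    move=> i ij; rewrite add0r (X0 i%:Z) ?(lm0 (Yr _ _)) ?scaler0 ?addr0; last first.
      by lia.
    rewrite aff_anti (X0 (-1 - i%:Z)); last by move: ij; lia.
    by rewrite (lm0 (Yr _ _)) subr0 subrK addr0.
  rewrite -(big_ord_widen _ (fun=> Yg gE (-1) a)) ?leq_maxr //.
  by rewrite sumr_const card_ord scaler_nat.
have yq : Y (qv (if s then gM else gP) (if s then gP else gM)) 0 a = - (j%:R *: Yg gE (-1) a).
  have [K0 hK] := q_mode (if s then gM else gP) (if s then gP else gM) 0 a.
  have [K1 hK1] := q_mode (if s then gP else gM) (if s then gM else gP) 0 a.
  rewrite -xq (hK (maxn K0 K1)) ?leq_maxl // (hK1 (maxn K0 K1)) ?leq_maxr //.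
  rewrite -sumrN; apply: eq_bigr => i _; rewrite !add0r.
  have -> : (-1) ^+ (godd (if s then gM else gP) && godd (if s then gP else gM)) = -1 :> C.
    by case: (s).
  rewrite (X0 i%:Z) ?(lm0 (Yr _ _)) ?add0r; last first.
    by lia.
  by rewrite scaler0 addr0 scaleN1r.
have [N E] := (vl_N h, vl_E h); have [N0 E0] := (vl_N0 h, vl_E0 h).
split; [exact: hq|by rewrite (hq gE gN e n) // addrC|exact: hq|..].
  by case: (s) xq yq => /= [-> _|_ ->]; rewrite ?expr0 ?expr1 ?mul1r ?mulN1r ?scaleNr.
by case: (s) xq yq => /= [_ ->|-> _]; rewrite ?expr0 ?expr1 ?mul1r ?mulN1r ?scaleNr.
Qed.

Lemma half_cancel (A B : W) : 2^-1 *: (A + A - B - B) + 2^-1 *: (B + B) = A.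
Proof. by rewrite -scalerDr -[A + A - B - B]addrA -opprD subrK half2. Qed.

(** When e is j up to the sign fixed by s, the odd terms add up to - e E_{-1} a and cancel the
    contribution of E_{-1}^2 / 2. *)
Lemma vaclike_Lm1 s (j : nat) n e a : vaclike s j n e a ->
  e = (-1) ^+ (~~ s) * j%:R ->
  Y (omega V) 0 a = e *: Yg gN (-1) a + n *: Yg gE (-1) a.
Proof.
move=> h he; have [h1 h2 h3 h4 h5] := vaclike_q h.
have {}h5 : Y (qv gM gP) 0 a = - (e *: Yg gE (-1) a).
  by rewrite h5 he -scaleNr; case: (s); rewrite ?mulN1r ?mul1r ?opprK.
rewrite -he in h4; rewrite omega_mode h1 h2 h3 h4 h5.
exact: half_cancel.
Qed.

End Omega.

(** * Weights of L_0 and uniqueness of the vacuum *)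

Section L0.
Context {R : realType} (V : V1gl11 R).
Local Notation C := R[i].
Local Notation Yg a := (vY (gi V a)).
Let hV := vsa_mod (vP V).

Lemma q_gi0 a b g : vY (qv V a b) 0 (gi V g) =
  Yg a (-1) (Yg b 0 (gi V g)) + Yg a (-2) (Yg b 1 (gi V g)) +
  (-1) ^+ (godd a && godd b) *:
    (Yg b (-1) (Yg a 0 (gi V g)) + Yg b (-2) (Yg a 1 (gi V g))).
Proof.
have [K0 /(_ (K0 + 2)%N (leq_addr _ _)) ->] := q_mode hV a b 0 (gi V g).
rewrite addn2 !big_ord_recl big1 ?addr0 /=; last first.
  move=> i _; rewrite /bump /= !gi_2 ?(lm0 (vm_linr hV _ _)) ?scaler0 ?addr0 //.
by rewrite ?addr0 ?add0r ?subr0 scalerDr addrACA.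
Qed.

Lemma q_gi1 a b g : vY (qv V a b) 1 (gi V g) =
  Yg a (-1) (Yg b 1 (gi V g)) +
  (-1) ^+ (godd a && godd b) *:
    (Yg b 0 (Yg a 0 (gi V g)) + Yg b (-1) (Yg a 1 (gi V g))).
Proof.
have [K0 /(_ (K0 + 2)%N (leq_addr _ _)) ->] := q_mode hV a b 1 (gi V g).
rewrite addn2 !big_ord_recl big1 ?addr0 /=; last first.
  move=> i _; rewrite /bump /= !gi_2 ?(lm0 (vm_linr hV _ _)) ?scaler0 ?addr0 //.
rewrite ?addr0 ?add0r ?subr0 (@gi_2 _ V b g 2 isT) (lm0 (vm_linr hV _ _)) add0r.
by rewrite scalerDr addrA.
Qed.

(** With its analogues below, this provides omega_0 g = g_{-2} 1 and omega_1 g = g for all four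
    currents, from which [L0_current] derives the commutator - n g_n of L_0 and g_n. *)
Lemma omega0_E : vY (omega V) 0 (gi V gE) = Yg gE (-2) (vac V).
Proof.
rewrite (omega_mode hV) !q_gi0 !gi_0 !gi_1 /=.
rewrite !scale0r !scale1r !(lm0 (vm_linr hV _ _)) ?expr0 ?expr1 ?scale1r ?scaler0 ?addr0 ?add0r.
by rewrite !scaler0 subr0 !addr0 half2.
Qed.

Lemma omega1_E : vY (omega V) 1 (gi V gE) = gi V gE.
Proof.
rewrite (omega_mode hV) !q_gi1 !gi_0 !gi_1 /=.
rewrite !scale0r !scale1r !(lm0 (vm_linr hV _ _)) ?expr0 ?expr1 ?scale1r ?scaler0 ?addr0 ?add0r.
by rewrite !scaler0 subr0 !addr0 !(vsa_create (vP V)) half2.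
Qed.

Lemma omega0_N : vY (omega V) 0 (gi V gN) = Yg gN (-2) (vac V).
Proof.
rewrite (omega_mode hV) !q_gi0 !gi_0 !gi_1 /=.
rewrite !scale0r !scale1r !(lm0 (vm_linr hV _ _)) ?expr0 ?expr1 ?scale1r ?scaler0 ?addr0 ?add0r.
have E2 : Yg gP (-1) (gi V gM) + Yg gM (-1) (gi V gP) = Yg gE (-2) (vac V).
  have := aff_anti hV true (-1) (-1) (vac V).
  by rewrite /= !(vsa_create (vP V)) addr0 => ->; rewrite subrK.
rewrite !(lmZ (vm_linr hV _ _)) !scaleN1r !opprK -opprD E2 addrC [_ + Yg gP _ _]addrC E2 addrC.
exact: half_cancel.
Qed.

Lemma omega1_N : vY (omega V) 1 (gi V gN) = gi V gN.
Proof.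
rewrite (omega_mode hV) !q_gi1 !gi_0 !gi_1 /=.
rewrite !scale0r !scale1r !(lm0 (vm_linr hV _ _)) ?expr0 ?expr1 ?scale1r ?scaler0 ?addr0 ?add0r.
rewrite !(lmZ (vm_linr hV _ _)) !gi_0 /= !scale1r !scaleN1r opprK !(vsa_create (vP V)).
exact: half_cancel.
Qed.

Lemma homog_omega : homog false (omega V).
Proof.
apply/homogP; rewrite /omega !(parD, parZ, parN).
have h (a b : gl11) : godd a = godd b -> par (vY (gi V a) (-1) (vY (gi V b) (-1) (vac V))) =
    vY (gi V a) (-1) (vY (gi V b) (-1) (vac V)).
  move=> hab; rewrite !(vm_par hV) par_vac !par_gi hab.
  rewrite (lmZ (vm_linl hV _ _)) (lmZ (vm_linl hV _ _)) (lmZ (vm_linr hV _ _)) scalerA.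
  by rewrite -expr2 sqrr_sign scale1r.
by rewrite !h.
Qed.

Lemma half_cancel2 (W : lmodType C) (A B : W) : 2^-1 *: (A + A - (A + B) - (A + B)) = - B.
Proof.
rewrite -[_ - (A + B) - _]addrA -opprD [A + B + _]addrACA opprD addrA subrr sub0r.
by rewrite scalerN half2.
Qed.

Lemma omega0_P : vY (omega V) 0 (gi V gP) = Yg gP (-2) (vac V).
Proof.
rewrite (omega_mode hV) !q_gi0 !gi_0 !gi_1 /=.
rewrite !scale0r !scale1r !(lm0 (vm_linr hV _ _)) ?expr0 ?expr1 ?scale1r ?scaler0 ?addr0 ?add0r.
rewrite !(lmZ (vm_linr hV _ _)) !scaleN1r ?oppr0 ?addr0 ?scaler0 ?addr0.
have -> : Yg gE (-1) (gi V gP) = Yg gP (-1) (gi V gE).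
  have := @aff_cartan _ _ _ _ hV gE gP (-1) (-1) (vac V) isT.
  by rewrite !(vsa_create (vP V)) /= scale0r !addr0.
by rewrite half_cancel2 opprK.
Qed.

Lemma omega1_P : vY (omega V) 1 (gi V gP) = gi V gP.
Proof.
rewrite (omega_mode hV) !q_gi1 !gi_0 !gi_1 /=.
rewrite !scale0r !scale1r !(lm0 (vm_linr hV _ _)) ?expr0 ?expr1 ?scale1r ?scaler0 ?addr0 ?add0r.
rewrite !(lmZ (vm_linr hV _ _)) !scaleN1r ?oppr0 ?addr0 ?scaler0 ?addr0.
rewrite !gi_0 /= !scale0r !(vsa_create (vP V)) !sub0r !opprK half2 //.
Qed.

Lemma omega0_M : vY (omega V) 0 (gi V gM) = Yg gM (-2) (vac V).
Proof.
rewrite (omega_mode hV) !q_gi0 !gi_0 !gi_1 /=.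
rewrite !scale0r !scale1r !(lm0 (vm_linr hV _ _)) ?expr0 ?expr1 ?scale1r ?scaler0 ?addr0 ?add0r.
rewrite !(lmZ (vm_linr hV _ _)) !scaleN1r ?oppr0 ?addr0 ?scaler0 ?addr0.
have -> : Yg gE (-1) (gi V gM) = Yg gM (-1) (gi V gE).
  have := @aff_cartan _ _ _ _ hV gE gM (-1) (-1) (vac V) isT.
  by rewrite !(vsa_create (vP V)) /= scale0r !addr0.
set A := Yg gM (-1) _; set B := Yg gM (-2) _.
have e : A + B = - (- A - B) by rewrite -opprD opprK.
by rewrite opprK e half_cancel2 opprK.
Qed.

Lemma omega1_M : vY (omega V) 1 (gi V gM) = gi V gM.
Proof.
rewrite (omega_mode hV) !q_gi1 !gi_0 !gi_1 /=.
rewrite !scale0r !scale1r !(lm0 (vm_linr hV _ _)) ?expr0 ?expr1 ?scale1r ?scaler0 ?addr0 ?add0r.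
rewrite !(lmZ (vm_linr hV _ _)) !scaleN1r ?oppr0 ?addr0 ?scaler0 ?addr0.
by rewrite !gi_0 /= !scale0r !(vsa_create (vP V)) oppr0 !add0r opprK half2.
Qed.

(** Vacuum modes vanish except at -1, so a single term of the iterate formula survives: in its
    second half for t > 0, in its first half for t < 0, and none for t = 0. *)
Lemma current_L1 (W : sspace R) (Y : V -> int -> W -> W) (g : gl11) (t : int) w :
  vmod_ax (vac V) (@vY _ V) Y ->
  Y (Yg g (-2) (vac V)) t w = - t%:~R *: Y (gi V g) (t - 1) w.
Proof.
move=> hY.
have sgn2 : (-1) ^ (-2) = 1 :> C by rewrite -[LHS]/(((-1) ^+ 2)^-1) sqrrN expr1n invr1.
have sgn i : (-1) ^+ i * ((-1) ^+ i * i.+1%:R) = i.+1%:R :> C.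
  by rewrite mulrA -exprD addnn -signr_odd odd_double expr0 mul1r.
have [K0 hK] := vm_iter hY (vac V) w (-2) t (@gi_par _ V g).
case: t hK => [[|n]|n] hK.
- rewrite (hK K0) // mulr0z oppr0 scale0r big1 // => i _; rewrite parb_vac !(vm_vac hY).
  have -> : (0 + i%:Z == -1) = false by lia.
  have -> : (0 + -2 - i%:Z == -1) = false by lia.
  by rewrite (lm0 (vm_linr hY _ _)) scaler0 subr0 scaler0.
- rewrite (hK (maxn K0 n.+1)) ?leq_maxl //.
  rewrite (bigD1 (Ordinal (leq_maxr K0 n.+1 : (n < _)%N))) //= big1 ?addr0.
    rewrite gbinN2 parb_vac !(vm_vac hY).
    have -> : (n.+1%:Z + n%:Z == -1) = false by lia.
    have -> : (n.+1%:Z + -2 - n%:Z == -1) = true by lia.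
    have -> : n.+1%:Z - 1 = n%:Z by lia.
    by rewrite (lm0 (vm_linr hY _ _)) sub0r sgn sgn2 scale1r scalerN scaleNr.
  move=> i ni; rewrite parb_vac !(vm_vac hY).
  have -> : (n.+1%:Z + i%:Z == -1) = false by lia.
  have -> : (n.+1%:Z + -2 - i%:Z == -1) = false.
    by apply/negbTE/eqP => h; move/negP: ni; apply; apply/eqP/val_inj => /=; lia.
  by rewrite (lm0 (vm_linr hY _ _)) scaler0 subr0 scaler0.
rewrite (hK (maxn K0 n.+1)) ?leq_maxl //.
rewrite (bigD1 (Ordinal (leq_maxr K0 n.+1 : (n < _)%N))) //= big1 ?addr0.
  rewrite gbinN2 parb_vac !(vm_vac hY).
  have -> : (Negz n + n%:Z == -1) = true by lia.
  have -> : (Negz n + -2 - n%:Z == -1) = false by lia.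
  have -> : Negz n - 1 = -2 - n%:Z by lia.
  by rewrite scaler0 subr0 sgn NegzE mulrNz opprK.
move=> i ni; rewrite parb_vac !(vm_vac hY).
have -> : (Negz n + -2 - i%:Z == -1) = false by lia.
have -> : (Negz n + i%:Z == -1) = false.
  by apply/negbTE/eqP => h; move/negP: ni; apply; apply/eqP/val_inj => /=; lia.
by rewrite (lm0 (vm_linr hY _ _)) scaler0 subr0 scaler0.
Qed.

Lemma L0_current (W : sspace R) (Y : V -> int -> W -> W) (g : gl11) (n : int) w :
  vmod_ax (vac V) (@vY _ V) Y ->
  Y (omega V) 1 (Y (gi V g) n w) =
  Y (gi V g) n (Y (omega V) 1 w) - n%:~R *: Y (gi V g) n w.
Proof.
move=> hY; have [K0 hK] := vm_comm hY (gi V g) w 1 n homog_omega.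
have := hK (K0 + 2)%N (leq_addr _ _); rewrite addn2 !big_ord_recl big1 ?addr0; last first.
  by move=> i _; rewrite gbin1S scale0r.
rewrite gbin0 gbin11 !scale1r /= /bump /=.
have -> : vY (omega V) 0 (gi V g) = vY (gi V g) (-2) (vac V).
  by case: (g); rewrite ?omega0_N ?omega0_E ?omega0_P ?omega0_M.
have -> : vY (omega V) 1 (gi V g) = gi V g.
  by case: (g); rewrite ?omega1_N ?omega1_E ?omega1_P ?omega1_M.
move/(canRL (subrK _)) => ->; rewrite addrC; congr (_ + _).
have -> : 1 + n - (1 + 0)%N%:Z = n by lia.
rewrite current_L1 // (_ : 1 + n - 1 = n); last by lia.
by rewrite rmorphD opprD scalerDl scaleN1r addrAC addNr add0r scaleNr.
Qed.

Definition nmono (s : seq (gl11 * nat)) : V :=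
  foldr (fun p u => Yg p.1 (- p.2.+1%:Z) u) (vac V) s.

Definition ndeg (s : seq (gl11 * nat)) : nat := \sum_(p <- s) p.2.+1.

(** Commutators move a nonnegative mode to the right until it meets the vacuum, which it kills. *)
Lemma nmono_span v : spanset (range nmono) v.
Proof.
have hG := subsp_span (range nmono).
have neg a n u : spanset (range nmono) u -> spanset (range nmono) (Yg a (- n.+1%:Z) u).
  apply: (span_min (U := fun u => spanset (range nmono) (Yg a (- n.+1%:Z) u))).
    by apply: subsp_preim => //; exact: (vm_linr hV).
  by move=> _ [s _ <-]; apply: span_sub; exists ((a, n) :: s).
have key s : forall a n, spanset (range nmono) (Yg a n (nmono s)).
  elim: s => [|p s IH] a [n|n].
  - by rewrite /= (vsa_create0 (vP V)) //; apply: ss0.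
  - by rewrite NegzE; apply: neg; apply: span_sub; exists [::].
  - rewrite /=; have := aff_rel (vm_aff hV) a p.1 n (- p.2.+1%:Z) (nmono s).
    move=> /(canRL (subrK _)) ->; apply: ssD => //.
      apply: ssD => //; first by apply: ssZ.
      case: ifP => _; last exact: ss0.
      by apply: ssZ => //; apply: span_sub; exists s.
    by apply: ssZ => //; apply: neg.
  - by rewrite NegzE; apply: neg; apply: span_sub; exists (p :: s).
move: v; apply: gi_gen => //; first by apply: span_sub; exists [::].
move=> a n u; apply: (span_min (U := fun u => spanset (range nmono) (Yg a n u))).
  by apply: subsp_preim => //; exact: (vm_linr hV).
by move=> _ [s _ <-].
Qed.

Lemma L0_nmono s : vY (omega V) 1 (nmono s) = (ndeg s)%:R *: nmono s.
Proof.
elim: s => [|p s IH]; first by rewrite /= (vsa_create0 (vP V)) // /ndeg big_nil scale0r.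
rewrite /= (L0_current _ _ _ hV) IH (lmZ (vm_linr hV _ _)) -scalerBl.
by rewrite /ndeg big_cons rmorphN opprK addrC natrD.
Qed.

(** The formula for omega gives L_0 u = 0, whereas a monomial in negative modes has its degree as
    L_0-weight; only the empty monomial has degree 0. *)
Lemma vacuum_unique (u : V) : (forall a (n : int), 0 <= n -> Yg a n u = 0) ->
  exists c : C, u = c *: vac V.
Proof.
move=> hu; pose T := vY (omega V) 1.
have TL : lin_map T by exact: (vm_linr hV).
have dT : diagz T.
  move=> v; have [s [ev hs]] := nmono_span v.
  have [t ht] : exists t : seq (C * V), [seq p.1 *: p.2 | p <- s] = [seq p.2 | p <- t] /\
      forall p, p \in t -> T p.2 = p.1 *: p.2.
    elim: s {ev} hs => [|p s IH] hs; first by exists [::].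
    have [|t [et ht]] := IH; first by move=> q qs; apply: hs; rewrite inE qs orbT.
    have [m _ em] := hs p (mem_head _ _).
    exists (((ndeg m)%:R, p.1 *: p.2) :: t); rewrite /= et; split=> // q.
    rewrite inE => /orP[/eqP -> /=|]; last exact: ht.
    by rewrite (lmZ TL) -em /T L0_nmono !scalerA mulrC.
  exists t; split; last exact: ht.2.
  by rewrite ev -(big_map (fun p : C * V => p.1 *: p.2) xpredT id) ht.1 big_map.
pose phi (l : C) : C := (l == 0)%:R.
have T0 : T u = 0.
  have q0 a b : vY (qv V a b) 1 u = 0.
    have [K0 /(_ K0 (leqnn _)) ->] := q_mode hV a b 1 u.
    rewrite big1 // => i _; rewrite !hu ?(lm0 (vm_linr hV _ _)) ?scaler0 ?addr0 //.
  by rewrite /T (omega_mode hV) !q0 !(addr0, subr0, scaler0).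
have e1 : fcalc T phi u = u.
  by rewrite (fcalc_eig TL phi (l := 0)) ?T0 ?scale0r // /phi eqxx scale1r.
have : exists c, fcalc T phi u = c *: vac V.
  apply: (span_min (U := fun u => exists c, fcalc T phi u = c *: vac V) _ _ (nmono_span u)).
    split; first by exists 0; rewrite (lm0 (fcalc_lin TL phi dT)) scale0r.
    move=> c x y [cx ex] [cy ey]; exists (c * cx + cy).
    by rewrite (fcalc_lin TL phi dT) ex ey scalerDl scalerA.
  move=> _ [[|p s] _ <-].
    exists (phi (ndeg [::])%:R); rewrite (fcalc_eig TL phi (L0_nmono [::])) //.
  exists 0; rewrite (fcalc_eig TL phi (L0_nmono (p :: s))) /phi pnatr_eq0 /ndeg big_cons.
  by rewrite !scale0r.
by rewrite e1.
Qed.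

End L0.

(** * Generalized modules *)

Section GMod.
Context {R : realType} {V : V1gl11 R}.
Local Notation C := R[i].
Implicit Types W X Z : gmod V.

Lemma gYl W n (w : W) : lin_map (fun v : V => gY v n w).
Proof. exact: (vm_linl (gax W)). Qed.
Lemma gYr W (v : V) n : lin_map (@gY _ V W v n).
Proof. exact: (vm_linr (gax W)). Qed.

Definition strict W X (f : W -> X) : Prop :=
  lin_map f /\ forall v n w, f (gY v n w) = gY v n (f w).

Lemma strict_id W : strict (fun w : W => w).
Proof. by []. Qed.

Lemma strict_comp W X Z (g : X -> Z) (f : W -> X) :
  strict g -> strict f -> strict (fun w => g (f w)).
Proof.
by move=> [gL gs] [fL fs]; split=> [|v n w]; [exact: lin_comp|rewrite fs gs].
Qed.

Lemma strict_gi W X (f : W -> X) : lin_map f ->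
  (forall a n w, f (gact a n w) = gact a n (f w)) -> strict f.
Proof.
move=> fL fa; split=> //.
exact: (vhom_ext (c := false) (gax W) (gax X) fL fa).
Qed.

Lemma sfun_strict W X (f : ghom W X) : strict (conjJ 'i f).
Proof.
split; first exact/conjJ_lin/hlin.
move=> v n w.
have h := @supercomm_strict R V W W X X (fun v w => gY v n w) (fun v w => gY v n w)
  (fun v => gYr v n) (fun v => gYr v n) (fun w => gYl n w) (fun w => gYl n w)
  (fun v w => vm_par (gax W) v n w) (fun v w => vm_par (gax X) v n w) f f
  (hlin f) (hlin f) 'i sqri.
by apply: h => b v' w' hv; apply: hcomm.
Qed.

Lemma strict_ghom W X (f : W -> X) : strict f ->
  exists F : ghom W X, (F : W -> X) = conjJ (- 'i) f.
Proof.
move=> [fL fs]; have FL := conjJ_lin (- 'i) fL.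
unshelve eexists (GHom FL _) => // b v n w hv.
have h := @strict_supercomm R V W W X X (fun v w => gY v n w) (fun v w => gY v n w)
  (fun v => gYr v n) (fun v => gYr v n) (fun w => gYl n w) (fun w => gYl n w)
  (fun v w => vm_par (gax W) v n w) (fun v w => vm_par (gax X) v n w) f f
  fL (- 'i).
by apply: h => //; rewrite mulrNN sqri.
Qed.

(** Stability under [par] is not imposed: kernels and images of strict maps can violate it. *)
Record vstable W (U : set W) : Prop := Vstable {
  vs_sp : subsp U;
  vs_act : forall v n w, U w -> U (gY v n w) }.

Lemma vstable_gi W (U : set W) : subsp U ->
  (forall a n w, U w -> U (gact a n w)) -> vstable U.
Proof. by move=> hU hg; split=> //; apply: (vstable_ext (gax W)). Qed.

Lemma vstable0 W : vstable [set (0 : W)].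
Proof. by split; [exact: subsp_eq0|move=> v n w ->; rewrite (lm0 (gYr _ _))]. Qed.

Lemma vstable_preim W X (f : W -> X) (A : set X) : strict f -> vstable A ->
  vstable (fun x => A (f x)).
Proof.
move=> [fL fs] hA; split; first by apply: subsp_preim => //; exact: vs_sp.
by move=> v n w Aw /=; rewrite fs; apply: vs_act.
Qed.

Lemma vstable_image W X (f : W -> X) (A : set W) : strict f -> vstable A ->
  vstable (f @` A).
Proof.
move=> [fL fs] hA; split; first split.
- by exists 0; rewrite ?lm0 //; apply: ss0; apply: vs_sp.
- move=> c _ _ [u Au <-] [v Av <-]; exists (c *: u + v); rewrite ?fL //.
  by apply: ssl => //; apply: vs_sp.
by move=> v n _ [u Au <-]; exists (gY v n u); rewrite ?fs //; apply: vs_act.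
Qed.

Lemma vstableI W (A B : set W) : vstable A -> vstable B -> vstable (A `&` B).
Proof.
move=> hA hB; split; first by apply: subspI; apply: vs_sp.
by move=> v n w [Aw Bw]; split; apply: vs_act.
Qed.

Lemma vstable_sum W (A B : set W) : vstable A -> vstable B -> vstable (sumset A B).
Proof.
move=> hA hB; split; first by apply: subsp_sumset; apply: vs_sp.
move=> v n _ [a [b [Aa Bb ->]]]; exists (gY v n a), (gY v n b).
by rewrite (lmD (gYr _ _)); split=> //; apply: vs_act.
Qed.

Lemma vstable_eigE W (e : C) : vstable [set w : W | gact gE 0 w = e *: w].
Proof.
apply: vstable_gi.
  split=> [|c u v]; rewrite /= /gact; first by rewrite (lm0 (gYr _ _)) scaler0.
  by move=> hu hv; rewrite gYr hu hv scalerDr !scalerA mulrC.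
move=> a n w /= hw; rewrite /gact (@aff_cartan _ _ _ _ (gax W) gE a 0 n w isT) -/(gact gE 0 w) hw.
rewrite (lmZ (gYr _ _)) add0r mul0r scale0r.
by case: a => /=; rewrite ?scale0r; case: ifP; rewrite !addr0.
Qed.

Local Notation L0 := (gY (omega V) 1).

Lemma gpr_sub W (U : set W) h w : vstable U -> U w -> U (gpr h w).
Proof.
move=> hU Uw; have [Jf [J0 ew]] := gpr_sum w.
have [hJ|/J0 ->] := boolP (h \in Jf); last by apply: ss0; exact: vs_sp.
apply: (@gen_eig_sub _ W (L0 : W -> W) (gYr _ _) U _ (enum_fset Jf) id (fun h => gpr h w)) => //.
- exact: vs_sp.
- by move=> u; apply: vs_act.
- by rewrite map_id fset_uniq.
- by move=> k _; apply: gpr_wt.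
- by rewrite -ew.
Qed.

Lemma gpr_other W h h' (w : W) n : h != h' ->
  iter n (fun u => L0 u - h' *: u) w = 0 -> gpr h w = 0.
Proof.
move=> hh hw; have [Jf [J0 ew]] := gpr_sum w.
have [hJ|/J0 ->//] := boolP (h \in Jf).
pose r := undup (h' :: enum_fset Jf).
(* Two decompositions of w are subtracted: into its projections, and as a single generalized
   eigenvector for h'. By independence the difference vanishes termwise. *)
pose x k := gpr k w - (if k == h' then w else 0).
have xs : \sum_(k <- r) x k = 0.
  rewrite sumrB -big_mkcond /= -[X in _ - X]big_filter.
  have -> : [seq k <- r | k == h'] = [:: h'].
    have : h' \in r by rewrite mem_undup mem_head.
    have := undup_uniq (h' :: enum_fset Jf); rewrite -/r.
    elim: (r) => //= k s IH /andP[ks us]; rewrite inE => /orP[/eqP e|hs].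
      rewrite -e eqxx; congr cons; apply/eqP; rewrite -[_ == _]negbK -has_filter e.
      by apply: contra ks => /hasP[y ys /eqP <-].
    by case: eqP => [e|_]; [rewrite e hs in ks|exact: IH].
  rewrite big_seq1; apply/eqP; rewrite subr_eq0; apply/eqP; rewrite [RHS]ew.
  rewrite [LHS](bigID (fun k => k \in Jf)) /= [X in _ + X]big1 ?addr0; last first.
    by move=> k /J0.
  rewrite -big_filter; apply: perm_big; apply: uniq_perm.
  - by rewrite filter_uniq // undup_uniq.
  - exact: fset_uniq.
  move=> k; rewrite mem_filter mem_undup inE.
  by case: (k \in Jf); rewrite //= orbT.
have : x h = 0.
  apply: (@gen_eig_sub _ W (L0 : W -> W) (gYr _ _) [set 0] _ r id x) => //.
  - exact: subsp_eq0.
  - by move=> u ->; rewrite (lm0 (gYr _ _)).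
  - by rewrite map_id undup_uniq.
  - move=> k _; rewrite /x; case: eqP => [->|_]; last by rewrite subr0; apply: gpr_wt.
    have [m hm] := gpr_wt h' w; exists (m + n)%N.
    rewrite (lmB (lin_iter _ (lin_shift (gYr _ _) _))) {1}addnC !iterD hm hw.
    by rewrite !(lm0 (lin_iter _ (lin_shift (gYr _ _) _))) subrr.
  - by rewrite mem_undup inE hJ orbT.
by rewrite /x (negPf hh) subr0.
Qed.

Lemma gpr_strict W X (f : W -> X) h w : strict f -> f (gpr h w) = gpr h (f w).
Proof.
move=> [fL fs].
have fit n k u : f (iter n (fun u => L0 u - k *: u) u) = iter n (fun u => L0 u - k *: u) (f u).
  by elim: n => //= n IH; rewrite (lmB fL) (lmZ fL) fs IH.
have [Jf [J0 ew]] := gpr_sum w.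
have key k : gpr h (f (gpr k w)) = if k == h then f (gpr h w) else 0.
  have [n hn] := gpr_wt k w.
  have hfn : iter n (fun u => L0 u - k *: u) (f (gpr k w)) = 0 by rewrite -fit hn (lm0 fL).
  case: eqP => [<-|/eqP kh]; first exact: gpr_id hfn.
  by apply: gpr_other hfn; rewrite eq_sym.
rewrite [in RHS]ew (lm_sum fL) (lm_sum (@gpr_lin _ _ _ h)).
have [hJ|hJ] := boolP (h \in Jf); last first.
  rewrite (J0 _ hJ) (lm0 fL) big_seq big1 // => k kJ; rewrite key.
  by case: eqP => // kh; rewrite -kh kJ in hJ.
rewrite (bigD1_seq h) ?fset_uniq //= big1 ?addr0 ?key ?eqxx // => k kh.
by rewrite key (negPf kh).
Qed.

(** The parity of the subobject is the parameter [tau]: the ambient [par] when the submodule is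
    stable under it, and otherwise a sign read off the N_0-weights. *)
Lemma subobj W (U : set W) (tau : W -> W) : vstable U -> lin_map tau -> involutive tau ->
  (forall v n w, tau (gY v n w) = gY (par v) n (tau w)) ->
  (forall w, U w -> U (tau w)) ->
  exists (Z : gmod V) (i : Z -> W),
    [/\ strict i, injective i, (forall z, U (i z)), (forall w, U w -> exists z, i z = w) &
     forall z, i (par z) = tau (i z)].
Proof.
move=> hU tL tK tY Ut; pose S := Subs (vs_sp hU).
pose p (z : subs_of S) : subs_of S := mksv (Ut _ (sv_in z) : sset S _).
have pL : lin_map p by apply: sv_lin_ker => c u v /=; rewrite tL.
have pK : involutive p by move=> z; apply: sv_inj; rewrite /= tK.
pose Zs := SSpace pL pK.
pose a (v : V) (n : int) (z : Zs) : Zs := mksv (vs_act hU v n (sv_in z) : sset S _).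
have svL := @sv_lin _ _ S.
have ha : vmod_ax (vac V) (@vY _ V) a.
  split.
  - by move=> n w c u v; apply: sv_inj; rewrite /= (vm_linl (gax W)).
  - by move=> v n; apply: (@sv_lin_ker _ _ S) => c u w /=; rewrite (vm_linr (gax W)).
  - by move=> v n w; apply: sv_inj; rewrite /= tY.
  - move=> v w; have [n0 h] := vm_trunc (gax W) v (sv w).
    by exists n0 => n /h e; apply: sv_inj.
  - move=> n w; apply: sv_inj; rewrite /= (vm_vac (gax W)); by case: ifP.
  - move=> b u v w l m n hu; have [K0 h] := vm_borcherds (gax W) v (sv w) l m n hu.
    exists K0 => K /h e; apply: sv_inj; move: e.
    by rewrite !(lm_sum svL).
pose g (h : C) (z : Zs) : Zs := mksv (gpr_sub h hU (sv_in z) : sset S _).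
have git n h (z : Zs) : sv (iter n (fun u => a (omega V) 1 u - h *: u) z) =
   iter n (fun u => L0 u - h *: u) (sv z).
  by elim: n => //= n <-.
unshelve eexists (@GMod R V Zs a ha g _ _ _ _), (@sv _ _ S).
- by move=> h; apply: (@sv_lin_ker _ _ S) => c u v /=; rewrite gpr_lin.
- move=> h z; have [n hn] := gpr_wt h (sv z); exists n.
  by apply: sv_inj; rewrite git hn.
- move=> h z n e; apply: sv_inj => /=; apply: (@gpr_id _ _ _ _ _ n).
  by rewrite -git e.
- move=> z; have [Jf [J0 e]] := gpr_sum (sv z); exists Jf; split.
    by move=> h /J0 e'; apply: sv_inj.
  by apply: sv_inj; rewrite (lm_sum svL) /=.
split=> //; first exact: sv_inj.
- exact: (@sv_in _ _ S).
- by move=> w Uw; exists (mksv (Uw : sset S w)).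
Qed.

Definition ndiag W := diagz (gact gN 0 : W -> W).

(* N_0-weights in a module generated by one vector differ by integers, and an odd
   mode shifts them by 1: the sign [phase], read off the weight, implements the
   parity of V on an arbitrary N_0-diagonalizable module. *)
Definition phase (l : C) : C := (-1) ^ Num.floor (complex.Re l).

Lemma phaseD1 l : phase (l + 1) = - phase l.
Proof.
case: l => a b; rewrite /phase /= Num.Theory.floorDrz ?rpred1 // Num.Theory.floor1.
by rewrite expfzDr ?oppr_eq0 ?oner_eq0 // expr1z mulrN1.
Qed.

Lemma phase_sq l : phase l * phase l = 1.
Proof. by rewrite /phase -expfzMl mulrNN mulr1 exp1rz. Qed.

Definition tau W (w : W) : W := fcalc (gact gN 0) phase w.

Lemma gactr W a n : lin_map (@gact _ V W a n).
Proof. exact: gYr. Qed.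

Lemma tau_lin W : ndiag W -> lin_map (@tau W).
Proof. by move=> d; apply: fcalc_lin => //; exact: gactr. Qed.

Lemma tauK W : ndiag W -> involutive (@tau W).
Proof.
move=> d w; have [s [-> hs]] := d w.
have tL := tau_lin d; rewrite !(lm_sum tL) !big_seq; apply: eq_bigr => p ps.
have e := fcalc_eig (gactr _ _) phase (hs _ ps).
by rewrite /tau e -/(tau _) (lmZ tL) /tau e scalerA phase_sq scale1r.
Qed.

Lemma gactN0 W b n l (w : W) : gact gN 0 w = l *: w ->
  gact gN 0 (gact b n w) =
  (l + (match b with gP => 1 | gM => -1 | _ => 0 end)) *: gact b n w.
Proof.
move=> hw; rewrite /gact (@aff_cartan _ _ _ _ (gax W) gN b 0 n w isT) -/(gact gN 0 w) hw.
rewrite (lmZ (gYr _ _)) add0r mul0r scale0r scalerDl.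
by case: b => /=; case: ifP; rewrite ?scale0r ?addr0.
Qed.

Lemma tau_act W : ndiag W ->
  forall v n (w : W), tau (gY v n w) = gY (par v) n (tau w).
Proof.
move=> d; apply: (vhom_ext (c := true) (gax W) (gax W) (tau_lin d)) => a n w /=.
rewrite par_gi (lmZ (gYl _ _)).
pose q : C := match a with gP => 1 | gM => -1 | _ => 0 end.
have h := @fcalc_comm R W W (gact gN 0) (gact gN 0) (gY (gi V a) n) phase
  (fun l => (-1) ^+ godd a * phase l) q (gactr _ _) (gactr _ _) d d (gYr _ _).
rewrite /tau h.
- have [s [-> hs]] := d w.
  rewrite !(lm_sum (fcalc_lin (gactr _ _) _ d)) !(lm_sum (gYr _ _)) scaler_sumr.
  rewrite !big_seq; apply: eq_bigr => p ps.
  by rewrite !(fcalc_eig (gactr _ _) _ (hs _ ps)) !(lmZ (gYr _ _)) scalerA.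
- by move=> l u hu; apply: gactN0.
move=> l; rewrite /q; case: (a) => /=; rewrite ?expr0 ?expr1 ?mul1r ?addr0 ?mulN1r //.
  exact: phaseD1.
by rewrite -[l in RHS](subrK 1) phaseD1 opprK.
Qed.

Lemma tau_par W (w : W) : ndiag W -> tau (par w) = par (tau w).
Proof.
move=> d; apply: (fcalc_comm (c := 0) (gactr _ _) (gactr _ _) d d (@par_lin _ _)).
  move=> l u hu; rewrite addr0 -parZ -hu /gact (vm_par (gax W)) par_gi.
  by rewrite expr0 scale1r.
by move=> l; rewrite addr0.
Qed.

Lemma tau_sub W (U : set W) w : ndiag W -> vstable U -> U w -> U (tau w).
Proof.
by move=> d hU; apply: fcalc_sub => //; [exact: gactr|exact: vs_sp|move=> u; apply: vs_act].
Qed.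

Lemma ndiag_inj W Z (f : Z -> W) : strict f -> injective f -> ndiag W -> ndiag Z.
Proof.
move=> [fL fs] fI d z; have [s hs] := d (f z).
by apply: (eigdec_pull (gactr _ _) (gactr _ _) fL fI _ hs) => u; apply: fs.
Qed.

(** Both [par] and [tau] twist the action by the parity of V, so their composite is V-linear; it
    compares the two gradings. *)
Definition ptau W (w : W) : W := par (tau w).

Lemma ptau_strict W : ndiag W -> strict (@ptau W).
Proof.
move=> d; split; first by apply: lin_comp; [exact: par_lin|exact: tau_lin].
by move=> v n w; rewrite /ptau tau_act // (vm_par (gax W)) parK.
Qed.

Lemma ptauK W : ndiag W -> involutive (@ptau W).
Proof. by move=> d w; rewrite /ptau tau_par // parK tauK. Qed.

Lemma par_ptau W (w : W) : ndiag W -> par w = tau (ptau w).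
Proof. by move=> d; rewrite /ptau tau_par // tauK. Qed.

Lemma graded_submod W (U : set W) : vstable U -> (forall u, U u -> U (par u)) ->
  submod (@gY _ V W) U.
Proof.
move=> hU hp; split=> //; [by apply: ss0; exact: vs_sp|by move=> c u v; apply: ssl; exact: vs_sp|].
by move=> v n u; apply: vs_act.
Qed.

Lemma submod_vstable W (U : set W) : submod (@gY _ V W) U -> vstable U.
Proof.
move=> h; split; last by move=> v n w; apply: (sm_act h).
by split; [exact: (sm_0 h)|exact: (sm_lin h)].
Qed.

(* [simple_mod] tests parity-stable subspaces only; the eigenspaces of the V-linear
   involution [ptau] are such, so [ptau] is a scalar and every submodule is
   parity-stable. *)
Lemma simple_strict W (U : set W) : ndiag W -> simple_mod W -> vstable U ->
  (exists2 u, U u & u <> 0) -> forall w, U w.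
Proof.
move=> d [_ hs] hU [u0 Uu0 u00].
have [cL cs] := ptau_strict d; have cK := ptauK d.
have pc (w : W) : par (ptau w) = ptau (par w) by rewrite /ptau (tau_par _ d).
have eig (e : C) : e * e = 1 ->
    submod (@gY _ V W) [set w : W | ptau w = e *: w].
  move=> ee; apply: graded_submod.
    split; first split=> [|c u v] /=; first by rewrite (lm0 cL) scaler0.
      by move=> hu hv; rewrite cL hu hv scalerDr !scalerA mulrC.
    by move=> v n w /= hw; rewrite cs hw (lmZ (gYr _ _)).
  by move=> u /= hu; rewrite -pc hu parZ.
have Upar e u : (forall w : W, ptau w = e *: w) -> U u -> U (par u).
  move=> he Uu; rewrite par_ptau // he; apply: tau_sub => //.
  by apply: ssZ => //; exact: vs_sp.
have fin e : (forall w : W, ptau w = e *: w) -> forall w, U w.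
  move=> he w; have [U0|->//] := hs U (graded_submod hU (fun u => Upar e u he)).
  by case: u00; move: Uu0; rewrite U0.
have [e1|e1] := hs _ (eig 1 (mulr1 1)); last first.
  by apply: (fin 1) => w; have : [set: W] w by []; rewrite -e1.
have m1 : -1 * -1 = 1 :> C by rewrite mulrNN mulr1.
have [e2|e2] := hs _ (eig (-1) m1).
  exfalso; apply: u00.
  have h1 : ptau (u0 + ptau u0) = 1 *: (u0 + ptau u0).
    by rewrite (lmD cL) cK addrC scale1r.
  have h2 : ptau (u0 - ptau u0) = -1 *: (u0 - ptau u0).
    by rewrite (lmB cL) cK scaleN1r opprB.
  have {}h1 : u0 + ptau u0 = 0 by move: h1; rewrite -/([set w : W | ptau w = 1 *: w] _) e1.
  have {}h2 : u0 - ptau u0 = 0 by move: h2; rewrite -/([set w : W | ptau w = -1 *: w] _) e2.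
  by rewrite -[u0]half2 -[X in _ *: (X + _)](addrK (ptau u0)) h1 sub0r addrC h2 scaler0.
by apply: (fin (-1)) => w; have : [set: W] w by []; rewrite -e2.
Qed.

End GMod.

(** * Finite length and projective covers *)

Section Length.
Context {R : realType} {V : V1gl11 R}.
Local Notation C := R[i].
Implicit Types W X Z : gmod V.

(** A substitute for length on submodules that need not be graded: bounded, monotone, and strictly
    so on proper inclusions. *)
Definition is_rank W (U : set W) (r : set W -> nat) (N : nat) : Prop :=
  forall A B : set W, vstable A -> vstable B -> A `<=` B -> B `<=` U ->
    (r A <= r B <= N)%N /\ (r A = r B -> A = B).

Definition has_rank W (U : set W) : Prop := exists r N, is_rank U r N.

Lemma count_mono n (P Q : 'I_n -> bool) : (forall i, P i -> Q i) ->
  (\sum_i P i <= \sum_i Q i)%N /\ ((\sum_i P i)%N = (\sum_i Q i)%N -> P =1 Q).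
Proof.
move=> PQ; have le i : (P i <= Q i)%N by case e: (P i) => //; rewrite PQ.
split; first by apply: leq_sum => i _.
move=> e i; move: e; rewrite (bigD1 i) //= [RHS](bigD1 i) //=.
have : (\sum_(j | j != i) P j <= \sum_(j | j != i) Q j)%N by apply: leq_sum => j _.
by case: (P i) (Q i) (PQ i) => [] [] h /=; [|by have := h isT|lia|].
Qed.

Lemma count_max n (P : 'I_n -> bool) : (\sum_i P i <= n)%N.
Proof.
rewrite -[X in (_ <= X)%N]card_ord -sum1_card; apply: leq_sum => i _.
by case: (P i).
Qed.

(** The rank counts the steps of the composition series at which A acquires a new vector. *)
Lemma graded_rank W : finite_length (@gY _ V W) ->
  exists (r : set W -> nat) N, forall A B : set W,
    submod (@gY _ V W) A -> submod (@gY _ V W) B -> A `<=` B ->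
    (r A <= r B <= N)%N /\ (r A = r B -> A = B).
Proof.
move=> [n [U [U0 Un hU cov]]].
pose P (A : set W) (i : 'I_n) : bool := `[< exists x, [/\ A x, U i.+1 x & ~ U i x] >].
exists (fun A => \sum_i P A i)%N, n => A B hA hB AB.
have PAB i : P A i -> P B i.
  by move/asboolP=> [x [Ax h1 h2]]; apply/asboolP; exists x; split=> //; apply: AB.
have [le eq] := count_mono PAB; split; first by rewrite le count_max.
move=> /eq e; apply/seteqP; split=> // x Bx.
suff h i : (i <= n)%N -> forall x, B x -> U i x -> A x.
  by apply: (h n (leqnn n) x Bx); rewrite Un.
elim: i => [|i IH] le_i y By Uy.
  by move: Uy; rewrite U0 => ->; exact: (sm_0 hA).
have [Uiy|nUiy] := pselect (U i y); first exact: (IH (ltnW le_i)).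
have : P B (Ordinal le_i) by apply/asboolP; exists y.
rewrite -e => /asboolP[z [/= Az Uz nUz]].
(* The factor of U_{i+1} by U_i is simple among graded modules and A meets it, so U_{i+1} is the sum
   of U_i and the part of A inside U_{i+1}. *)
have [_ _ /(_ (sumset (U i) (A `&` U i.+1)))] := cov i le_i.
have vA := submod_vstable hA; have vU j := submod_vstable (hU j).
have UU : U i `<=` U i.+1 by have [] := cov i le_i.
case.
- apply: graded_submod; first by apply: vstable_sum => //; apply: vstableI.
  move=> _ [a [b [Ua [Ab Ub] ->]]]; exists (par a), (par b).
  by rewrite parD; split=> //; [exact: (sm_par (hU i))|split; [exact: (sm_par hA)|exact: (sm_par (hU _))]].
- by apply: sumset_l; apply: subspI; apply: vs_sp.
- by move=> _ [a [b [Ua [Ab Ub] ->]]]; apply: ssD; [exact: (vs_sp (vU _))|exact: UU|].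
- move=> e'; exfalso; apply: nUz; rewrite -e'.
  by apply: sumset_r => //; apply: vs_sp.
move=> e'; move: (Uy); rewrite -e' => -[a [b [Ua [Ab Ub] eab]]].
rewrite eab; apply: ssD => //; first exact: vs_sp.
apply: (IH (ltnW le_i)) => //.
rewrite (_ : a = y - b); last by rewrite eab addrK.
by apply: ssB => //; [exact: (vs_sp (submod_vstable hB))|exact: AB].
Qed.

(** With c = [ptau], the intersection and the sum of A and c A are graded, and by the modular law
    nested submodules sharing both are equal. The two graded ranks are added. *)
Lemma has_rankT W : ndiag W -> finite_length (@gY _ V W) -> has_rank [set: W].
Proof.
move=> d /graded_rank[r [N hr]].
have [cL cs] := ptau_strict d; have cK := ptauK d.
pose A1 (A : set W) := A `&` (fun x => A (ptau x)).
pose A2 (A : set W) := sumset A (fun x => A (ptau x)).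
have vc A : vstable A -> vstable (fun x : W => A (ptau x)).
  by apply: vstable_preim; exact: ptau_strict.
have pc (w : W) : ptau (par w) = tau w.
  by rewrite /ptau tau_par // parK.
have g1 A : vstable A -> submod (@gY _ V W) (A1 A).
  move=> hA; apply: graded_submod; first by apply: vstableI => //; apply: vc.
  move=> u [Au Acu]; split; first by rewrite par_ptau //; apply: tau_sub.
  by rewrite /= pc; apply: tau_sub.
have g2 A : vstable A -> submod (@gY _ V W) (A2 A).
  move=> hA; apply: graded_submod; first by apply: vstable_sum => //; apply: vc.
  move=> _ [a [b [Aa Acb ->]]]; exists (par b), (par a); rewrite parD addrC.
  split=> //; first by rewrite par_ptau //; apply: tau_sub.
  by rewrite pc; apply: tau_sub.
exists (fun A => r (A1 A) + r (A2 A))%N, (N + N)%N => A B hA hB AB _.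
have s1 : A1 A `<=` A1 B by move=> x [Ax Acx]; split; apply: AB.
have s2 : A2 A `<=` A2 B.
  by move=> _ [a [b [Aa Ab ->]]]; exists a, b; split=> //; apply: AB.
have [/andP[l1 m1] e1] := hr _ _ (g1 _ hA) (g1 _ hB) s1.
have [/andP[l2 m2] e2] := hr _ _ (g2 _ hA) (g2 _ hB) s2.
split; first by rewrite !leq_add.
move=> e; have {}e1 : A1 A = A1 B by apply: e1; lia.
have {}e2 : A2 A = A2 B by apply: e2; lia.
apply/seteqP; split=> // x Bx.
have : A2 B x by apply: sumset_l => //; apply: vs_sp; apply: vc.
rewrite -e2 => -[a [b [Aa Acb ex]]].
rewrite ex; apply: ssD => //; first exact: vs_sp.
suff: A1 A b by case.
rewrite e1; split; last exact: AB.
rewrite (_ : b = x - a); last by rewrite ex addrC addKr.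
by apply: ssB => //; [exact: vs_sp|exact: AB].
Qed.

(** A proper graded submodule is covered by any strictly larger graded one of least rank; iterating
    from 0 raises the rank each time, so the bound N stops the process. *)
Lemma finite_length_rank W (r : set W -> nat) N :
  (forall A B : set W, submod (@gY _ V W) A -> submod (@gY _ V W) B -> A `<=` B ->
    (r A <= r B <= N)%N /\ (r A = r B -> A = B)) -> finite_length (@gY _ V W).
Proof.
move=> hr; pose sm := submod (@gY _ V W).
have smT : sm setT by apply: graded_submod.
have sm0 : sm [set 0].
  apply: graded_submod; first exact: vstable0.
  by move=> u ->; rewrite /= (lm0 (@par_lin _ W)).
pose covers (A B : set W) := [/\ sm B, A `<=` B, A <> B &
   forall U', sm U' -> A `<=` U' -> U' `<=` B -> U' = A \/ U' = B].
have next A : sm A -> A <> setT -> exists B, covers A B.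
  move=> hA AT.
  have ex : exists k, `[< exists B, [/\ sm B, A `<=` B, A <> B & r B = k] >].
    by exists (r setT); apply/asboolP; exists setT.
  case: (ex_minnP ex) => k /asboolP[B [hB AB nAB rB]] hmin.
  exists B; split=> // U' hU' AU' U'B.
  have [->|nA] := pselect (U' = A); [by left|right].
  have [/andP[h1 _] h2] := hr _ _ hU' hB U'B; apply: h2.
  apply/eqP; rewrite eqn_leq h1 rB; apply: hmin; apply/asboolP; exists U'.
  by split=> // e; apply: nA.
pose nx (A : set W) : set W :=
  if pselect (exists B, covers A B) is left e then projT1 (cid e) else A.
have nxP A : sm A -> A <> setT -> covers A (nx A).
  move=> hA AT; rewrite /nx; case: pselect => [e|[]]; last exact: next.
  by case: (cid e).
pose U i := iter i nx [set 0].
have hU i : sm (U i).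
  elim: i => [|i IH] //=; rewrite /nx; case: pselect => // e.
  by case: (cid e) => B [].
have grow i : U i = setT \/ (i <= r (U i))%N.
  elim: i => [|i IH]; first by right.
  have [e|ne] := pselect (U i = setT).
    left; rewrite /= -/(U i) e /nx; case: pselect => // ex.
    case: (cid ex) => B [_ TB _ _] /=; apply/seteqP; split=> //.
  case: IH => // IH; right.
  have [hB AB nAB _] := nxP _ (hU i) ne.
  have [/andP[h1 _] h2] := hr _ _ (hU i) hB AB.
  rewrite /= -/(U i); apply: leq_ltn_trans IH _; rewrite ltn_neqAle h1 andbT.
  by apply/eqP => /h2.
have ex : exists n, `[< U n = setT >].
  exists N.+1; apply/asboolP; have [//|h] := grow N.+1.
  have [/andP[_ h'] _] := hr _ _ (hU N.+1) (hU N.+1) (fun _ h => h).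
  by have := leq_trans h h'; rewrite ltnn.
case: (ex_minnP ex) => n /asboolP eT hmin.
exists n, U; split=> // i lin.
have ni : U i <> setT by move=> e; have := hmin i (asboolT e); rewrite leqNgt lin.
by have [] := nxP _ (hU i) ni.
Qed.

(** The conditions of O_1^fin for a submodule of a possibly larger W, phrased without parity so that
    they pass to strict images and to sums. *)
Record finsub W (U : set W) : Prop := Finsub {
  fs_st : vstable U;
  fs_rk : has_rank U;
  fs_span : forall h, exists s : seq W, forall w, U w -> inspan s (gpr h w);
  fs_low : forall h, exists n0 : nat, forall n, (n0 <= n)%N ->
    forall w, U w -> gpr (h - n%:R) w = 0;
  fs_N : forall w, U w -> exists s, eigdec (gact gN 0 : W -> W) w s;
  fs_E : forall w, U w -> exists s, eigdec (gact gE 0 : W -> W) w s }.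

Lemma O1fin_ndiag W : O1fin W -> ndiag W. Proof. exact: O1_N. Qed.

Lemma finsubT W : O1fin W -> finsub [set: W].
Proof.
move=> hW; have [sp low] := O1_gr hW; split=> //.
- by apply: has_rankT; [exact: O1_N|exact: O1_len].
- by move=> h; have [s hs] := sp h; exists s => w _; apply: hs.
- by move=> h; have [n0 hn] := low h; exists n0 => n /hn hh w _.
- by move=> w _; apply: (O1_N hW).
- by move=> w _; apply: (O1_E hW).
Qed.

Lemma eigdec_map W X (f : W -> X) a w s : strict f ->
  eigdec (gact a 0 : W -> W) w s ->
  eigdec (gact a 0 : X -> X) (f w) [seq (p.1, f p.2) | p <- s].
Proof.
move=> [fL fs] [-> hs]; split; first by rewrite (lm_sum fL) big_map.
by move=> p /mapP[q qs ->] /=; rewrite -(lmZ fL) -hs // /gact fs.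
Qed.

Lemma finsub_image W X (f : W -> X) (U : set W) : strict f -> finsub U ->
  finsub (f @` U).
Proof.
move=> fs hU; have [fL _] := fs; split.
- by apply: vstable_image => //; apply: fs_st.
- have [r [N hr]] := fs_rk hU; exists (fun A => r (U `&` (fun x => A (f x)))), N.
  move=> A B hA hB AB BU.
  have vp D : vstable D -> vstable (U `&` (fun x => D (f x))).
    by move=> hD; apply: vstableI; [exact: fs_st|apply: vstable_preim].
  have [h1 h2] := hr _ _ (vp A hA) (vp B hB) (fun x '(conj Ux Ax) => conj Ux (AB _ Ax))
    (fun x '(conj Ux _) => Ux).
  split=> // /h2 e; apply/seteqP; split=> // y By.
  have [x Ux exy] := BU y By.
  have : (U `&` (fun x => B (f x))) x by split=> //; rewrite /= exy.
  by rewrite -e => -[_]; rewrite /= exy.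
- move=> h; have [s hs] := fs_span hU h; exists (map f s) => _ [w Uw <-].
  by rewrite -gpr_strict //; apply: inspan_map => //; apply: hs.
- move=> h; have [n0 hn] := fs_low hU h; exists n0 => n le _ [w Uw <-].
  by rewrite -gpr_strict // hn // (lm0 fL).
- by move=> _ [w Uw <-]; have [s hs] := fs_N hU Uw; eexists; apply: eigdec_map hs.
- by move=> _ [w Uw <-]; have [s hs] := fs_E hU Uw; eexists; apply: eigdec_map hs.
Qed.

Lemma finsub_sub W (A U : set W) : finsub U -> vstable A -> A `<=` U -> finsub A.
Proof.
move=> hU hA AU; split=> //.
- have [r [N hr]] := fs_rk hU; exists r, N => B D hB hD BD DA.
  by apply: hr => //; apply: subset_trans AU.
- by move=> h; have [s hs] := fs_span hU h; exists s => w /AU; apply: hs.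
- by move=> h; have [n0 hn] := fs_low hU h; exists n0 => n le w /AU; apply: hn.
- by move=> w /AU; apply: fs_N.
- by move=> w /AU; apply: fs_E.
Qed.

Lemma eigdec_add W (T : W -> W) u v s t : eigdec T u s -> eigdec T v t ->
  eigdec T (u + v) (s ++ t).
Proof.
move=> [-> hs] [-> ht]; split; first by rewrite big_cat.
by move=> p; rewrite mem_cat => /orP[/hs|/ht].
Qed.

(** Nested submodules D of A + B are separated by the intersections of D with A and of D + A with B;
    the ranks of these are added. *)
Lemma finsub_sum W (A B : set W) : finsub A -> finsub B -> finsub (sumset A B).
Proof.
move=> hA hB; have vA := fs_st hA; have vB := fs_st hB; split.
- exact: vstable_sum.
- have [r [N hr]] := fs_rk hA; have [r' [N' hr']] := fs_rk hB.
  exists (fun D => r (D `&` A) + r' (sumset D A `&` B))%N, (N + N')%N.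
  move=> D E hD hE DE EAB.
  have s2 : sumset D A `&` B `<=` sumset E A `&` B.
    by move=> x [[a [b [Da Ab ->]]] Bx]; split=> //; exists a, b; split=> //; apply: DE.
  have [||||[/andP[l1 m1] e1]] := hr (D `&` A) (E `&` A);
    [exact: vstableI|exact: vstableI|by move=> x [/DE ? ?]|by move=> x []|].
  have [||||[/andP[l2 m2] e2]] := hr' (sumset D A `&` B) (sumset E A `&` B);
    [by apply: vstableI => //; apply: vstable_sum|by apply: vstableI => //; apply: vstable_sum|exact: s2|by move=> x []|].
  split; first by rewrite !leq_add.
  move=> e; have {}e1 : D `&` A = E `&` A by apply: e1; lia.
  have {}e2 : sumset D A `&` B = sumset E A `&` B by apply: e2; lia.
  apply/seteqP; split=> // x Ex.
  have [a [b [Aa Bb exab]]] := EAB x Ex.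
  have : (sumset E A `&` B) b.
    split=> //; exists x, (- a); split=> //; last by rewrite exab addrAC subrr add0r.
    by apply: ssN => //; apply: vs_sp.
  rewrite -e2 => -[[d [a' [Dd Aa' eb]]] _].
  have Ae : A (a + a') by apply: ssD => //; apply: vs_sp.
  have xd : x = d + (a + a') by rewrite exab eb addrCA.
  rewrite xd; apply: ssD => //; first exact: vs_sp.
  suff: (D `&` A) (a + a') by case.
  rewrite e1; split=> //.
  rewrite (_ : a + a' = x - d); last by rewrite xd addrAC subrr add0r.
  by apply: ssB => //; [exact: vs_sp|exact: DE].
- move=> h; have [s hs] := fs_span hA h; have [t ht] := fs_span hB h.
  exists (s ++ t) => _ [a [b [Aa Bb ->]]]; rewrite (lmD (@gpr_lin _ _ _ h)).
  by apply: inspan_cat; [exact: hs|exact: ht].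
- move=> h; have [n0 hn] := fs_low hA h; have [n1 hn1] := fs_low hB h.
  exists (maxn n0 n1) => n; rewrite geq_max => /andP[l0 l1] _ [a [b [Aa Bb ->]]].
  by rewrite (lmD (@gpr_lin _ _ _ _)) hn // hn1 // addr0.
- move=> _ [a [b [Aa Bb ->]]]; have [s hs] := fs_N hA Aa; have [t ht] := fs_N hB Bb.
  by exists (s ++ t); apply: eigdec_add.
- move=> _ [a [b [Aa Bb ->]]]; have [s hs] := fs_E hA Aa; have [t ht] := fs_E hB Bb.
  by exists (s ++ t); apply: eigdec_add.
Qed.

Lemma O1fin_sub W Z (i : Z -> W) (U : set W) : finsub U -> strict i -> injective i ->
  (forall z, U (i z)) -> O1fin Z.
Proof.
move=> hU fs fI iU; have [fL fY] := fs.
have vim (A : set Z) : vstable A -> vstable (i @` A) by apply: vstable_image.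
split.
- split=> [h|h].
    have [s hs] := fs_span hU h.
    have [||t [tK tS]] := @fin_dim_sub _ W s (i @` [set z | gpr h z = z]).
    + split=> [|c _ _ [u /= hu <-] [v /= hv <-]].
        by exists 0; rewrite ?(lm0 fL) //= (lm0 (@gpr_lin _ _ _ h)).
      by exists (c *: u + v); rewrite ?fL //= gpr_lin hu hv.
    + by move=> _ [z /= hz <-]; rewrite -hz gpr_strict //; apply: hs.
    have [t' et] : exists t' : seq Z, map i t' = t.
      elim: t tK {tS} => [|x t IH] tK; first by exists [::].
      have [|t' et] := IH; first by move=> y yt; apply: tK; rewrite inE yt orbT.
      by have [|z _ ez] := tK x; [rewrite mem_head|exists (z :: t'); rewrite /= ez et].
    exists t' => z; have [|c hc] := tS (i (gpr h z)).
      by exists (gpr h z) => //=; have [n hn] := gpr_wt h z; apply: gpr_id hn.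
    exists c; apply: fI; rewrite hc -et size_map (lm_sum fL).
    by apply: eq_bigr => k _; rewrite (lmZ fL) (nth_map 0).
  have [n0 hn] := fs_low hU h; exists n0 => n le z; apply: fI.
  by rewrite gpr_strict // hn // (lm0 fL).
- have [r [N hr]] := fs_rk hU.
  apply: (@finite_length_rank Z (fun A => r (i @` A)) N) => A B hA hB AB.
  have [||||[h1 h2]] := hr (i @` A) (i @` B).
  + by apply: vim; apply: submod_vstable.
  + by apply: vim; apply: submod_vstable.
  + by move=> _ [z Az <-]; exists z => //; apply: AB.
  + by move=> _ [z _ <-].
  split=> // /h2 e; apply/seteqP; split=> // z Bz.
  by have : (i @` B) (i z); [exists z|rewrite -e => -[z' Az' /fI <-]].
- move=> z; have [s hs] := fs_N hU (iU z).
  by apply: (eigdec_pull (gactr _ _) (gactr _ _) fL fI _ hs) => u; apply: fY.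
- move=> z; have [s hs] := fs_E hU (iU z).
  by apply: (eigdec_pull (gactr _ _) (gactr _ _) fL fI _ hs) => u; apply: fY.
Qed.

(** Here [tau] serves as parity, since U need not be stable under [par]. *)
Lemma finsub_obj W (U : set W) : ndiag W -> finsub U ->
  exists (Z : finO V) (i : Z -> W), [/\ strict i, injective i, (forall z, U (i z)) &
    forall w, U w -> exists z, i z = w].
Proof.
move=> d hU; have [|||||Z [i [iS iI iU Ui _]]] := @subobj _ V W U (@tau _ V W).
- exact: fs_st.
- exact: tau_lin.
- exact: tauK.
- exact: tau_act.
- by move=> w; apply: tau_sub => //; exact: fs_st.
by exists (FinO (O1fin_sub hU iS iI iU)), i.
Qed.

Lemma in_ind_finsub W (w : W) : in_ind W -> exists U : set W, finsub U /\ U w.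
Proof.
move=> hW; have [X [f [hX fe fI [x fx]]]] := hW w.
have fs := sfun_strict f.
have fE u : conjJ 'i f u = f u.
  by apply: conjJ_even; [exact: sqri|exact: hlin|move=> y; rewrite fe expr0 scale1r].
exists (range (conjJ 'i f)); split; last by exists x => //; rewrite fE.
by apply: finsub_image => //; apply: finsubT.
Qed.

Lemma in_ind_ndiag W : in_ind W -> ndiag W.
Proof. by move=> hW w; have [U [hU Uw]] := in_ind_finsub w hW; apply: (fs_N hU). Qed.

Lemma in_ind_ediag W : in_ind W -> diagz (gact gE 0 : W -> W).
Proof. by move=> hW w; have [U [hU Uw]] := in_ind_finsub w hW; apply: (fs_E hU). Qed.

(** Each vector of U comes from an object X of O_1^fin mapped into W, and the preimage of U in X is
    again in O_1^fin. *)
Lemma ind_subobj (W : indO V) (U : set W) : vstable U -> (forall u, U u -> U (par u)) ->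
  exists (Z : indO V) (i : Z -> W),
    [/\ strict i, injective i, (forall z, U (i z)), (forall w, U w -> exists z, i z = w) &
     forall z, i (par z) = par (i z)].
Proof.
move=> hU Up; have [||||Z [i [iS iI iU Ui ip]]] := @subobj _ V W U (@par _ W) hU.
- exact: par_lin.
- exact: parK.
- by move=> v n w; rewrite (vm_par (gax W)).
- exact: Up.
suff hZ : in_ind Z by exists (IndO hZ), i.
move=> z; have [X [f [hX fe fI [x fx]]]] := iP (i z).
have fs := sfun_strict f; have fp y : f (par y) = par (f y) by rewrite fe expr0 scale1r.
have fE u : conjJ 'i f u = f u by apply: conjJ_even => //; [exact: sqri|exact: hlin].
have [fL fY] : strict f.
  by move: fs; rewrite (_ : conjJ 'i f = f) //; apply/funext.
pose A := [set y : X | U (f y)].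
have hA : vstable A by apply: vstable_preim.
have [||||Y [j [jS jI jA Aj jp]]] := @subobj _ V X A (@par _ X) hA.
- exact: par_lin.
- exact: parK.
- by move=> v n w; rewrite (vm_par (gax X)).
- by move=> w Aw; rewrite /A /= fp; apply: Up.
have oY : O1fin Y by apply: (O1fin_sub (finsub_sub (finsubT hX) hA _) jS jI jA).
pose g (y : Y) : Z := projT1 (cid (Ui _ (jA y))).
have gE y : i (g y) = f (j y) by rewrite /g; case: (cid _).
have [iL iY] := iS; have [jL jY] := jS.
have gS : strict g.
  split=> [c u v|v n w]; apply: iI; rewrite ?iL ?iY !gE ?jL ?jY ?fL ?fY //.
have [G eG] := strict_ghom gS.
have gp y : g (par y) = par (g y) by apply: iI; rewrite ip !gE jp fp.
have eG' y : G y = g y.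
  rewrite eG; apply: conjJ_even => //; last exact: gS.1.
  by rewrite mulrNN sqri.
exists Y, G; split=> //.
- by move=> y; rewrite expr0 scale1r !eG' gp.
- by move=> y y'; rewrite !eG' => /(congr1 i); rewrite !gE => /fI /jI.
have [|y jy] := Aj x; first by rewrite /A /= fx.
by exists y; rewrite eG'; apply: iI; rewrite gE jy.
Qed.

Lemma surj_strict W X (f : W -> X) : (forall y, exists x, f x = y) ->
  forall y, exists x, conjJ 'i f x = y.
Proof.
move=> hf y; have [x hx] := hf (J (- 'i) y).
by exists (J 'i x); rewrite /conjJ J_K hx J_VK.
Qed.

Lemma surj_super W X (f : W -> X) : (forall y, exists x, f x = y) ->
  forall y, exists x, conjJ (- 'i) f x = y.
Proof.
move=> hf y; have [x hx] := hf (J 'i y).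
by exists (J (- 'i) x); rewrite /conjJ opprK J_VK hx J_K.
Qed.

Lemma conjJ_eq W X (f g : W -> X) : (forall u, f u = g u) ->
  forall z u, conjJ z f u = conjJ z g u.
Proof. by move=> h z u; rewrite /conjJ h. Qed.

Definition sproj (P : gmod V) : Prop := forall (X Y : finO V) (p : X -> Y) (f : P -> Y),
  strict p -> (forall y, exists x, p x = y) -> strict f ->
  exists g : P -> X, strict g /\ forall u, p (g u) = f u.

(** Conjugation by [J] exchanges lifting problems for supermorphisms with lifting problems for
    strict maps. *)
Lemma sprojP (P : finO V) :
  @projective (finO V) (fun W : finO V => W) (fun _ => True)
    (fun (W X : finO V) f => exists F : ghom W X, (F : _ -> _) = f) P <-> sproj P.
Proof.
split=> [[_ h] X Y p f ps pS fs|h].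
  have [p' ep] := strict_ghom ps; have [f' ef] := strict_ghom fs.
  have [||g [[G eG] hg]] := h X Y p' f' I I.
  - split; first by exists p'.
    by rewrite ep; apply: surj_super.
  - by exists f'.
  exists (conjJ 'i G); split; first exact: sfun_strict.
  move=> u; have hp x : p x = conjJ 'i p' x by rewrite ep conjJVK.
  by rewrite hp -(conjJ_comp p' G) eG (conjJ_eq hg) ef conjJVK.
split=> // X Y p f _ _ [[p' ep] pS] [f' ef].
have [g [gs hg]] := h X Y (conjJ 'i p') (conjJ 'i f') (sfun_strict p')
  (surj_strict (W := X) (X := Y) (f := p') (eq_ind_r (fun q => forall y, exists x, q x = y) pS ep))
  (sfun_strict f').
have [G eG] := strict_ghom gs; exists G; split; first by exists G.
move=> u; rewrite -ep -ef -[LHS](conjJK (fun u => p' (G u))) -[RHS](conjJK f').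
apply: conjJ_eq => x.
by rewrite (conjJ_comp p' G) eG conjJVK hg.
Qed.

End Length.

(** * Fitting decomposition and lifting into the ind-completion *)

Section ProjectiveLemmas.
Context {R : realType} {V : V1gl11 R}.
Local Notation C := R[i].
Implicit Types W X Z : gmod V.

Lemma corestrict W X Z (f : W -> X) (j : Z -> X) : strict f -> strict j -> injective j ->
  (forall w, exists z, j z = f w) -> exists g : W -> Z, strict g /\ forall w, j (g w) = f w.
Proof.
move=> [fL fs] [jL js] jI h; pose g w := projT1 (cid (h w)).
have gE w : j (g w) = f w by rewrite /g; case: (cid _).
exists g; split=> //; split=> [c u v|v n w]; apply: jI; first by rewrite gE fL jL !gE.
by rewrite gE fs js gE.
Qed.

Lemma strict_iter W (f : W -> W) n : strict f -> strict (iter n f).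
Proof. by move=> fs; elim: n => [|n IH]; [exact: strict_id|exact: (strict_comp fs IH)]. Qed.

Lemma vstable_ker W X (f : W -> X) : strict f -> vstable [set w | f w = 0].
Proof. by move=> fs; apply: (vstable_preim fs (vstable0 X)). Qed.

Lemma vstable_range W X (f : W -> X) : strict f -> vstable (range f).
Proof. by move=> fs; apply: vstable_image. Qed.

Lemma bounded_stable (F : nat -> nat) N : (forall n, F n <= F n.+1)%N ->
  (forall n, F n <= N)%N -> exists n, forall m, (n <= m)%N -> F m = F n.
Proof.
move=> mono bd.
have ex : exists k, `[< exists n, F n = k >] by exists (F 0); apply/asboolP; exists 0%N.
have [|k /asboolP[n <-] hmax] := ex_maxnP ex (m := N).
  by move=> k /asboolP[n <-].
exists n => m le; apply/eqP; rewrite eqn_leq hmax; last by apply/asboolP; exists m.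
by apply: (@homo_leq _ F leq) => //; [exact: leq_trans].
Qed.

Lemma bounded_stable_decr (F : nat -> nat) : (forall n, F n.+1 <= F n)%N ->
  exists n, forall m, (n <= m)%N -> F m = F n.
Proof.
move=> mono.
have bd n : (F n <= F 0)%N by elim: n => // n IH; apply: leq_trans (mono n) IH.
have [|n|n hn] := @bounded_stable (fun n => F 0 - F n)%N (F 0).
- by move=> n; apply: leq_sub2l.
- exact: leq_subr.
exists n => m /hn; have := bd n; have := bd m; lia.
Qed.

(** The kernels of the iterates stabilize at some n. A kernel vector of F is F^n x for some x; then
    x is in the kernel of F^{n+1}, which is that of F^n. *)
Lemma surj_endo_inj W (F : W -> W) : has_rank [set: W] -> strict F ->
  (forall y, exists x, F x = y) -> injective F.
Proof.
move=> [r [N hr]] Fs FS; pose K n := [set w | iter n F w = 0].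
have hK n : vstable (K n) by apply: vstable_ker; exact: strict_iter.
have F0 : F 0 = 0 by rewrite (lm0 Fs.1).
have KS n : K n `<=` K n.+1 by move=> w; rewrite /K /= => ->.
have [n|n|n hn] := @bounded_stable (fun n => r (K n)) N.
- by have [/andP[]] := hr _ _ (hK n) (hK n.+1) (KS n) (fun _ _ => Logic.I).
- by have [/andP[]] := hr _ _ (hK n) (hK n.+1) (KS n) (fun _ _ => Logic.I) => h1 h2 _; apply: leq_trans h2.
have eK : K n = K n.+1.
  by have [_] := hr _ _ (hK n) (hK n.+1) (KS n) (fun _ _ => Logic.I); apply; rewrite (hn n.+1).
have iS m y : exists x, iter m F x = y.
  elim: m y => [|m IH] y; first by exists y.
  by have [x <-] := FS y; have [z <-] := IH x; exists z.
move=> a b eab; apply/eqP; rewrite -subr_eq0; apply/eqP.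
have [x ex] := iS n (a - b).
have : K n.+1 x by rewrite /K /= ex (lmB Fs.1) eab subrr.
by rewrite -eK /K /= ex.
Qed.

Record scover (P S : finO V) (pi : P -> S) : Prop := Scover {
  sc_proj : sproj P;
  sc_strict : strict pi;
  sc_surj : forall s, exists w, pi w = s;
  sc_univ : forall (Q : finO V) (q : Q -> S), sproj Q -> strict q ->
    (forall s, exists w, q w = s) ->
    exists q' : Q -> P, [/\ strict q', forall w, exists u, q' u = w &
      forall u, q u = pi (q' u)] }.

Lemma cover_strict (P S : finO V) : projective_cover_O1fin P S ->
  exists pi : P -> S, scover pi.
Proof.
move=> [_ [/sprojP hP [pi [[[F eF] piS] univ]]]].
exists (conjJ 'i F); split=> //; first exact: sfun_strict.
  by rewrite eF; apply: surj_strict.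
move=> Q q hQ qs qS; have [q0 eq0] := strict_ghom qs.
have [||q' [[[G eG] q'S] hq']] := univ Q q0.
- exact/sprojP.
- by split; [exists q0|rewrite eq0; apply: surj_super].
exists (conjJ 'i G); split; first exact: sfun_strict.
  by rewrite eG; apply: surj_strict.
move=> u; rewrite -(conjJ_comp F G) -[LHS](conjJVK q).
by apply: conjJ_eq => x; rewrite -eq0 hq' eF eG.
Qed.

(* Fitting's lemma: an endomorphism f of P over S splits off an f-stable
   projective summand mapping onto S, on which f is invertible. *)
Lemma essential (P S : finO V) (pi : P -> S) (U : set P) : scover pi -> vstable U ->
  (forall s, exists2 u, U u & pi u = s) -> forall w, U w.
Proof.
move=> [hP piSt piS univ] hU piU; have dP := O1fin_ndiag (fP P).
have [r [N hr]] := has_rankT dP (O1_len (fP P)).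
have [Z [i [iS iI iU Ui]]] := finsub_obj dP (finsub_sub (finsubT (fP P)) hU (fun _ _ => Logic.I)).
(* Projectivity lifts [pi] through the surjection of U onto S, which gives an endomorphism f of P
   over S with image in U. *)
have [g [gS hg]] : exists g : P -> Z, strict g /\ forall u, pi (i (g u)) = pi u.
  apply: (hP Z S (fun z => pi (i z)) pi _ _ piSt); first exact: strict_comp.
  by move=> s; have [u Uu <-] := piU s; have [z <-] := Ui u Uu; exists z.
pose f u := i (g u); have fs : strict f by apply: strict_comp.
have pif n u : pi (iter n f u) = pi u by elim: n => //= n IH; rewrite hg.
have its n := strict_iter n fs; have itL n := (its n).1.
pose K n := [set w : P | iter n f w = 0]; pose Im n := range (iter n f).
have hK n : vstable (K n) by apply: vstable_ker.
have hI n : vstable (Im n) by apply: vstable_range.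
have KS n : K n `<=` K n.+1 by move=> w; rewrite /K /= => ->; rewrite (lm0 fs.1).
have IS n : Im n.+1 `<=` Im n by move=> _ [w _ <-]; exists (f w) => //; rewrite -iterSr.
have rT A B : vstable A -> vstable B -> A `<=` B -> (r A <= r B <= N)%N /\ (r A = r B -> A = B).
  by move=> hA hB AB; apply: hr.
have [n|n|n1 h1] := @bounded_stable (fun n => r (K n)) N.
- by have [/andP[]] := rT _ _ (hK n) (hK n.+1) (KS n).
- by have [/andP[_ h] _] := rT _ _ (hK n) (hK n) (fun _ h => h).
have [n|n2 h2] := @bounded_stable_decr (fun n => r (Im n)).
  by have [/andP[]] := rT _ _ (hI n.+1) (hI n) (IS n).
have [n en] : exists n, n = (n1 + n2).+1 by exists (n1 + n2).+1.
have Kle m k : K m `<=` K (k + m)%N by move=> w; rewrite /K /= iterD => ->; rewrite (lm0 (itL k)).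
have Ile m k : Im (m + k)%N `<=` Im m by move=> _ [w _ <-]; exists (iter k f w); rewrite ?iterD.
have eK : K (n + n)%N = K n.
  have [_ e] := rT _ _ (hK n) (hK (n + n)%N) (Kle n n); rewrite e //.
  by rewrite (h1 n) ?(h1 (n + n)%N) //; lia.
have eI m : (n <= m)%N -> Im m = Im n.
  move=> le; rewrite -(subnKC le).
  have [_ e] := rT _ _ (hI (n + (m - n))%N) (hI n) (Ile n (m - n)%N); apply: e.
  by rewrite (h2 n) ?(h2 (n + (m - n))%N) //; lia.
(* Q is the stable image of f. Since f^n is invertible on it, Q is a retract of P and hence
   projective. *)
have [Q [j [jS jI jIm Imj]]] :=
  finsub_obj dP (finsub_sub (finsubT (fP P)) (hI n) (fun _ _ => Logic.I)).
have [rho [rhoS hrho]] : exists rho : P -> Q, strict rho /\ forall w, j (rho w) = iter n f w.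
  by apply: corestrict => // w; apply: Imj; exists w.
pose th q := rho (j q); have thS : strict th by apply: strict_comp.
have thI : injective th.
  move=> a b /(congr1 j); rewrite /th !hrho => e; apply: jI.
  apply/eqP; rewrite -subr_eq0; apply/eqP.
  have [x _ ex] := jIm a; have [y _ ey] := jIm b.
  rewrite -ex -ey -(lmB (itL n)); have : K (n + n)%N (x - y).
    by rewrite /K /= iterD (lmB (itL n)) ex ey (lmB (itL n)) e subrr.
  by rewrite eK.
have thSu q : exists q0, th q0 = q.
  have : Im (n + n)%N (j q) by rewrite eI ?leq_addl //; apply: jIm.
  case=> y _ ey; have [q0 e0] : exists q0, j q0 = iter n f y by apply: Imj; exists y.
  by exists q0; apply: jI; rewrite hrho e0 -iterD.
have [thi [thiS hthi]] : exists thi : Q -> Q, strict thi /\ forall q, th (thi q) = q.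
  by apply: corestrict => //; exact: strict_id.
have hQ : sproj Q.
  move=> X Y p phi ps pS phis.
  have [|G [GS hG]] := hP X Y p (fun w => phi (thi (rho w))) ps pS.
    exact: (strict_comp phis (strict_comp thiS rhoS)).
  exists (fun q => G (j q)); split; first exact: strict_comp.
  move=> q; rewrite hG; congr phi; apply: thI; rewrite hthi; exact: erefl.
have [|s|q' [q'S q'Su hq']] := univ Q (fun q => pi (j q)) hQ.
- exact: strict_comp.
- have [w <-] := piS s; have [q eq] : exists q, j q = iter n f w by apply: Imj; exists w.
  by exists q; rewrite eq pif.
(* The cover maps Q onto P, so P maps onto itself through f^n; such a surjective endomorphism is
   injective, and so is f^n. *)
have FI : injective (fun w => q' (rho w)).
  apply: surj_endo_inj; [by exists r, N|exact: strict_comp|].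
  move=> y; have [q <-] := q'Su y; have [q0 e0] := thSu q.
  by exists (j q0); rewrite -e0.
have fnI : injective (iter n f).
  by move=> a b e; apply: FI; congr q'; apply: jI; rewrite !hrho.
(* The vector f^n w lies in the image of f^{n+1}, so injectivity of f^n puts w in the image of f,
   which is inside U. *)
move=> w; have : Im n.+1 (iter n f w) by rewrite eI //; exists w.
case=> y _; rewrite iterSr => /fnI <-; exact: iU.
Qed.

(* A finite-length P meets only finitely generated pieces of X and Y, so the lifting
   problem takes place in O_1^fin. *)
Lemma sproj_ind (P : finO V) (X Y : gmod V) (p : X -> Y) (f : P -> Y) : sproj P ->
  in_ind X -> in_ind Y -> strict p -> (forall y, exists x, p x = y) -> strict f ->
  exists g : P -> X, strict g /\ forall u, p (g u) = f u.
Proof.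
move=> hP iX iY ps pS fs; have dP := O1fin_ndiag (fP P).
have [r [N hr]] := has_rankT dP (O1_len (fP P)).
pose D (A : set X) := [set w : P | exists2 x, A x & p x = f w].
have hD A : vstable A -> vstable (D A).
  by move=> hA; apply: (vstable_preim fs (vstable_image ps hA)).
have rT A B : vstable A -> vstable B -> A `<=` B -> (r A <= r B <= N)%N /\ (r A = r B -> A = B).
  by move=> hA hB AB; apply: hr.
(* A is chosen with D A, the part of P whose values under f lie in p(A), of maximal rank. Enlarging
   A by any further piece leaves D A unchanged, so D A is all of P. *)
have ex : exists k, `[< exists A, finsub A /\ r (D A) = k >].
  have [A [hA _]] := in_ind_finsub 0 iX.
  by exists (r (D A)); apply/asboolP; exists A.
have [|k /asboolP[A [hA <-]] hmax] := ex_maxnP ex (m := N).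
  move=> k /asboolP[A [hA <-]].
  by have [/andP[_ h] _] := rT _ _ (hD _ (fs_st hA)) (hD _ (fs_st hA)) (fun _ h => h).
have DA w : D A w.
  have [x ex'] := pS (f w); have [B [hB Bx]] := in_ind_finsub x iX.
  have hAB := finsub_sum hA hB.
  have sub : D A `<=` D (sumset A B).
    move=> u [a Aa ea]; exists a => //; apply: sumset_l => //; exact: (vs_sp (fs_st hB)).
  have [/andP[le _] e] := rT _ _ (hD _ (fs_st hA)) (hD _ (fs_st hAB)) sub.
  rewrite e; last first.
    apply/eqP; rewrite eqn_leq le /=; apply: hmax; apply/asboolP.
    by exists (sumset A B).
  by exists x => //; apply: sumset_r => //; exact: (vs_sp (fs_st hA)).
have [Xo [i [iS iI iA Ai]]] := finsub_obj (in_ind_ndiag iX) hA.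
have [Yo [j [jS jI jB Bj]]] := finsub_obj (in_ind_ndiag iY) (finsub_image ps hA).
have [p' [p'S hp']] : exists p' : Xo -> Yo, strict p' /\ forall x, j (p' x) = p (i x).
  apply: (corestrict (strict_comp ps iS)) => // x; apply: Bj; by exists (i x).
have [f' [f'S hf']] : exists f' : P -> Yo, strict f' /\ forall w, j (f' w) = f w.
  by apply: corestrict => // w; apply: Bj; have [x Ax e] := DA w; exists x.
have [|g [gS hg]] := hP Xo Yo p' f' p'S _ f'S.
  move=> y; have [x Ax ex'] := jB y; have [z ez] := Ai x Ax.
  by exists z; apply: jI; rewrite hp' ez.
exists (fun u => i (g u)); split; first exact: strict_comp.
by move=> u; rewrite -hp' hg hf'.
Qed.

End ProjectiveLemmas.

(** * Intertwining operators and the Knizhnik-Zamolodchikov equation *)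

Section Intertwining.
Context {R : realType} {V : V1gl11 R}.
Local Notation C := R[i].
Variables (W1 W2 W3 : gmod V) (I : @coefs R W1 W2 W3).
Hypothesis hI : intertwining I.

Let Il h k w2 := it_linl hI h k w2.
Let Ir w1 h k := it_linr hI w1 h k.

Lemma it_comm b v w1 h k w2 (m : int) : homog b v ->
  exists K0, forall K, (K0 <= K)%N ->
    gY v m (I w1 h k w2) - I (parb b w1) h k (gY v m w2) =
    \sum_(i < K) gbin m i *: I (gY v i%:Z w1) (m%:~R + h - i%:R) k w2.
Proof.
move=> hv; have [K0 hK] := it_jacobi hI w1 w2 0 m h k hv.
exists K0.+1 => K; case: K => // K le; have := hK K.+1 (ltnW le).
under eq_bigr do rewrite add0r.
move=> ->; rewrite big_ord_recl big1 ?addr0; last first.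
  by move=> i _; rewrite gbin0S mulr0 scale0r.
by rewrite gbin0 expr0 mulr1 scale1r /= expr0z scale1r ?mulr0z ?addr0 ?subr0.
Qed.

Lemma it_iter b v w1 h k w2 (l : int) : homog b v ->
  exists K0, forall K, (K0 <= K)%N ->
    I (gY v l w1) h k w2 =
    \sum_(i < K) ((-1) ^+ i * gbin l i) *:
      (gY v (l - i%:Z) (I w1 (h + i%:R) k w2)
       - (-1) ^ l *: I (parb b w1) (h + l%:~R - i%:R) k (gY v i%:Z w2)).
Proof.
move=> hv; have [K0 hK] := it_jacobi hI w1 w2 l 0 h k hv.
exists K0.+1 => K; case: K => // K le; have := hK K.+1 (ltnW le).
under [X in _ = X]eq_bigr do rewrite !add0r.
move=> <-; rewrite big_ord_recl big1 ?addr0; last first.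
  by move=> i _; rewrite gbin0S scale0r.
by rewrite gbin0 scale1r /= ?mulr0z ?addr0 ?add0r ?subr0.
Qed.

Section Stable.
Variable A : C -> nat -> set W3.
Hypothesis hA : forall h k, vstable (A h k).
Hypothesis Az : forall h k (m : int) x, A (h + m%:~R) k x -> A h k x.

Hypothesis Ap : forall h k x, A h k x -> A h k (par x).

(** The iterate formula expresses the coefficients for a_l w1 through those for w1 and its parity
    twist at exponents differing by integers, as [Az] and [Ap] permit. It spreads a property from a
    generator of a summand of A to the whole summand. *)
Lemma it_stable_left : vstable [set w1 | forall w2 h k, A h k (I w1 h k w2)].
Proof.
apply: vstable_gi.
  split=> [w2 h k|c u v hu hv w2 h k].
    by rewrite (lm0 (Il _ _ _)); apply: ss0; apply: vs_sp.
  by rewrite Il; apply: ssl; [exact: vs_sp|exact: hu|exact: hv].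
move=> a l w1 hw w2 h k.
have hw' w h' : A h' k (I (parb (godd a) w1) h' k w).
  case: (godd a) => //=; rewrite -[w]parK -(it_par hI); exact/Ap/hw.
have [K0 /(_ K0 (leqnn _))] := it_iter w1 h k w2 l (@gi_par _ V a).
rewrite /gact => ->; apply: ss_sum; first exact: vs_sp.
move=> i _ _; apply: ssZ; first exact: vs_sp.
apply: ssB; first exact: vs_sp.
  apply: (vs_act (hA _ _)); apply: (@Az _ _ i%:Z); rewrite -pmulrn; exact: hw.
apply: ssZ; first exact: vs_sp.
apply: (@Az _ _ (l - i%:Z)).
rewrite (_ : h + (l - i%:Z)%:~R = h + l%:~R - i%:R); last by rewrite rmorphB /= addrA -pmulrn.
exact: hw'.
Qed.
End Stable.

Variables (s : bool) (j : nat) (n e : C) (a : W1).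
Hypothesis va : vaclike (@gY _ V W1) s j n e a.
Hypothesis he : e = (-1) ^+ (~~ s) * j%:R.

Definition curr (e n : C) : V := e *: gi V gN + n *: gi V gE.
Local Notation h := (curr e n).

Lemma curr_mode (W : gmod V) r (w : W) :
  gY h r w = e *: gact gN r w + n *: gact gE r w.
Proof. by rewrite /curr (lmD (gYl _ _)) !(lmZ (gYl _ _)). Qed.

Lemma homog_curr : homog false h.
Proof. by apply/homogP; rewrite /curr parD !parZ !par_gi !expr0 !scale1r. Qed.

Lemma curr_a (i : nat) : gY h i%:Z a = if i == 0%N then (e * n + n * e) *: a else 0.
Proof.
rewrite curr_mode; case: i => [|i] /=.
  by rewrite /gact (vl_N0 va) (vl_E0 va) !scalerA scalerDl.
by rewrite /gact (vl_N va) // (vl_E va) // !scaler0 addr0.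
Qed.

Lemma curr_comm (W : gmod V) (r t : int) (w : W) :
  gY h r (gY h t w) = gY h t (gY h r w) +
    (if r + t == 0 then (r%:~R * (e * n + n * e)) *: w else 0).
Proof.
have N r' := (gYr (W := W) (gi V gN) r'); have E r' := (gYr (W := W) (gi V gE) r').
have NN := @aff_cartan _ _ _ _ (gax W) gN gN r t w isT.
have NE := @aff_cartan _ _ _ _ (gax W) gN gE r t w isT.
have EN := @aff_cartan _ _ _ _ (gax W) gE gN r t w isT.
have EE := @aff_cartan _ _ _ _ (gax W) gE gE r t w isT.
rewrite /= !scale0r !add0r !mulr0 !mulr1 in NN NE EN EE.
rewrite !curr_mode /gact !(lmD (N _)) !(lmD (E _)) !(lmZ (N _)) !(lmZ (E _)).
rewrite NN NE EN EE; case: ifP => _; last by rewrite !addr0 !scalerDr addrACA !scalerA [n * e]mulrC.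
rewrite scale0r !addr0 !scalerDr !scalerA.
rewrite mulrDr scalerDl [LHS](AC (1*2*3) ((1*4)*(2*6)*(3*5)))%AC.
by congr (_ + _ *: _ + (_ *: _ + _) + (_ *: _ + _ *: _)); ring.
Qed.

Hypothesis aL : gY (omega V) 0 a = gY h (-1) a.

(* L_{-1} a = h_{-1} a turns the L_{-1}-derivative property into a
   Knizhnik-Zamolodchikov equation for I(a, x). *)
Lemma it_diff g k w : exists K0, forall K, (K0 <= K)%N ->
  k.+1%:R *: I a g k.+1 w - (g + 1) *: I a g k w =
  \sum_(i < K) (gY h (-1 - i%:Z) (I a (g + 1 + i%:R) k w) + I a (g - i%:R) k (gY h i%:Z w)).
Proof.
have [K0 hK] := it_iter a (g + 1) k w (-1) homog_curr.
exists K0 => K /hK; rewrite -aL -/(Lm1 a) (it_deriv hI) addrK => e1.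
rewrite addrC -scaleNr e1; apply: eq_bigr => i _.
rewrite gbinN1 -exprD addnn -signr_odd odd_double expr0 scale1r exprN1 invrN1 scaleN1r opprK /=.
by congr (_ + I a _ k _); rewrite rmorphN1; ring.
Qed.

Section Highest.
Variables (lam : C) (w : W2).
Hypothesis w0 : gY h 0 w = lam *: w.
Hypothesis wp : forall i : nat, gY h i.+1%:Z w = 0.

(** In powers of x: x^(-g-1) (log x)^k can occur only for k = 0 and -g-1 in lam + N. *)
Definition KZstmt g := forall k, (0 < k)%N \/ (forall m : nat, g + 1 + lam <> - m%:R) ->
  I a g k w = 0.

Lemma it_diff_h g k : exists K0, forall K, (K0 <= K)%N ->
  k.+1%:R *: I a g k.+1 w - (g + 1 + lam) *: I a g k w =
  \sum_(i < K) gY h (-1 - i%:Z) (I a (g + 1 + i%:R) k w).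
Proof.
have [K0 hK] := it_diff g k w; exists K0.+1; case=> // K le.
rewrite scalerDl opprD addrA (hK K.+1 (ltnW le)) big_split /=.
rewrite [X in _ + X - _]big_ord_recl [X in _ + (_ + X) - _]big1 ?addr0; last first.
  by move=> i _; rewrite wp (lm0 (Ir _ _ _)).
by rewrite /= subr0 w0 (lmZ (Ir _ _ _)) addrK.
Qed.

(** Wherever the right side of [it_diff_h] vanishes, (k+1) I_{k+1} = (g+1+lam) I_k. If g+1+lam = 0,
    this kills all logarithms; otherwise the vanishing of I_k for large k propagates downwards. *)
Lemma KZ_step g : (forall i : nat, KZstmt (g + 1 + i%:R)) -> KZstmt g.
Proof.
move=> IH; pose S k := k.+1%:R *: I a g k.+1 w - (g + 1 + lam) *: I a g k w.
have S0 k : (0 < k)%N \/ (forall m : nat, g + 1 + lam <> - m.+1%:R) -> S k = 0.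
  move=> hk; rewrite /S; have [K0 /(_ K0 (leqnn _)) ->] := it_diff_h g k.
  rewrite big1 // => i _; rewrite IH ?(lm0 (gYr _ _)) //.
  case: hk => [k0|hg]; [by left|right=> m hm; apply: (hg (i + m)%N)].
  rewrite -addnS natrD opprD -natr1 opprD addrA -[- m%:R]hm; ring.
have [c0|c0] := eqVneq (g + 1 + lam) 0.
  have Sk k : S k = 0.
    by apply: S0; right=> m; rewrite c0 => /eqP; rewrite eq_sym oppr_eq0 pnatr_eq0.
  have Ik k : I a g k.+1 w = 0.
    have := Sk k; rewrite /S c0 scale0r subr0 => /eqP.
    by rewrite scaler_eq0 pnatr_eq0 => /eqP.
  case=> [[//|h0]|k _]; last exact: Ik.
  by case: (h0 0%N); rewrite c0 oppr0.
have desc (p : nat) : (forall k, (p <= k)%N -> S k = 0) -> forall k, (p <= k)%N -> I a g k w = 0.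
  move=> hS; have [k0 hk0] := it_log hI a w g.
  have main d : forall k, (p <= k)%N -> (k0 <= k + d)%N -> I a g k w = 0.
    elim: d => [|d IHd] k pk le; first by apply: hk0; rewrite -[k]addn0.
    have := hS k pk; rewrite /S IHd ?(leq_trans pk) //; last by rewrite addSnnS.
    by rewrite scaler0 sub0r => /eqP; rewrite oppr_eq0 scaler_eq0 (negPf c0) => /eqP.
  by move=> k pk; apply: (main k0 k pk); rewrite leq_addl.
move=> k hk; case: (posnP k) => [k0|k0]; last first.
  by apply: (desc 1%N) => // k' k'0; apply: S0; left.
apply: (desc 0%N) => // k' _; apply: S0; right=> m hm.
by case: hk => [|/(_ m.+1)]; [rewrite k0|move=> []].
Qed.

(** Truncation makes the coefficients vanish at g + m for large m, and [KZ_step] descends from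
    there. *)
Lemma KZ_highest g : KZstmt g.
Proof.
have [m0 hm0] := it_trunc hI a w g.
have main d : forall g', (forall m, (d <= m)%N -> forall k, I a (g' + m%:R) k w = 0) -> KZstmt g'.
  elim: d => [|d IH] g' ht; first by move=> k _; have := ht 0%N (leqnn _) k; rewrite addr0.
  apply: KZ_step => i; apply: IH => m dm k.
  have := ht (1 + i + m)%N; rewrite !natrD !addrA; apply.
  by rewrite -addnA add1n ltnS (leq_trans dm) // leq_addl.
by apply: (main m0) => m le k; apply: hm0.
Qed.
End Highest.

(** Any integral shift of the exponent is allowed, unlike in [KZstmt], so that the condition
    survives the negative modes of h. *)
Definition KZgood (lam : C) (w : W2) := forall g k,
  (0 < k)%N \/ (forall m : int, g <> - lam + m%:~R) -> I a g k w = 0.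

Lemma KZgood_highest lam w : gY h 0 w = lam *: w -> (forall i : nat, gY h i.+1%:Z w = 0) ->
  KZgood lam w.
Proof.
move=> w0 wp g k hk; apply: (KZ_highest w0 wp).
case: hk => [k0|hg]; [by left|right=> m hm; apply: (hg (- m.+1%:Z))].
rewrite rmorphN /= -pmulrn -natr1 opprD -hm; ring.
Qed.

Lemma KZgood_lin lam : subsp (KZgood lam).
Proof.
split=> [g k _|c u v hu hv g k hk]; first by rewrite (lm0 (Ir _ _ _)).
by rewrite Ir hu // hv // scaler0 addr0.
Qed.

(** As h_i a = 0 for i > 0 and h_0 a = 2 e n a, commuting h_m with a coefficient only yields a
    multiple of the coefficient with exponent shifted by m. *)
Lemma KZgood_act lam w (m : int) : KZgood lam w -> KZgood lam (gY h m w).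
Proof.
move=> hw g k hk; have [K0 /(_ K0.+1 (leqnSn _))] := it_comm a g k w m homog_curr.
rewrite big_ord_recl big1 ?addr0; last first.
  by move=> i _; rewrite curr_a (lm0 (Il _ _ _)) scaler0.
rewrite /= (curr_a 0) (lmZ (Il _ _ _)) hw // (lm0 (gYr _ _)) sub0r hw; last first.
  case: hk => [|hg]; [by left|right=> m' hm; apply: (hg (m' - m))].
  move: hm => /(congr1 (fun x => x - m%:~R)); rewrite rmorphB /= subr0 addrAC subrr add0r => ->.
  by rewrite addrA.
by rewrite !scaler0 => /eqP; rewrite oppr_eq0 => /eqP.
Qed.

End Intertwining.

(** * Heisenberg modules for the modes of h *)

Section Heisenberg.
Context {R : realType} {V : V1gl11 R}.
Local Notation C := R[i].
Variables (W : gmod V) (e n : C).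
Local Notation h := (curr e n : V).
Local Notation H := (@gY _ V W h).
Local Notation kap := (e * n + n * e).
Local Notation L0 := (@gY _ V W (omega V) 1).

Let HL m : lin_map (H m) := gYr h m.

Lemma L0_curr (m : int) (w : W) : L0 (H m w) = H m (L0 w) - m%:~R *: H m w.
Proof.
have LL : lin_map L0 by exact: gYr.
rewrite !curr_mode (lmD LL) !(lmZ LL) /gact !(L0_current _ _ _ (gax W)).
rewrite !scalerDr !scalerN !scalerA opprD ![m%:~R * _]mulrC.
by rewrite addrACA.
Qed.

Lemma curr_shift N x (m : int) (u : W) :
  iter N (fun u => L0 u - (x - m%:~R) *: u) (H m u) =
  H m (iter N (fun u => L0 u - x *: u) u).
Proof.
elim: N => //= N ->; rewrite L0_curr (lmB (HL m)) (lmZ (HL m)) scalerBl opprB.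
by rewrite addrA subrK.
Qed.

(** The mode h_{k+1} lowers generalized L_0-weights by k+1, and going down from any weight in
    integral steps ends in zero spaces. *)
Lemma curr_nilp (k : nat) (w : W) : O1fin W -> exists N, iter N (H k.+1%:Z) w = 0.
Proof.
move=> hW; have [Jf [_ ew]] := gpr_sum w; have [_ low] := O1_gr hW.
have itL N := lin_iter N (HL k.+1%:Z).
suff [N hN] : exists N, forall x, x \in enum_fset Jf -> iter N (H k.+1%:Z) (gpr x w) = 0.
  by exists N; rewrite ew (lm_sum (itL N)) big_seq big1.
have one x : exists N, forall N', (N <= N')%N -> iter N' (H k.+1%:Z) (gpr x w) = 0.
  have [n0 hn0] := low x; exists n0 => N' le.
  have [p hp] := gpr_wt x w.
  have : iter p (fun u => L0 u - (x - (N' * k.+1)%:R) *: u) (iter N' (H k.+1%:Z) (gpr x w)) = 0.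
    elim: (N') => [|q IH]; first by rewrite mul0n subr0.
    rewrite mulSn addnC natrD opprD addrA [iter q.+1 _ _]/=.
    have := curr_shift p (x - (q * k.+1)%:R) k.+1%:Z (iter q (H k.+1%:Z) (gpr x w)).
    by rewrite -pmulrn => ->; rewrite IH (lm0 (HL _)).
  move/gpr_id => <-; apply: hn0; apply: leq_trans le _; exact: leq_pmulr.
elim: (enum_fset Jf) => [|x r [N hN]]; first by exists 0%N.
have [N' hN'] := one x; exists (maxn N' N) => y; rewrite inE => /orP[/eqP ->|yr].
  by apply: hN'; apply: leq_maxl.
by rewrite -(subnK (leq_maxr N' N)) iterD hN // (lm0 (itL _)).
Qed.

Lemma H_commute (r t : int) (w : W) : r + t != 0 -> H r (H t w) = H t (H r w).
Proof. by move=> rt; rewrite curr_comm (negPf rt) addr0. Qed.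

Lemma H_iter_commute (r t : int) N (w : W) : r + t != 0 ->
  H r (iter N (H t) w) = iter N (H t) (H r w).
Proof. by move=> rt; elim: N => //= N IH; rewrite H_commute // IH. Qed.

Lemma H_lower (k N : nat) (u : W) : H k.+1%:Z u = 0 ->
  H k.+1%:Z (iter N.+1 (H (- k.+1%:Z)) u) =
  (N.+1%:R * (k.+1%:R * kap)) *: iter N (H (- k.+1%:Z)) u.
Proof.
move=> hu; elim: N => [|N IH].
  by rewrite /= curr_comm hu (lm0 (HL _)) add0r subrr eqxx mul1r.
rewrite [iter N.+2 _ _]iterS curr_comm IH (lmZ (HL _)) subrr eqxx -iterS -scalerDl.
by rewrite -[N.+2%:R]natr1 mulrDl mul1r.
Qed.

Lemma H_lower_iter (k N : nat) (u : W) : H k.+1%:Z u = 0 ->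
  iter N (H k.+1%:Z) (iter N (H (- k.+1%:Z)) u) = (N`!%:R * (k.+1%:R * kap) ^+ N) *: u.
Proof.
move=> hu; elim: N => [|N IH]; first by rewrite /= fact0 expr0 mulr1 scale1r.
rewrite iterSr H_lower // (lmZ (lin_iter _ (HL _))) IH scalerA; congr (_ *: _).
by rewrite factS natrM exprS; ring.
Qed.

Variables (lam : C) (G : set W).
Hypothesis hW : O1fin W.
Hypothesis kap0 : kap != 0.
Hypothesis Gs : subsp G.
Hypothesis GH : forall m w, G w -> G (H m w).
Hypothesis Ghi : forall w, H 0 w = lam *: w -> (forall i : nat, H i.+1%:Z w = 0) -> G w.

(* H_0-eigenvectors lie in the Fock modules generated by highest-weight vectors. *)
Lemma Heis_gen w : H 0 w = lam *: w -> G w.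
Proof.
(* The outer induction bounds the positive modes that may act nontrivially on w; the inner one is on
   the nilpotency order of h_{j+1} on w. *)
have key j : forall w, H 0 w = lam *: w -> (forall i : nat, (j <= i)%N -> H i.+1%:Z w = 0) -> G w.
  elim: j => [|j IHj] {}w w0 wj; first by apply: Ghi => // i; apply: wj.
  have [N hN] := curr_nilp j w hW.
  elim: N w w0 wj hN => [|N IHN] w w0 wj hN; first by move: hN => /= ->; apply: ss0.
  pose u := iter N (H j.+1%:Z) w.
  have itL m k := lin_iter m (HL k).
  have u0 : H 0 u = lam *: u by rewrite /u H_iter_commute // w0 (lmZ (itL _ _)).
  have hu : H j.+1%:Z u = 0 by [].
  have uj (i : nat) : (j < i)%N -> H i.+1%:Z u = 0.
    by move=> ji; rewrite /u H_iter_commute // wj // (lm0 (itL _ _)).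
  have Gu : G u.
    apply: IHj => // i; rewrite leq_eqVlt => /orP[/eqP <- //|]; exact: uj.
  (* The inverse of the scalar in [H_lower_iter], so that h_{j+1}^N kills w - c x and the inner
     induction applies to it. *)
  pose c := (N`!%:R * (j.+1%:R * kap) ^+ N)^-1; pose x := iter N (H (- j.+1%:Z)) u.
  have c0 : N`!%:R * (j.+1%:R * kap) ^+ N != 0.
    by rewrite mulf_neq0 ?expf_neq0 ?mulf_neq0 ?pnatr_eq0 // -lt0n fact_gt0.
  have Gx : G x by rewrite /x; elim: (N) => //= q IHq; apply: GH.
  rewrite -[w](subrK (c *: x)); apply: ssD => //; last exact: ssZ.
  have x0 : H 0 x = lam *: x by rewrite /x H_iter_commute ?u0 ?(lmZ (itL _ _)).
  apply: IHN.
  - by rewrite (lmB (HL _)) (lmZ (HL _)) w0 x0 scalerBr !scalerA mulrC.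
  - move=> i ji; rewrite (lmB (HL _)) (lmZ (HL _)) wj // /x H_iter_commute; last by lia.
    by rewrite uj // (lm0 (itL _ _)) scaler0 subr0.
  - by rewrite (lmB (itL _ _)) (lmZ (itL _ _)) /x H_lower_iter // scalerA mulVf // scale1r subrr.
move=> w0; have [n1 h1] := vm_trunc (gax W) h w.
apply: (key `|n1|%N) => // i le; apply: h1; lia.
Qed.

End Heisenberg.

Section KZ.
Context {R : realType} {V : V1gl11 R}.
Local Notation C := R[i].

Lemma KZ_eigen (W1 W2 W3 : gmod V) (I : @coefs R W1 W2 W3) s j (n e : C) (a : W1) lam w :
  intertwining I -> O1fin W2 -> vaclike (@gY _ V W1) s j n e a ->
  e = (-1) ^+ (~~ s) * j%:R -> e * n != 0 ->
  gY (curr e n : V) 0 w = lam *: w -> KZgood I a lam w.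
Proof.
move=> hI hW va he en0 w0.
have aL : gY (omega V) 0 a = gY (curr e n : V) (-1) a.
  by rewrite (vaclike_Lm1 (gax W1) va he) curr_mode.
apply: (@Heis_gen _ _ W2 e n lam (KZgood I a lam) hW) => //.
- by rewrite [n * e]mulrC -mulr2n -mulr_natl mulf_neq0 ?pnatr_eq0.
- exact: KZgood_lin.
- by move=> m u; apply: (KZgood_act hI va).
- by move=> u u0 up; apply: (KZgood_highest hI aL u0 up).
Qed.

End KZ.

(** * Tensor products and monodromy *)

Section Cexp.
Context {R : realType}.
Local Notation C := R[i].
Local Notation ip := ('i * pi%:C : C).

Lemma cexpD (x y : C) : cexp (x + y) = cexp x * cexp y.
Proof.
case: x y => [a b] [c d]; rewrite /cexp /= expRD cosD sinD rmorphM /=.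
rewrite mulrACA; congr (_ * _).
by apply/eqP; rewrite eq_complex /= [sin b * sin d]mulrC addrC; apply/andP; split; apply/eqP; ring.
Qed.

Lemma cexp0 : cexp (0 : C) = 1.
Proof. by rewrite /cexp /= expR0 cos0 sin0 mul1r. Qed.

Lemma cexp_ip : cexp (- ip) = -1.
Proof.
have -> : - ip = (0 +i* (- pi))%C.
  by apply/eqP; rewrite eq_complex /=; apply/andP; split; apply/eqP; ring.
rewrite /cexp /= expR0 cosN sinN cospi sinpi oppr0 mul1r.
by apply/eqP; rewrite eq_complex /= oppr0 !eqxx.
Qed.

Lemma cexp_nat n : cexp (- ip * n%:R) = (-1) ^+ n.
Proof.
elim: n => [|n IH]; first by rewrite mulr0 cexp0.
by rewrite -natr1 mulrDr mulr1 cexpD IH cexp_ip exprSr.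
Qed.

Lemma cexp_int (m : int) : cexp (- ip * (2 * m%:~R)) = 1.
Proof.
have nat1 n : cexp (- ip * (2 * n%:R)) = 1.
  by rewrite -natrM cexp_nat -signr_odd mul2n odd_double expr0.
case: m => n; first by rewrite -pmulrn nat1.
have := nat1 n.+1; rewrite NegzE rmorphN /= -pmulrn !mulrN => h.
have := cexpD (- ip * (2 * n.+1%:R)) (- (- ip * (2 * n.+1%:R))).
by rewrite subrr cexp0 h mul1r => <-.
Qed.

(** Once the integral part of Re z is removed, real and imaginary parts give y = 0 and sin (pi x) =
    0, whence x = 0 on [0, 1). *)
Lemma cexp_eq1 (z : C) : cexp (- ip * (2 * z)) = 1 -> exists m : int, z = m%:~R.
Proof.
case: z => a b; pose m := Num.floor a; pose x := a - m%:~R; pose y := b.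
have ez : (a +i* b)%C = m%:~R + (x +i* y)%C.
  have -> : m%:~R = (m%:~R : R)%:C :> C by rewrite rmorph_int.
  by apply/eqP; rewrite eq_complex /= /x /y addrCA subrr addr0 add0r !eqxx.
have x1 : 0 <= x < 1.
  have /andP[l1 l2] := Num.Theory.floor_itv a.
  by rewrite /x subr_ge0 l1 ltrBlDl addrC; move: l2; rewrite rmorphD /= addrC.
clearbody x y; rewrite ez !mulrDr cexpD cexp_int mul1r => h; exists m.
have e : - ip * (2 * (x +i* y)%C) = ((2 * (pi * y)) +i* (- (2 * (pi * x))))%C.
  apply/eqP; rewrite eq_complex /=; apply/andP; split; apply/eqP; ring.
move: h; rewrite e /cexp /= cosN sinN => /eqP; rewrite eq_complex /= => /andP[/eqP h1 /eqP h2].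
have {}h1 : expR (2 * (pi * y)) * cos (2 * (pi * x)) = 1 by move: h1; rewrite mul0r subr0.
have {}h2 : expR (2 * (pi * y)) * sin (2 * (pi * x)) = 0.
  by move: h2; rewrite mul0r addr0 mulrN => /eqP; rewrite oppr_eq0 => /eqP.
have s0 : sin (2 * (pi * x)) = 0.
  by move/eqP: h2; rewrite mulf_eq0 gt_eqF ?expR_gt0 // => /eqP.
have c1 : cos (2 * (pi * x)) ^+ 2 = 1 by rewrite cos2sin2 s0 expr0n subr0.
have cp : 0 < cos (2 * (pi * x)).
  by rewrite -(pmulr_rgt0 _ (expR_gt0 (2 * (pi * y)))) h1.
have {}c1 : cos (2 * (pi * x)) = 1.
  by apply/eqP; rewrite -(eqrXn2 (n := 2)) ?expr1n ?c1 // ltW.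
have y0 : y = 0.
  move: h1; rewrite c1 mulr1 -[X in _ = X]expR0 => /expR_inj /eqP.
  by rewrite !mulf_eq0 pnatr_eq0 (gt_eqF (pi_gt0 R)) => /eqP.
have x0 : x = 0.
  case/andP: x1; rewrite le_eqVlt => /orP[/eqP -> //|x0 x1].
  have : 0 < sin (pi * x).
    by apply: sin_gt0_pi; rewrite mulr_gt0 ?pi_gt0 //= gtr_pMr ?pi_gt0.
  have := c1; rewrite mulr_natl cos_mulr2n cos2sin2 => h sp.
  have : sin (pi * x) ^+ 2 = 0 by lra.
  by move/eqP; rewrite expf_eq0 /= gt_eqF.
by rewrite x0 y0 addr0.
Qed.

End Cexp.

(** * Finite form of the skew-symmetry series *)

Section Skew.
Context {R : realType}.
Local Notation C := R[i].
Local Notation ip := ('i * pi%:C : C).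

Lemma fsbig_box (W : zmodType) (F : nat * nat -> W) M K :
  (forall p, ~~ ((p.1 < M) && (p.2 < K))%N -> F p = 0) ->
  \sum_(p \in [set: nat * nat]) F p = \sum_(i < M) \sum_(j < K) F (nat_of_ord i, nat_of_ord j).
Proof.
move=> hF.
rewrite (@fsbigE _ _ _ _ _ [seq (i, j) | i <- iota 0 M, j <- iota 0 K]) //.
- under eq_bigl do rewrite in_setT.
  rewrite big_allpairs; under eq_bigr do rewrite -[K in iota 0 K]subn0 big_mkord.
  by rewrite -[M in iota 0 M]subn0 big_mkord.
- by apply: allpairs_uniq => [||[? ?] [? ?] _ _ //]; apply: iota_uniq.
move=> [i j] _ h; apply: hF; apply: contra h => /= /andP[iM jK].
by apply/allpairsP; exists (i, j); rewrite !mem_iota.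
Qed.

Lemma shift_sum (W : nmodType) (N p : nat) (g : nat -> W) :
  (forall n, (N <= n)%N -> g n = 0) ->
  \sum_(q < N) g (p + q)%N = \sum_(n < N | (p <= n)%N) g n.
Proof.
move=> hg.
have e2 : \sum_(n < N | (p <= n)%N) g n = \sum_(p <= n < N) g n by rewrite big_geq_mkord.
have e : \sum_(q < N) g (p + q)%N = \sum_(p <= n < N + p) g n.
  rewrite -{2}[p]add0n big_addn addnK big_mkord.
  by apply: eq_bigr => i _; rewrite addnC.
have z m : (N <= m)%N -> \sum_(m <= n < N + p) g n = 0.
  by move=> Nm; rewrite big_nat_cond big1 // => i /andP[/andP[h _] _]; apply: hg; apply: leq_trans h.
rewrite e e2; have [pN|Np] := leqP p N.
  by rewrite (big_cat_nat (n := N)) ?leq_addr //= z ?addr0.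
by rewrite z ?(ltnW Np) // big_geq // ltnW.
Qed.

(** The coefficients of e^{-x} e^x = 1; it collapses the two exponentials of L_{-1} in a double
    braiding. *)
Lemma alt_fact_sum n :
  \sum_(p < n.+1) (-1) ^+ p / ((p`!)%:R * ((n - p)`!)%:R) = (n == 0%N)%:R :> C.
Proof.
have e : \sum_(p < n.+1) (-1) ^+ p / ((p`!)%:R * ((n - p)`!)%:R) =
    (1 - 1) ^+ n / (n`!)%:R :> C.
  rewrite exprBn mulr_suml; apply: eq_bigr => p _; rewrite !expr1n !mulr1.
  have le : (p <= n)%N by rewrite -ltnS.
  have -> : (n`!)%:R = ('C(n, p))%:R * ((p`!)%:R * ((n - p)`!)%:R) :> C.
    by rewrite -(bin_fact le) !natrM.
  have c0 : ('C(n, p))%:R != 0 :> C by rewrite pnatr_eq0 -lt0n bin_gt0.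
  by rewrite -[_ *+ 'C(n, p)]mulr_natr [in RHS]invfM -[RHS]mulrA mulVKf.
by rewrite e subrr expr0n; case: n {e} => [|n]; rewrite /= ?fact0 ?divr1 ?mul0r.
Qed.

Context {V : V1gl11 R}.

Definition skew_coef (h : C) (k : nat) (p : nat * nat) : C :=
  cexp (- ip * (h + p.1%:R + 1)) * ('C(k + p.2, k))%:R * ip ^+ p.2 / (p.1`!)%:R.

Lemma skewE W1 W2 (W3 : gmod V) (Jc : @coefs R W2 W1 W3) w1 h k w2 M K :
  (forall p : nat * nat, ~~ ((p.1 < M) && (p.2 < K))%N -> Jc w2 (h + p.1%:R) (k + p.2)%N w1 = 0) ->
  skew Jc w1 h k w2 = \sum_(i < M) \sum_(j < K)
    skew_coef h k (nat_of_ord i, nat_of_ord j) *: iter i (@Lm1 _ _ W3) (Jc w2 (h + i%:R) (k + j)%N w1).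
Proof.
move=> hJ; rewrite /skew (@fsbig_box _ _ M K) // => p /hJ ->.
by rewrite (lm0 (lin_iter _ (gYr _ _))) scaler0.
Qed.

(** Truncation leaves finitely many exponents of x, and these have a common bound on the power of
    log x. *)
Lemma it_box (W1 W2 W3 : gmod V) (I : @coefs R W1 W2 W3) w1 w2 h k : intertwining I ->
  exists M, forall M', (M <= M')%N -> exists K0, forall K, (K0 <= K)%N ->
    forall p : nat * nat, ~~ ((p.1 < M') && (p.2 < K))%N ->
    I w1 (h + p.1%:R) (k + p.2)%N w2 = 0.
Proof.
move=> hI; have [m0 hm] := it_trunc hI w1 w2 h; exists m0 => M' le.
have [K0 hK] : exists K0, forall i, (i < M')%N -> forall k', (K0 <= k')%N ->
    I w1 (h + i%:R) k' w2 = 0.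
  elim: (M') => [|M [K0 IH]]; first by exists 0%N.
  have [k0 hk0] := it_log hI w1 w2 (h + M%:R); exists (maxn K0 k0) => i.
  rewrite ltnS leq_eqVlt => /orP[/eqP ->|iM] k'; rewrite geq_max => /andP[l1 l2].
    exact: hk0.
  exact: IH.
exists K0 => K leK [i j] /=; rewrite negb_and -!leqNgt => /orP[Mi|Kj].
  by apply: hm; apply: leq_trans le Mi.
have [iM|Mi] := ltnP i M'; last by apply: hm; apply: leq_trans le Mi.
by apply: hK => //; apply: leq_trans leK (leq_trans Kj (leq_addl _ _)).
Qed.

Lemma strict_Lm1 (W X : gmod V) (f : ghom W X) n (w : W) :
  f (iter n (@Lm1 _ _ W) w) = iter n (@Lm1 _ _ X) (f w).
Proof.
by elim: n => //= n IH; rewrite /Lm1 (hcomm f _ _ (homog_omega V)) /= -/(Lm1 _) IH.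
Qed.

End Skew.

(** * Calculus of tensor products and the double braiding *)

Section Tensor.
Context {R : realType} {V : V1gl11 R} (T : HLZ V).
Local Notation C := R[i].
Local Notation obj := (indO V).
Local Notation "W ** X" := (tens T W X) (at level 40).
Local Notation ip := ('i * pi%:C : C).

Lemma hevenP (W X : gmod V) (f : W -> X) : heven f <-> forall w, f (par w) = par (f w).
Proof. by split=> h w; have := h w; rewrite expr0 scale1r. Qed.

Lemma heven_id (W : gmod V) : heven (hid W).
Proof. by apply/hevenP. Qed.

Lemma heven_comp (W X Z : gmod V) (g : ghom X Z) (f : ghom W X) :
  heven g -> heven f -> heven (hcompose g f).
Proof. by move=> /hevenP hg /hevenP hf; apply/hevenP => w /=; rewrite hf hg. Qed.

Lemma conjJ_ghom z (W X : gmod V) (f : ghom W X) w : z * z = -1 -> heven f -> conjJ z f w = f w.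
Proof. by move=> hz /hevenP fe; apply: conjJ_even => //; apply: hlin. Qed.

Lemma strict_even_ghom (W X : gmod V) (f : W -> X) : strict f ->
  (forall w, f (par w) = par (f w)) -> exists F : ghom W X, (F : W -> X) = f /\ heven F.
Proof.
move=> fs fp; have [F eF] := strict_ghom fs.
have e : (F : W -> X) = f.
  rewrite eF; apply/funext => w; apply: conjJ_even => //; last exact: fs.1.
  by rewrite mulrNN sqri.
by exists F; split=> //; apply/hevenP => w; rewrite e.
Qed.

Definition tcoef (W1 W2 : obj) : set (W1 ** W2) :=
  [set t | exists w1 h k w2, t = tY T w1 h k w2].

(** The coefficients span a graded submodule Z, and tY corestricts to an intertwining operator into
    Z. The induced map to Z followed by the inclusion is the identity, by uniqueness. *)
Lemma tens_span (W1 W2 : obj) t : spanset (@tcoef W1 W2) t.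
Proof.
pose U := spanset (@tcoef W1 W2); have hU : subsp U by apply: subsp_span.
have hI := tY_intw T W1 W2.
have vU : vstable U.
  apply: vstable_gi => // a n; apply: (span_min (U := fun w => U (gact a n w))).
    by apply: subsp_preim => //; exact: gactr.
  move=> _ [w1 [h [k [w2 ->]]]] /=.
  have [K0 /(_ K0 (leqnn _))] := it_comm hI w1 h k w2 n (@gi_par _ V a).
  rewrite -/(gact a n _) => /(canRL (subrK _)) ->; apply: ssD => //.
    apply: ss_sum => // i _ _; apply: ssZ => //.
    by apply: span_sub; do 4!eexists.
  by apply: span_sub; do 4!eexists.
have pU u : U u -> U (par u).
  move: u; apply: (span_min (U := fun w => U (par w))).
    by apply: subsp_preim => //; exact: par_lin.
  by move=> _ [w1 [h [k [w2 ->]]]]; rewrite (it_par hI); apply: span_sub; do 4!eexists.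
have [Z [i [iS iI iU Ui ip']]] := ind_subobj vU pU; have [iL iY] := iS.
have ex w1 h k w2 : exists z, i z = tY T w1 h k w2.
  by apply: Ui; apply: span_sub; exists w1, h, k, w2.
pose I' : @coefs R W1 W2 Z := fun w1 h k w2 => projT1 (cid (ex w1 h k w2)).
have iE w1 h k w2 : i (I' w1 h k w2) = tY T w1 h k w2 by rewrite /I'; case: (cid _).
have hI' : intertwining I'.
  split.
  - by move=> h k w2 c u v; apply: iI; rewrite iL !iE (it_linl hI).
  - by move=> w1 h k c u v; apply: iI; rewrite iL !iE (it_linr hI).
  - by move=> w1 h k w2; apply: iI; rewrite ip' !iE (it_par hI).
  - move=> w1 w2 h; have [m0 hm] := it_trunc hI w1 w2 h; exists m0 => m k le.
    by apply: iI; rewrite iE hm // (lm0 iL).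
  - move=> w1 w2 h; have [m0 hm] := it_log hI w1 w2 h; exists m0 => k le.
    by apply: iI; rewrite iE hm // (lm0 iL).
  - move=> b v w1 w2 l m h k hv; have [K0 hK] := it_jacobi hI w1 w2 l m h k hv.
    exists K0 => K /hK e; apply: iI; rewrite !(lm_sum iL).
    under eq_bigr do rewrite (lmZ iL) iE.
    under [RHS]eq_bigr do rewrite (lmZ iL) (lmB iL) (lmZ iL) iY !iE.
    exact: e.
  - move=> w1 h k w2; apply: iI; rewrite iE (it_deriv hI) (lmD iL) !(lmZ iL) !iE //.
have [f [fe fE _]] := tY_univ T hI'.
have [F [eF Fe]] := strict_even_ghom iS ip'.
have [g [_ _ gU]] := tY_univ T hI.
have h1 : forall t, hid _ t = g t by apply: gU => //; apply: heven_id.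
have h2 : forall t, hcompose F f t = g t.
  apply: gU; first exact: heven_comp.
  by move=> w1 h k w2 /=; rewrite fE eF iE.
have -> : t = i (f t) by rewrite -eF -[F _]/(hcompose F f t) h2 -h1.
exact: iU.
Qed.

Lemma tens_ext (W1 W2 : obj) (Z : lmodType C) (f g : W1 ** W2 -> Z) :
  lin_map f -> lin_map g ->
  (forall w1 h k w2, f (tY T w1 h k w2) = g (tY T w1 h k w2)) -> forall t, f t = g t.
Proof.
move=> fL gL fg t; apply: (span_eq fL gL _ (tens_span t)).
by move=> _ [w1 [h [k [w2 ->]]]].
Qed.

Lemma tYl (W1 W2 : obj) h k (w2 : W2) : lin_map (fun w1 : W1 => tY T w1 h k w2).
Proof. exact: (it_linl (tY_intw T W1 W2)). Qed.
Lemma tYr (W1 W2 : obj) (w1 : W1) h k : lin_map (fun w2 : W2 => tY T w1 h k w2).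
Proof. exact: (it_linr (tY_intw T W1 W2)). Qed.
Lemma tYp (W1 W2 : obj) (w1 : W1) h k (w2 : W2) :
  par (tY T w1 h k w2) = tY T (par w1) h k (par w2).
Proof. exact: (it_par (tY_intw T W1 W2)). Qed.

Lemma tens_ext_homog (W1 W2 : obj) (Z : lmodType C) (f g : W1 ** W2 -> Z) :
  lin_map f -> lin_map g ->
  (forall b1 b2 w1 h k w2, homog b1 w1 -> homog b2 w2 ->
     f (tY T w1 h k w2) = g (tY T w1 h k w2)) -> forall t, f t = g t.
Proof.
move=> fL gL fg; apply: tens_ext => // w1 h k w2.
have ev := @homog_pev R; have ho := @homog_pod R.
rewrite -[w1]pevpod -[w2]pevpod (lmD (tYl _ _ _)) !(lmD (tYr _ _ _)) !(lmD fL) !(lmD gL).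
by congr (_ + _ + (_ + _)); apply: fg; [exact: ev|exact: ev|exact: ev|exact: ho|exact: ho|exact: ev|exact: ho|exact: ho].
Qed.

Lemma hcomp_even (W X : gmod V) (g : W -> X) w : heven g -> hcomp false g w = g w.
Proof. by move=> /hevenP ge; rewrite /hcomp expr0 scale1r ge parK half2. Qed.

Lemma hcomp_even1 (W X : gmod V) (g : W -> X) w : heven g -> hcomp true g w = 0.
Proof. by move=> /hevenP ge; rewrite /hcomp expr1 scaleN1r ge parK subrr scaler0. Qed.

Lemma tmapE0 (W1 W2 X1 X2 : obj) (f : ghom W1 X1) (g : ghom W2 X2) w1 h k w2 : heven g ->
  tmap T f g (tY T w1 h k w2) = tY T (f w1) h k (g w2).
Proof.
move=> ge; rewrite tmapE big_bool /= hcomp_even // hcomp_even1 //.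
by rewrite (lm0 (tYr _ _ _)) add0r.
Qed.

Lemma tmap_eq (W1 W2 X1 X2 : obj) (f f' : ghom W1 X1) (g g' : ghom W2 X2) :
  (forall w, f w = f' w) -> (forall w, g w = g' w) ->
  forall t, tmap T f g t = tmap T f' g' t.
Proof.
move=> hf hg; apply: tens_ext; try exact: hlin.
move=> w1 h k w2; rewrite !tmapE; apply: eq_bigr => b _.
by rewrite hf /hcomp !hg.
Qed.

Lemma tmapC (W1 W2 X1 X2 Z1 Z2 : obj) (f' : ghom X1 Z1) (g' : ghom X2 Z2)
    (f : ghom W1 X1) (g : ghom W2 X2) t : heven g' -> heven g ->
  tmap T f' g' (tmap T f g t) = tmap T (hcompose f' f) (hcompose g' g) t.
Proof.
move=> ge' ge; move: t; apply: tens_ext; try exact: hlin.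
  exact: lin_comp (hlin _) (hlin _).
by move=> w1 h k w2; rewrite !tmapE0 //; apply: heven_comp.
Qed.

Lemma tmap_even (W1 W2 X1 X2 : obj) (f : ghom W1 X1) (g : ghom W2 X2) :
  heven f -> heven g -> heven (tmap T f g).
Proof.
move=> fe ge; apply/hevenP; apply: tens_ext.
- exact: lin_comp (hlin _) (@par_lin _ _).
- exact: lin_comp (@par_lin _ _) (hlin _).
move=> w1 h k w2; rewrite tYp !tmapE0 // tYp.
by move/hevenP: fe => ->; move/hevenP: ge => ->.
Qed.

Lemma hcompD (W X : gmod V) (g : W -> X) w : hcomp true g w + hcomp false g w = g w.
Proof.
by rewrite /hcomp expr1 expr0 scaleN1r scale1r -scalerDr addrACA addNr addr0 half2.
Qed.

Lemma hcompB (W X : gmod V) (g : W -> X) w :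
  hcomp false g w - hcomp true g w = par (g (par w)).
Proof.
rewrite /hcomp expr1 expr0 scaleN1r scale1r -scalerBr opprD opprK addrACA subrr add0r.
exact: half2.
Qed.

(** The sign in [tmapE] is that of [supercomm], so conjugation removes it. *)
Lemma tmap_strict (W X Y : obj) (g : ghom X Y) (w : W) h k x :
  conjJ 'i (tmap T (hid W) g) (tY T w h k x) = tY T w h k (conjJ 'i g x).
Proof.
have h0 := @supercomm_strict R W X (W ** X) Y (W ** Y) (fun w x => tY T w h k x)
  (fun w y => tY T w h k y) (fun w => tYr w h k) (fun w => tYr w h k)
  (fun x => tYl h k x) (fun y => tYl h k y) (fun w x => tYp w h k x) (fun w x => tYp w h k x)
  g (tmap T (hid W) g) (hlin _) (hlin _) 'i sqri.
apply: h0 => b w' x' hw'; rewrite tmapE big_bool /=.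
move/homogP: hw' => ->; case: b; last by rewrite -(lmD (tYr _ _ _)) hcompD.
by rewrite (lmN (tYl _ _ _)) addrC -(lmB (tYr _ _ _)) hcompB.
Qed.

Lemma tl_surj (W : obj) w : exists t, tl T W t = w.
Proof. by have [g h1 h2] := tl_bij T W; exists (g w). Qed.

(** Kelly's argument: tensoring with the unit on the left is faithful, and after it both sides agree
    by the pentagon and the triangle. *)
Lemma tl_tens (X Y : obj) t :
  tl T (X ** Y) t = tmap T (tl T X) (hid Y) (ta T (tone T) X Y t).
Proof.
have hi := heven_id; have le := @tl_even _ _ T; have re := @tr_even _ _ T; have ae := @ta_even _ _ T.
pose K := hcompose (tmap T (tl T X) (hid Y)) (ta T (tone T) X Y).
have Ke : heven K by apply: heven_comp => //; apply: tmap_even.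
suff key s : tmap T (hid (tone T)) (tl T (X ** Y)) s = tmap T (hid (tone T)) K s.
  have [s <-] := tl_surj t.
  by rewrite -(tl_nat (tl T (X ** Y))) key (tl_nat K).
apply: (can_inj (@taK _ _ T (tone T) X Y)).
rewrite -triangle.
have -> u : tmap T (tr T (tone T)) (hid (X ** Y)) u =
   tmap T (tr T (tone T)) (tmap T (hid X) (hid Y)) u.
  by apply: tmap_eq => // x; rewrite tmap_id.
rewrite ta_nat -pentagon tmapC //.
have -> u : tmap T (hcompose (tmap T (tr T (tone T)) (hid X)) (ta T (tone T) (tone T) X))
    (hcompose (hid Y) (hid Y)) u = tmap T (tmap T (hid (tone T)) (tl T X)) (hid Y) u.
  by apply: tmap_eq => // x /=; rewrite triangle.
rewrite -ta_nat tmapC //; last by apply: tmap_even.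
by congr (ta T _ _ _ _); apply: tmap_eq.
Qed.

(** Both sides are the same skew-symmetry series, in Y and in tY respectively, and [tl] carries tY
    on the unit to Y. *)
Lemma tr_tR (W : obj) t : tr T W t = tl T W (tR T W (tone T) t).
Proof.
have [ui ui1 ui2] := tu_bij T.
move: t; apply: tens_ext_homog; try exact: hlin.
  exact: lin_comp (hlin _) (hlin _).
move=> b b2 w1 h k w2 hw1 _; rewrite -[w2]ui2; move: (ui w2) => v {w2}.
rewrite (trE T h k v hw1) (tRE T h k (tu T v) hw1).
have -> : parb b (tu T v) = tu T (parb b v) by case: (b) => //=; rewrite tu_par.
have [M /(_ M (leqnn _)) [K0 /(_ K0 (leqnn _)) hbox]] :=
  it_box (tu T (parb b v)) w1 h k (tY_intw T (tone T) W).
rewrite (skewE hbox) (@skewE _ _ _ _ _ _ _ _ _ _ M K0); last first.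
  by move=> p /hbox e; rewrite -(@tlE _ _ T) e (lm0 (hlin _)).
rewrite (lm_sum (hlin _)); apply: eq_bigr => i _.
rewrite (lm_sum (hlin _)); apply: eq_bigr => j _.
by rewrite (lmZ (hlin _)) strict_Lm1 tlE.
Qed.

(* The monodromy acts on a logarithm-free intertwining operator by the change
   of x^(-h-1) along a loop around 0. *)
Lemma monodromy (W1 W2 : obj) b1 b2 (w1 : W1) (w2 : W2) h : homog b1 w1 -> homog b2 w2 ->
  (forall g k, (0 < k)%N -> tY T w1 g k w2 = 0) ->
  tR T W2 W1 (tR T W1 W2 (tY T w1 h 0 w2)) = cexp (- ip * (2 * (h + 1))) *: tY T w1 h 0 w2.
Proof.
move=> hw1 hw2 nolog.
have hI12 := tY_intw T W1 W2; have hI21 := tY_intw T W2 W1.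
have [m0 hm0] := it_trunc hI12 w1 w2 h.
rewrite (tRE T h 0%N w2 hw1) (parb_homog b1 hw2).
have inner g k : tR T W2 W1 (tY T w2 g k w1) = (-1) ^+ (b1 && b2) *: skew (@tY R V T W1 W2) w2 g k w1.
  rewrite (tRE T g k w1 hw2) (parb_homog b2 hw1).
  have [M /(_ M (leqnn _)) [K0 /(_ K0 (leqnn _)) hbox]] := it_box w1 w2 g k hI12.
  rewrite (@skewE _ _ _ _ _ _ w2 g k w1 M K0) //.
  rewrite (@skewE _ _ _ _ _ _ _ _ _ _ M K0); last first.
    by move=> p /hbox e; rewrite (lmZ (tYl _ _ _)) e scaler0.
  rewrite scaler_sumr; apply: eq_bigr => i _; rewrite scaler_sumr; apply: eq_bigr => j _.
  rewrite (lmZ (tYl _ _ _)) (lmZ (lin_iter _ (gYr _ _))) !scalerA mulrC.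
  by [].
have inner0 g k : (0 < k)%N -> tR T W2 W1 (tY T w2 g k w1) = 0.
  move=> k0; rewrite inner (@skewE _ _ _ _ _ _ _ _ _ _ 0 0) ?big_ord0 ?scaler0 // => p _.
  by apply: nolog; apply: leq_trans k0 (leq_addr _ _).
have [M hM] := it_box w2 w1 h 0 hI21.
pose N := maxn M m0; have [K0 /(_ K0.+1 (leqnSn _)) hbox] := hM N (leq_maxl _ _).
rewrite (@skewE _ _ _ _ _ _ _ _ _ _ N K0.+1); last first.
  by move=> p /hbox e; rewrite (lmZ (tYl _ _ _)) e scaler0.
pose X m := iter m (@Lm1 _ _ (W1 ** W2)) (tY T w1 (h + m%:R) 0 w2).
have X0 m : (N <= m)%N -> X m = 0.
  move=> le; rewrite /X hm0 ?(lm0 (lin_iter _ (gYr _ _))) //.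
  by apply: leq_trans le; apply: leq_maxr.
(* The coefficient of L_{-1}^m to which the first braiding contributes the power p and the second m
   - p. *)
pose al p m : C := cexp (- ip * (h + p%:R + 1)) * cexp (- ip * (h + m%:R + 1)) /
  ((p`!)%:R * ((m - p)`!)%:R).
have step (p : nat) : tR T W2 W1 (\sum_(j < K0.+1) skew_coef h 0 (p, nat_of_ord j) *:
    iter p (@Lm1 _ _ (W2 ** W1)) (tY T ((-1) ^+ (b2 && b1) *: w2) (h + p%:R) (0 + j)%N w1)) =
    \sum_(m < N | (p <= m)%N) al p m *: X m.
  rewrite (lm_sum (hlin _)) big_ord_recl big1 ?addr0; last first.
    move=> i _; rewrite (lmZ (hlin _)) strict_Lm1 (lmZ (tYl _ _ _)) (lmZ (hlin _)).
    have li : (0 < 0 + lift ord0 i)%N by rewrite add0n lift0.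
    by rewrite (inner0 _ _ li) scaler0 (lm0 (lin_iter _ (gYr _ _))) scaler0.
  rewrite (lmZ (hlin _)) strict_Lm1 (lmZ (tYl _ _ _)) (lmZ (hlin _)) inner scalerA.
  rewrite [b2 && b1]andbC -expr2 sqrr_sign scale1r.
  rewrite (@skewE _ _ _ _ _ _ _ _ _ _ N 1); last first.
    move=> [q k] /=; rewrite negb_and -!leqNgt => /orP[Nq|k0]; last first.
      by apply: nolog; rewrite addn_gt0 k0 orbT.
    rewrite -addrA -natrD; apply: hm0; apply: leq_trans (leq_addl _ _).
    by apply: leq_trans Nq; apply: leq_maxr.
  rewrite (lm_sum (lin_iter _ (gYr _ _))) scaler_sumr.
  rewrite -(@shift_sum _ N p (fun m => al p m *: X m)); last first.
    by move=> m /X0 ->; rewrite scaler0.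
  apply: eq_bigr => q _; rewrite big_ord1 (lmZ (lin_iter _ (gYr _ _))) scalerA -iterD.
  rewrite /X natrD addrA; congr (_ *: _).
  rewrite /skew_coef /al /= !addn0 !bin0 !expr0 !mulr1 addnC addnK natrD addrA.
  rewrite [_ / _ * (_ / _)]mulrACA invfM; congr (_ * cexp (- ip * _) * _).
  by ring.
rewrite (lm_sum (hlin _)); under eq_bigr do rewrite step.
rewrite (exchange_big_dep xpredT) //=.
(* The phase of the first braiding contributes (-1)^p, so the sum over p alternates and vanishes
   unless m = 0. *)
rewrite (eq_bigr (fun m : 'I_N => (cexp (- ip * (2 * (h + 1) + m%:R)) * ((m : nat) == 0%N)%:R) *: X m)).
  have [N0|N0] := posnP N.
    have e : tY T w1 h 0 w2 = 0 by have := X0 0%N; rewrite N0 /X addr0; apply.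
    by rewrite e scaler0; case: (N) N0 => // _; rewrite big_ord0.
  rewrite (bigD1 (Ordinal N0)) //= big1 ?addr0.
    by rewrite /X /= !addr0 mulr1.
  by move=> i; rewrite -val_eqE /= => /negPf ->; rewrite mulr0 scale0r.
move=> m _; rewrite -scaler_suml; congr (_ *: _).
rewrite -alt_fact_sum mulr_sumr.
rewrite (big_ord_widen _ (fun p => cexp (- ip * (2 * (h + 1) + m%:R)) *
   ((-1) ^+ p / ((p`!)%:R * ((m - p)`!)%:R))) (ltn_ord m)).
apply: eq_big => [p|p _]; first by rewrite ltnS.
rewrite /al [RHS]mulrA; congr (_ / _); rewrite -cexp_nat -!cexpD; congr cexp; ring.
Qed.

End Tensor.

(** * Induced modules *)

Section Rep.
Context {R : realType} {V : V1gl11 R} {T : HLZ V} {A : sl21_ext V} (M : alg_struct T A).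
Local Notation C := R[i].
Local Notation obj := (indO V).
Local Notation "W ** X" := (tens T W X) (at level 40).

Lemma int_modes_int (P Q : Type) (D : lmodType C) (Y : P -> int -> Q -> D) a (m : int) b :
  int_modes Y a m%:~R 0 b = Y a m b.
Proof.
rewrite /int_modes; case: pselect => [e|[]]; last by exists m.
by case: (cid e) => m' /= /eqP; rewrite eqr_int => /eqP ->.
Qed.

Lemma par_avac : par (avac A) = avac A.
Proof. by rewrite -aj_vac -aj_par par_vac. Qed.

Lemma avac_act v (i : nat) : gY v i (avac A) = 0.
Proof. by rewrite aj_act (vsa_create0 (aP A)). Qed.

Lemma unitA_even : heven (unitA M).
Proof.
apply/hevenP => w; have [ui _ ui2] := tu_bij T.
by rewrite -[w]ui2 -tu_par !unitAE aj_par.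
Qed.

Let mu_evenM := mu_even M.
Let ue := unitA_even.
Let ie (W : gmod V) := @heven_id _ _ W.
Let ae W1 W2 W3 := @ta_even _ _ T W1 W2 W3.

Definition rmuF (W : obj) : ghom (A ** (A ** W)) (A ** W) :=
  hcompose (tmap T (mu M) (hid W)) (ta T A A W).
Definition repF (W : obj) : repobj T A := @RepObj R V T A (A ** W) (rmuF W).

Lemma hcomp_post (W X Z : gmod V) (g : ghom X Z) (f : W -> X) b w : heven g ->
  hcomp b (fun w => g (f w)) w = g (hcomp b f w).
Proof.
by move=> /hevenP ge; rewrite /hcomp (lmZ (hlin g)) (lmD (hlin g)) (lmZ (hlin g)) ge.
Qed.

Lemma tmap_post (W1 W2 X2 Z2 : obj) (g' : ghom X2 Z2) (g : ghom W2 X2) t : heven g' ->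
  tmap T (hid W1) g' (tmap T (hid W1) g t) = tmap T (hid W1) (hcompose g' g) t.
Proof.
move=> ge; move: t; apply: tens_ext; try exact: hlin.
  by apply: lin_comp; exact: hlin.
move=> w1 h k w2; rewrite !tmapE (lm_sum (hlin _)); apply: eq_bigr => b _.
rewrite tmapE0 //; congr (tY T _ h k _); apply/esym; exact: hcomp_post.
Qed.

Lemma tmapC1 (W1 W2 X1 Z1 : obj) (f' : ghom X1 Z1) (f : ghom W1 X1) t :
  tmap T f' (hid W2) (tmap T f (hid W2) t) = tmap T (hcompose f' f) (hid W2) t.
Proof. by rewrite tmapC //; apply: tmap_eq. Qed.

Lemma ta_nat1 (W1 W2 W3 X1 : obj) (f : ghom W1 X1) t :
  ta T X1 W2 W3 (tmap T f (hid (W2 ** W3)) t) =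
  tmap T (tmap T f (hid W2)) (hid W3) (ta T W1 W2 W3 t).
Proof.
rewrite -ta_nat; congr (ta T _ _ _ _).
by apply: tmap_eq => // x; rewrite tmap_id.
Qed.

Lemma ta_nat3 (W1 W2 W3 X3 : obj) (f : ghom W3 X3) t :
  ta T W1 W2 X3 (tmap T (hid W1) (tmap T (hid W2) f) t) =
  tmap T (hid (W1 ** W2)) f (ta T W1 W2 W3 t).
Proof. by rewrite ta_nat; apply: tmap_eq => // x; rewrite tmap_id. Qed.

Lemma rmuF_even W : heven (rmuF W).
Proof. by apply: heven_comp => //; apply: tmap_even. Qed.

Lemma repF_rep (W : obj) : is_rep M (repF W).
Proof.
split; first exact: rmuF_even.
- move=> t /=; rewrite ta_nat1 -pentagon !tmapC1.
  have -> u : tmap T (hid A) (rmuF W) u = tmap T (hid A) (tmap T (mu M) (hid W))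
      (tmap T (hid A) (ta T A A W) u) by rewrite tmap_post //; apply: tmap_even.
  rewrite ta_nat tmapC1; apply: tmap_eq => // x /=; exact: mu_assoc.
- move=> t /=; rewrite ta_nat1 tmapC1 tl_tens.
  by apply: tmap_eq => // x /=; apply: mu_unit.
Qed.

Lemma mu_unit_r t : mu M (tmap T (hid A) (unitA M) t) = tr T A t.
Proof.
rewrite -mu_comm (@tR_nat _ _ T _ _ _ _ _ _ false false _ (@ie _) ue).
by rewrite expr0 scale1r mu_unit tr_tR.
Qed.

Lemma rmuF_unit (W : obj) t :
  rmuF W (tmap T (hid A) (tmap T (unitA M) (hid W)) t) = tmap T (hid A) (tl T W) t.
Proof.
rewrite /= ta_nat tmapC1 -triangle.
by apply: tmap_eq => // x /=; apply: mu_unit_r.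
Qed.

(** The map from w to 1 (x) w: the index -1 selects the coefficient of x^0 in tY(1, x) w. *)
Definition eta (W : obj) (w : W) : A ** W := tY T (avac A) (-1) 0 w.

Lemma etaE (W : obj) (w : W) : eta w = tmap T (unitA M) (hid W) (tY T (tu T (vac V)) (-1) 0 w).
Proof. by rewrite tmapE0 // unitAE aj_vac. Qed.

Lemma tl_vac (W : obj) (w : W) : tl T W (tY T (tu T (vac V)) (-1) 0 w) = w.
Proof.
rewrite tlE (_ : -1 = (-1 : int)%:~R :> C); last by rewrite rmorphN1.
by rewrite int_modes_int (vm_vac (gax W)).
Qed.

Lemma act_eta (W : obj) a h k (w : W) : rmuF W (tY T a h k (eta w)) = tY T a h k w.
Proof.
have e u : tY T a h k (tmap T (unitA M) (hid W) u) =
    tmap T (hid A) (tmap T (unitA M) (hid W)) (tY T a h k u).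
  by rewrite tmapE0 //; apply: tmap_even.
rewrite etaE e.
rewrite rmuF_unit tmapE0 //; last exact: tl_even.
by rewrite tl_vac.
Qed.

Lemma eta_strict (W : obj) : strict (@eta W).
Proof.
apply: strict_gi => [|a n w]; first exact: tYr.
have [K0 /(_ K0 (leqnn _))] := it_comm (tY_intw T A W) (avac A) (-1) 0 w n (@gi_par _ V a).
rewrite big1; last by move=> i _; rewrite avac_act (lm0 (tYl _ _ _ _)) scaler0.
have -> : parb (godd a) (avac A) = avac A by case: (godd a) => //=; rewrite par_avac.
by move/eqP; rewrite subr_eq0 => /eqP e; rewrite /eta /gact e.
Qed.

Lemma monodromy_nat (W1 W2 X2 : obj) (g : ghom W2 X2) t : heven g ->
  tR T X2 W1 (tR T W1 X2 (tmap T (hid W1) g t)) =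
  tmap T (hid W1) g (tR T W2 W1 (tR T W1 W2 t)).
Proof.
move=> ge; rewrite (@tR_nat _ _ T _ _ _ _ _ _ false false _ (@ie _) ge) expr0 scale1r.
by rewrite (@tR_nat _ _ T _ _ _ _ _ _ false false _ ge (@ie _)) expr0 scale1r.
Qed.

(** By the hexagons the monodromy of A with A (x) W consists of that with W, trivial by hypothesis,
    and that with A, absorbed by the commutative product. *)
Lemma repF_local (W : obj) : (forall t, tR T W A (tR T A W t) = t) -> is_local (repF W).
Proof.
move=> h t /=; rewrite hexagon1 hexagon2 taK taVK tmap_post; last exact: tR_even.
have -> u : tmap T (hid A) (hcompose (tR T W A) (tR T A W)) u = u.
  by rewrite -[RHS]tmap_id; apply: tmap_eq.
rewrite taVK !tmapC1.
by apply: tmap_eq => // x /=; rewrite !mu_comm.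
Qed.

(** On A (x) (1 (x) W) the action reduces to the identity of A (x) W by [rmuF_unit], so locality
    there concerns the monodromy with W alone. *)
Lemma local_monodromy (W : obj) : is_local (repF W) -> forall t, tR T W A (tR T A W t) = t.
Proof.
move=> hl t.
have su u : exists s, tmap T (hid A) (tl T W) s = u.
  pose U := [set u | exists s, tmap T (hid A) (tl T W) s = u].
  suff: U u by []; apply: (span_min (G := @tcoef _ _ T A W) (U := U)); last exact: tens_span.
    split; first by exists 0; rewrite (lm0 (hlin _)).
    by move=> c _ _ [s <-] [s' <-]; exists (c *: s + s'); rewrite hlin.
  move=> _ [a [h [k [w ->]]]]; exists (tY T a h k (tY T (tu T (vac V)) (-1) 0 w)).
  by rewrite tmapE0 ?tl_vac //; apply: tl_even.
have [s <-] := su t.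
rewrite monodromy_nat; last exact: tl_even.
rewrite -!rmuF_unit -monodromy_nat; last exact: tmap_even.
exact: hl.
Qed.

Definition astrict (X Z : repobj T A) (f : rX X -> rX Z) : Prop :=
  lin_map f /\ forall a h k x, f (rmu X (tY T a h k x)) = rmu Z (tY T a h k (f x)).

Lemma rmu_gY (X : repobj T A) v n (x : rX X) : is_rep M X ->
  gY v n x = rmu X (tY T (aj A v) n%:~R 0 x).
Proof.
move=> hX; have := rep_unit hX (tY T (tu T v) n%:~R 0 x).
by rewrite tlE int_modes_int tmapE0 // unitAE => <-.
Qed.

Lemma astrict_strict (X Z : repobj T A) (f : rX X -> rX Z) : is_rep M X -> is_rep M Z ->
  astrict f -> strict f.
Proof. by move=> hX hZ [fL fs]; split=> // v n w; rewrite !rmu_gY. Qed.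

Lemma rmu_conj (X Z : repobj T A) (F : ghom (rX X) (rX Z)) a h k x :
  is_rep M X -> is_rep M Z ->
  conjJ 'i (fun t => rmu Z (tmap T (hid A) F t)) (tY T a h k x) =
  rmu Z (tY T a h k (conjJ 'i F x)).
Proof.
move=> hX hZ; rewrite (conjJ_comp (rmu Z) (tmap T (hid A) F)) tmap_strict.
by rewrite conjJ_ghom //; [exact: sqri|exact: (rep_even hZ)].
Qed.

Lemma rmu_conj' (X Z : repobj T A) (F : ghom (rX X) (rX Z)) t : is_rep M X ->
  conjJ 'i (fun t => F (rmu X t)) t = conjJ 'i F (rmu X t).
Proof.
move=> hX; rewrite (conjJ_comp F (rmu X)) (conjJ_ghom (f := rmu X)) //; [exact: sqri|exact: (rep_even hX)].
Qed.

Lemma rep_mor_astrict (X Z : repobj T A) (f : rX X -> rX Z) : is_rep M X -> is_rep M Z ->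
  rep_mor f -> astrict (conjJ 'i f).
Proof.
move=> hX hZ [F [<- hF]]; split; first exact/conjJ_lin/hlin.
by move=> a h k x; rewrite -rmu_conj' // -rmu_conj //; apply: conjJ_eq.
Qed.

Lemma astrict_rep_mor (X Z : repobj T A) (g : rX X -> rX Z) : is_rep M X -> is_rep M Z ->
  astrict g -> rep_mor (conjJ (- 'i) g).
Proof.
move=> hX hZ gA; have [F eF] := strict_ghom (astrict_strict hX hZ gA).
exists F; split=> // t.
have Fg x : conjJ 'i F x = g x by rewrite eF conjJVK.
rewrite -[LHS](conjJK (fun t => F (rmu X t))) -[RHS](conjJK (fun t => rmu Z (tmap T (hid A) F t))).
apply: conjJ_eq; apply: tens_ext.
- by apply: conjJ_lin; apply: lin_comp; exact: hlin.
- by apply: conjJ_lin; apply: lin_comp; exact: hlin.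
by move=> a h k x; rewrite rmu_conj // rmu_conj' // !Fg (gA.2).
Qed.

Lemma tmap_swap (W1 X1 W2 X2 : obj) (f : ghom W1 X1) (g : ghom W2 X2) t : heven f ->
  tmap T (hid X1) g (tmap T f (hid W2) t) = tmap T f (hid X2) (tmap T (hid W1) g t).
Proof.
move=> fe; move: t; apply: tens_ext.
- by apply: lin_comp; exact: hlin.
- by apply: lin_comp; exact: hlin.
move=> w1 h k w2; rewrite tmapE0 // !tmapE (lm_sum (hlin _)); apply: eq_bigr => b _.
rewrite tmapE0 //=; congr (tY T _ h k _).
by case: b => //=; move/hevenP: fe => ->.
Qed.

(** The extension is the action of A after id (x) f, with f first conjugated into a supermorphism,
    on which the tensor product is functorial. *)
Lemma frobenius (W : obj) (X : repobj T A) (f : W -> rX X) : is_rep M X -> strict f ->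
  exists F : rX (repF W) -> rX X, astrict F /\
    forall a h k w, F (tY T a h k w) = rmu X (tY T a h k (f w)).
Proof.
move=> hX fs; have [G eG] := strict_ghom fs.
have Gf x : conjJ 'i G x = f x by rewrite eG conjJVK.
pose F0 : ghom (rX (repF W)) (rX X) := hcompose (rmu X) (tmap T (hid A) G).
exists (conjJ 'i F0); split; last first.
  move=> a h k w; rewrite /= (conjJ_comp (rmu X) (tmap T (hid A) G)) tmap_strict Gf.
  by rewrite conjJ_ghom //; [exact: sqri|exact: (rep_even hX)].
apply: rep_mor_astrict => //; first exact: repF_rep.
exists F0; split=> // t /=.
rewrite tmap_swap // -ta_nat3 (rep_assoc hX) tmap_post //; exact: (rep_even hX).
Qed.

End Rep.

(** * The summands of the extension *)

Section Chain.
Context {R : realType} {V : V1gl11 R} (W : gmod V).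
Local Notation C := R[i].
Local Notation xg s := (if s then gP else gM).
Local Notation yg s := (if s then gM else gP).

(** One mode short of [vaclike]: x_{-j} may still act nontrivially. *)
Record prevac (s : bool) (j : nat) (n e : C) (a : W) : Prop := Prevac {
  pv_N : forall r : int, 0 < r -> gact gN r a = 0;
  pv_E : forall r : int, 0 < r -> gact gE r a = 0;
  pv_N0 : gact gN 0 a = n *: a;
  pv_E0 : gact gE 0 a = e *: a;
  pv_x : forall r : int, - j%:Z < r -> gact (xg s) r a = 0;
  pv_y : forall r : int, j%:Z <= r -> gact (yg s) r a = 0 }.

Lemma anti_yx s (r t : int) (w : W) : gact (yg s) r (gact (xg s) t w) =
  gact gE (r + t) w + (if r + t == 0 then (r%:~R * (-1) ^+ s) *: w else 0)
  - gact (xg s) t (gact (yg s) r w).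
Proof. by have := aff_anti (gax W) (~~ s) r t w; rewrite negbK; case: s. Qed.

Lemma sq_x s (r : int) (w : W) : gact (xg s) r (gact (xg s) r w) = 0.
Proof. exact: (aff_sq (gax W)). Qed.

Lemma comm_xx s (r t : int) (w : W) :
  gact (xg s) r (gact (xg s) t w) = - gact (xg s) t (gact (xg s) r w).
Proof.
have := aff_rel (vm_aff (gax W)) (xg s) (xg s) r t w.
rewrite /gact; case: s => /=; rewrite expr1 scaleN1r opprK scale0r mulr0 scale0r add0r;
  by case: ifP => _ /eqP; rewrite addr_eq0 => /eqP.
Qed.

Lemma pre_step s j n e a (k := j%:Z) : prevac s j n e a ->
  [/\ forall r : int, 0 < r -> gact gN r (gact (xg s) (- k) a) = 0,
      forall r : int, 0 < r -> gact gE r (gact (xg s) (- k) a) = 0,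
      gact gN 0 (gact (xg s) (- k) a) = (n + (-1) ^+ (~~ s)) *: gact (xg s) (- k) a,
      gact gE 0 (gact (xg s) (- k) a) = e *: gact (xg s) (- k) a &
      (forall r : int, - k <= r -> gact (xg s) r (gact (xg s) (- k) a) = 0) /\
      (forall r : int, k <= r -> gact (yg s) r (gact (xg s) (- k) a) =
          if r == k then (e + j%:R * (-1) ^+ s) *: a else 0)].
Proof.
move=> h; have hx r : - k < r -> gact (xg s) r a = 0 := @pv_x _ _ _ _ _ h r.
have hL b r : lin_map (@gact _ V W b r) := @gactr _ _ W b r.
split.
- move=> r r0; rewrite /gact (@aff_cartan _ _ _ _ (gax W) gN (xg s) r _ a isT).
  rewrite -/(gact gN r a) (pv_N h) // (lm0 (gYr _ _)) add0r -/(gact (@gbr R gN (xg s)).2 _ a).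
  have -> : (@gbr R gN (xg s)).2 = xg s by case: (s).
  rewrite hx; last by lia.
  have -> : @gform R gN (xg s) = 0 by case: (s).
  by rewrite mulr0 scale0r scaler0 add0r; case: ifP.
- move=> r r0; rewrite /gact (@aff_cartan _ _ _ _ (gax W) gE (xg s) r _ a isT).
  rewrite -/(gact gE r a) (pv_E h) // (lm0 (gYr _ _)) add0r.
  have -> : (@gbr R gE (xg s)).1 = 0 by case: (s).
  have -> : @gform R gE (xg s) = 0 by case: (s).
  by rewrite mulr0 !scale0r add0r; case: ifP.
- by rewrite (gactN0 _ _ (pv_N0 h)); case: (s); rewrite ?expr0 ?expr1.
- exact: (vs_act (vstable_eigE W e) _ _ (pv_E0 h)).
split=> r; rewrite le_eqVlt => /orP[/eqP <-|kr].
- exact: sq_x.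
- by rewrite comm_xx hx // (lm0 (hL _ _)) oppr0.
- rewrite eqxx anti_yx subrr eqxx (pv_E0 h) (pv_y h) // (lm0 (hL _ _)) subr0.
  by rewrite -scalerDl -pmulrn.
- rewrite gt_eqF // anti_yx (pv_E h) ?subr_gt0 // (pv_y h) ?ltW // (lm0 (hL _ _)) subr0.
  by rewrite subr_eq0 gt_eqF // addr0.
Qed.

(* Applying x_{-j}, x_{-j-1}, and so on to a highest-weight vector; the step from j
   to j + 1 is invertible by y_j as long as j <> J. *)
Lemma chain s (J j : nat) (n e : C) (a : W) : e = (-1) ^+ (~~ s) * J%:R -> (j <= J)%N ->
  prevac s j n e a -> a <> 0 ->
  exists a', a' <> 0 /\ exists n', vaclike (@gY _ V W) s J n' e a' /\
    (n' = n + (-1) ^+ (~~ s) * (J - j)%:R \/ n' = n + (-1) ^+ (~~ s) * (J - j).+1%:R).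
Proof.
move=> he jJ; move: {2}(J - j)%N (erefl (J - j)%N) => d hd.
elim: d j jJ hd n a => [|d IH] j jJ hd n a h a0; have [h1 h2 h3 h4 [h5 h6]] := pre_step h.
  have ej : j = J by lia.
  (* At j = J either a is killed by x_{-J} or x_{-J} a is the vector sought; this causes the two
     possible N_0-weights. *)
  have [xa|xa] := pselect (gact (xg s) (- j%:Z) a = 0).
    exists a; split=> //; exists n; split; last by left; rewrite hd mulr0 addr0.
    rewrite -ej; split; [exact: (pv_N h)|exact: (pv_E h)|exact: (pv_N0 h)|exact: (pv_E0 h)| |exact: (pv_y h)].
    by move=> r; rewrite le_eqVlt => /orP[/eqP <- //|]; exact: (pv_x h).
  exists (gact (xg s) (- j%:Z) a); split=> //; exists (n + (-1) ^+ (~~ s)).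
  split; last by right; rewrite hd mulr1.
  rewrite -ej; split=> // r jr; rewrite -[LHS]/(gact _ _ (gact _ _ _)) h6 //; case: ifP => // _.
  rewrite he -ej; case: (s) => /=; rewrite ?expr0 ?expr1 ?mulN1r ?mulrN1 ?mul1r ?mulr1 ?subrr ?addNr scale0r //.
have xa : gact (xg s) (- j%:Z) a <> 0.
  (* Indeed y_j x_{-j} a = (e + (-1)^s j) a, a nonzero multiple of a since |e| = J > j. *)
  move=> xa; have := h6 _ (lexx _); rewrite eqxx xa (lm0 (gactr _ _)) => /esym/eqP.
  rewrite scaler_eq0 => /orP[|/eqP //]; rewrite he.
  have jlt : (j < J)%N by lia.
  have -> : (-1) ^+ (~~ s) * J%:R + j%:R * (-1) ^+ s = (-1) ^+ (~~ s) * (J - j)%:R :> C.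
    by rewrite natrB; [case: (s) => /=; rewrite ?expr0 ?expr1; ring|exact: ltnW].
  by rewrite mulf_eq0 signr_eq0 pnatr_eq0 subn_eq0 leqNgt jlt.
have h' : prevac s j.+1 (n + (-1) ^+ (~~ s)) e (gact (xg s) (- j%:Z) a).
  split=> // r jr; first by apply: h5; lia.
  by rewrite h6; [rewrite gt_eqF //; lia|lia].
have [||a' [a'0 [n' [v' hn']]]] := IH j.+1 _ _ _ _ h' xa; try lia.
exists a'; split=> //; exists n'; split=> //.
have -> : (J - j = (J - j.+1).+1)%N by lia.
by case: hn' => ->; [left|right]; rewrite -addrA; congr (_ + _); rewrite -[in RHS]natr1 mulrDr mulr1 addrC.
Qed.

End Chain.

Section EProjection.
Context {R : realType} {V : V1gl11 R}.
Local Notation C := R[i].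
Implicit Types W X : gmod V.

Definition epr W (e : C) : W -> W :=
  fcalc (@gact _ V W gE 0) (fun l => (l == e)%:R).

Lemma epr_id W e (w : W) : gact gE 0 w = e *: w -> epr e w = w.
Proof. by move=> h; rewrite /epr (fcalc_eig (@gactr _ _ W gE 0) _ h) eqxx scale1r. Qed.

Lemma epr_eig W e (w : W) : diagz (@gact _ V W gE 0) -> gact gE 0 (epr e w) = e *: epr e w.
Proof.
move=> d; have [s hs] := d w; rewrite /epr (fcalcE (@gactr _ _ W gE 0) _ hs).
apply: (ss_sum (vs_sp (vstable_eigE W e))) => p ps _ /=.
have hp := hs.2 p ps; case: eqP => [<-|_]; first by rewrite scale1r.
by rewrite scale0r; exact: (ss0 (vs_sp (vstable_eigE W e))).
Qed.

Lemma epr_nat W X e (f : W -> X) : diagz (@gact _ V W gE 0) -> diagz (@gact _ V X gE 0) ->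
  strict f -> forall w, epr e (f w) = f (epr e w).
Proof.
move=> dW dX [fL fs]; apply: (fcalc_comm (c := 0)) => //; try exact: gactr.
- by move=> l w h; rewrite /gact -fs -/(gact gE 0 w) h addr0 (lmZ fL).
by move=> l; rewrite addr0.
Qed.

Lemma epr_strict W e : diagz (@gact _ V W gE 0) -> strict (@epr W e).
Proof.
move=> d; split; first by apply: fcalc_lin => //; exact: gactr.
move=> v n; apply: (fcalc_comm (c := 0)) => //; try exact: gactr.
- exact: (vm_linr (gax W)).
- by move=> l w h; rewrite addr0; apply: (vs_act (vstable_eigE W l)).
by move=> l; rewrite addr0.
Qed.

Lemma epr_par W e (w : W) : diagz (@gact _ V W gE 0) -> epr e (par w) = par (epr e w).
Proof.
move=> d; move: w; apply: (fcalc_comm (c := 0)) => //; try exact: gactr.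
- exact: par_lin.
- move=> l w h; have := vm_par (gax W) (gi V gE) 0 w.
  by rewrite par_gi scale1r addr0 -/(gact gE 0 w) h parZ => ->.
by move=> l; rewrite addr0.
Qed.

End EProjection.

(** * The summands of A and their E_0-weights *)

Section ExtStructure.
Context {R : realType} {V : V1gl11 R} (A : sl21_ext V).
Local Notation C := R[i].

Let dN : ndiag A := in_ind_ndiag (@iP _ _ A).
Let dE : diagz (@gact _ V A gE 0) := in_ind_ediag (@iP _ _ A).

Lemma simple_nonzero (W : gmod V) : simple_mod W -> exists w : W, w <> 0.
Proof. by case. Qed.

Lemma surj_gen n l (Mo B : gmod V) (p : ghom Mo B) (v : Mo) : simple_mod B -> surj p ->
  induced (rel_V n l) (@gact _ V Mo) v ->
  exists w : B, w <> 0 /\ rel_V n l (@gact _ V B) w.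
Proof.
move=> sB pS hv; have [pL ps] := sfun_strict p; have pS' := surj_strict pS.
exists (conjJ 'i p v); split; last first.
  have [_ [r1 r2 r3 r4] _] := hv.
  have e a r : gact a r (conjJ 'i p v) = conjJ 'i p (gact a r v) by rewrite /gact ps.
  by split=> [a r r0|||]; rewrite e ?r2 ?r3 ?r4 ?(lmZ pL) ?(lm0 pL) // r1 // (lm0 pL).
move=> p0; have [w w0] := simple_nonzero sB; have [x ex] := pS' w.
apply: w0; rewrite -ex; move: x {ex}.
refine (induced_gen _ hv (U := fun x => conjJ 'i p x = 0) _ p0 _).
- by move=> S act' v' ha hv'; apply: (rel_V_sub ha hv').
- exact: (vs_sp (vstable_ker (sfun_strict p))).
by move=> a r u /= hu; rewrite /gact ps hu (lm0 (gYr _ _)).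
Qed.

Record block (m : int) : Type := Block {
  bB : gmod V;
  bi : bB -> A;
  b_ahat : is_Ahat (m%:~R - eps m) (-2 * m) bB;
  b_strict : strict bi;
  b_inj : injective bi }.

Lemma blocks : exists B : forall m, block m,
  forall x : A, exists (s : seq int) (y : forall m, bB (B m)), x = \sum_(m <- s) bi (y m).
Proof.
have [B [i [hB hs hi]]] := a_decomp A.
have iI m : injective (conjJ 'i (i m)).
  move=> a b e; have [iL _] := sfun_strict (i m).
  pose z := J (- 'i) (a - b).
  have : J (- 'i) (conjJ 'i (i m) (a - b)) = 0.
    by rewrite (lmB iL) e subrr (lm0 (@J_lin _ _ _)).
  rewrite /conjJ J_K -/z => iz.
  have := hi [:: m] (@eqtype.dfwith _ (fun m' : int => B m' : Type) (fun m' => 0) m z) isT.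
  rewrite big_seq1 eqtype.dfwith_in iz => /(_ erefl m (mem_head _ _)).
  rewrite eqtype.dfwith_in /z => /(congr1 (J 'i)); rewrite J_VK (lm0 (@J_lin _ _ _)).
  by move/eqP; rewrite subr_eq0 => /eqP.
exists (fun m => Block (hB m) (sfun_strict (i m)) (@iI m)) => x.
have [s [y ey]] := hs (J (- 'i) x); exists s, (fun m => J 'i (y m)) => /=.
rewrite -[x]J_VK ey (lm_sum (@J_lin _ _ _)); apply: eq_bigr => m _.
by rewrite /conjJ J_K.
Qed.

Lemma bi_eig (m : int) (B : block m) e (w : bB B) :
  gact gE 0 w = e *: w -> gact gE 0 (bi w) = e *: bi w.
Proof. by move=> h; rewrite /gact -(b_strict B).2 -/(gact gE 0 w) h (lmZ (b_strict B).1). Qed.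

Lemma b_ndiag m (B : block m) : ndiag (bB B).
Proof. exact: (ndiag_inj (b_strict B) (@b_inj _ B) dN). Qed.

Lemma block_nz m (B : block m) : m != 0 -> simple_mod (bB B) /\
  exists w : bB B, w <> 0 /\ rel_V (m%:~R - eps m) (-2 * m)%:~R (@gact _ V (bB B)) w.
Proof.
move=> m0; have := b_ahat B; rewrite /is_Ahat ifF; last by apply/negbTE; rewrite mulf_neq0.
move=> [sB [Mo [p [[v hv] pS]]]]; split=> //.
exact: (surj_gen sB pS hv).
Qed.

Lemma block_zero (B : block 0) : exists v : bB B, induced (rel_A 0) (@gact _ V (bB B)) v.
Proof.
have := b_ahat B; rewrite /is_Ahat mulr0 eqxx /eps ltxx eqxx subrr.
by [].
Qed.

Lemma block_E m (B : block m) (w : bB B) : gact gE 0 w = (-2 * m)%:~R *: w.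
Proof.
have vE := vstable_eigE (bB B) (-2 * m)%:~R.
have [m0|m0] := eqVneq m 0.
  subst m; have [v hv] := block_zero B; move: w.
  refine (induced_gen _ hv (U := fun w => gact gE 0 w = (-2 * 0)%:~R *: w) (vs_sp vE) _ _).
  - by move=> S act' v' ha hv'; apply: (rel_A_sub ha hv').
  - by have [_ [_ _ -> _ _] _] := hv; rewrite mulr0 scale0r.
  by move=> a n u; apply: (vs_act vE).
have [sB [v [v0 [_ _ r3 _]]]] := block_nz B m0.
by apply: (simple_strict (@b_ndiag _ B) sB vE); exists v.
Qed.

Lemma A_sum (x : A) : exists s : seq A, x = \sum_(y <- s) y /\
  forall y, y \in s -> exists m : int, gact gE 0 y = (-2 * m)%:~R *: y.
Proof.
have [B hB] := blocks; have [s [y ->]] := hB x.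
exists [seq bi (y m) | m <- s]; rewrite big_map; split=> // _ /mapP[m _ ->].
by exists m; apply: bi_eig; apply: block_E.
Qed.

(** The summands have pairwise distinct E_0-weights -2m, so projecting a decomposition of x to its
    own weight leaves the m-th term only. *)
Lemma eig_block (B : forall m, block m) m (x : A) :
  (forall x : A, exists (s : seq int) (y : forall m, bB (B m)), x = \sum_(m <- s) bi (y m)) ->
  gact gE 0 x = (-2 * m)%:~R *: x -> exists b : bB (B m), bi b = x.
Proof.
move=> hB hx; have [s [y ex]] := hB x.
have EL : lin_map (gact gE 0 : A -> A) := @gactr _ _ A gE 0.
pose phi (l : C) : C := (l == (-2 * m)%:~R)%:R.
have <- : fcalc (gact gE 0) phi x = x by rewrite (fcalc_eig EL phi hx) /phi eqxx scale1r.
rewrite ex (lm_sum (fcalc_lin EL phi dE)).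
have rS : subsp (range (@bi m (B m))).
  exact: (vs_sp (vstable_range (b_strict (B m)))).
suff [b _ eb] : range (@bi m (B m)) (\sum_(i <- s) fcalc (gact gE 0 : A -> A) phi (bi (y i))) by exists b.
apply: ss_sum => // m' _ _.
rewrite (fcalc_eig EL phi (bi_eig (block_E (y m')))) /phi.
case: eqP => [/eqP|_]; last by rewrite scale0r; apply: ss0.
rewrite eqr_int => /eqP e; have e' : m' = m by move: e; lia.
by rewrite scale1r e'; exists (y m).
Qed.

Lemma A_block (m : int) : m != 0 -> exists s (j : nat) (k : int) (a : A),
  [/\ a <> 0, vaclike (@gY _ V A) s j k%:~R (-2 * m)%:~R a,
     (-2 * m)%:~R = (-1) ^+ (~~ s) * j%:R :> C, k != 0 &
     forall U : set A, vstable U -> U a ->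
       forall x, gact gE 0 x = (-2 * m)%:~R *: x -> U x].
Proof.
move=> m0; have [B hB] := blocks; have [sB [v [v0 [r1 r2 r3 r4]]]] := block_nz (B m) m0.
(* For m < 0, e is positive and x = psi^+; the highest-weight vector is killed by psi^+_0, so the
   chain starts at j = 1. For m > 0, x = psi^- and it starts at j = 0. *)
pose s : bool := m < 0; pose J0 := absz (2 * m); pose j0 : nat := s.
have he : (-2 * m)%:~R = (-1) ^+ (~~ s) * J0%:R :> C.
  have eJ : J0%:Z = (-1) ^+ (~~ s) * (-2 * m).
    by rewrite /s /J0; case: ltP => h /=; rewrite ?expr0 ?expr1; lia.
  by rewrite -[J0%:R]/((Posz J0)%:~R) eJ [X in _ = _ * X]rmorphM rmorph_sign mulrA -expr2 sqrr_sign mul1r.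
(* The N_0-weight m - eps m + 1/2 of the highest-weight vector, integral thanks to [eps]. *)
pose k0 : int := if s then m + 1 else m.
have hk : m%:~R - eps m + 2^-1 = k0%:~R :> C.
  rewrite /eps /k0 /s; case: (ltgtP 0 m) m0 => [mp _|mn _|<-]; last by rewrite ?eqxx.
    by rewrite subrK.
  by rewrite rmorphD /= opprK -addrA -mulr2n -[_ *+ 2]mulr_natr mulVf ?pnatr_eq0.
have jJ : (j0 <= J0)%N by rewrite /j0 /s /J0; move: m0; case: ltP => /=; lia.
have pv : prevac s j0 k0%:~R (-2 * m)%:~R v.
  split; [exact: r1|exact: r1|by rewrite r2 hk|by []| |]; rewrite /s /j0; case: ltP => h r /=.
  - move=> hr; have : 0 <= r by lia.
    by rewrite le_eqVlt => /orP[/eqP <-//|]; exact: r1.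
  - by move=> r0; apply: r1; lia.
  - by move=> r0; apply: r1; lia.
  - move=> hr; have : 0 <= r by lia.
    by rewrite le_eqVlt => /orP[/eqP <-//|]; exact: r1.
have [a [a0 [n' [ha hn]]]] := chain he jJ pv v0.
(* The chain takes k0 to -m or -m - 1 when m > 0, and to -m or 1 - m when m < 0; none of these is
   0. *)
have [k ek kn0] : exists2 k : int, n' = k%:~R & k != 0.
  case: hn => ->; [exists (k0 + (-1) ^+ (~~ s) * (J0 - j0)%:Z) | exists (k0 + (-1) ^+ (~~ s) * (J0 - j0).+1%:Z)];
    rewrite ?rmorphD ?rmorphM ?rmorphXn ?rmorphN ?rmorph1 //; rewrite /k0 /J0 /j0 /s; case: ltP => h /=; rewrite ?expr0 ?expr1; lia.
exists s, J0, k, (bi a); split=> //.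
- by move=> e; apply: a0; apply: (@b_inj _ (B m)); rewrite e (lm0 (b_strict _).1).
- case: ha => g1 g2 g3 g4 g5 g6; have [bL bs] := b_strict (B m).
  have b0 : bi (0 : bB (B m)) = 0 by exact: (lm0 bL).
  split=> [r r0|r r0|||r r0|r r0]; rewrite -bs.
  - by rewrite g1.
  - by rewrite g2.
  - by rewrite g3 (lmZ bL) ek.
  - by rewrite g4 (lmZ bL).
  - by rewrite g5.
  - by rewrite g6.
move=> U hU Ua x hx; have [b <-] := eig_block hB hx.
apply: (simple_strict (@b_ndiag _ (B m)) sB (vstable_preim (b_strict _) hU)).
by exists a.
Qed.

Lemma aj_gY u n v : gY u n (aj A v) = aj A (vY u n v).
Proof. by rewrite aj_act aj_Y. Qed.

Lemma avac_gi a (n : int) : 0 <= n -> gact a n (avac A) = 0.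
Proof.
move=> n0; rewrite -aj_vac /gact aj_gY (vsa_create0 (vP V)) // (lm0 (@aj_lin _ _ A)) //.
Qed.

Lemma avac_neq0 : avac A <> 0.
Proof.
move=> e; have [w w0] := (a_simple A).1; apply: w0.
by rewrite -(vsa_create (aP A) w) e (lm0 (vm_linr (vsa_mod (aP A)) _ _)).
Qed.

(** The summand of weight 0 and V are both induced from A_0, hence isomorphic. By [vacuum_unique],
    [avac A] is a nonzero multiple of the generator, so [aj] is this isomorphism up to a scalar. *)
Lemma A_zero : [/\ injective (aj A), forall v, gact gE 0 (aj A v) = 0 &
  forall x, gact gE 0 x = 0 -> exists v, aj A v = x].
Proof.
have [B hB] := blocks; have [w0 hw] := block_zero (B 0).
have hV := gi_ind V; have [aV rV uV] := hV; have [aB rB uB] := hw.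
have [f [[[fL fs] fv] _]] := uV _ _ _ aB rB.
have [g [[[gL gs] gv] _]] := uB _ _ _ aV rV.
have gf v : g (f v) = v.
  have [h [_ hh]] := uV _ _ _ aV rV; have e1 : h = (fun v => v) by apply: hh; split.
  have e2 : h = g \o f.
    by apply: hh; split; [split=> [c a b|a n v'] /=; rewrite ?fL ?gL ?fs ?gs|rewrite /= fv gv].
  by rewrite -[LHS]/((g \o f) v) -e2 e1.
have fg w : f (g w) = w.
  have [h [_ hh]] := uB _ _ _ aB rB; have e1 : h = (fun v => v) by apply: hh; split.
  have e2 : h = f \o g.
    by apply: hh; split; [split=> [c a b|a n v'] /=; rewrite ?gL ?fL ?gs ?fs|rewrite /= gv fv].
  by rewrite -[LHS]/((f \o g) w) -e2 e1.
have [bL bs] := b_strict (B 0).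
have zero (x : A) : gact gE 0 x = 0 -> exists b : bB (B 0), bi b = x.
  by move=> hx; apply: (eig_block hB); rewrite mulr0 scale0r.
have [b eb] := zero _ (avac_gi gE (lexx 0)).
have [|c hc] := @vacuum_unique _ V (g b).
  move=> a n n0; rewrite -gs (_ : gact a n b = 0) ?(lm0 gL) //.
  by apply: (@b_inj _ (B 0)); rewrite (lm0 bL) /gact bs eb -/(gact a n _) avac_gi.
have ev : avac A = c *: bi w0 by rewrite -eb -[b]fg hc (lmZ fL) fv (lmZ bL).
have c0 : c != 0 by apply/eqP => e; apply: avac_neq0; rewrite ev e scale0r.
have ajE v : aj A v = c *: bi (f v).
  have aA := vm_aff (gax A).
  have rA : rel_A 0 (@gact _ V A) (avac A).
    by split=> [a r r0||||]; rewrite avac_gi ?scale0r // ltW.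
  have [h [_ hh]] := uV _ _ _ aA rA.
  have e1 : h = aj A.
    by apply: hh; split; [split=> [|a n v'];[exact: aj_lin|rewrite /gact aj_gY]|exact: aj_vac].
  rewrite -e1; suff -> : h = fun v => c *: bi (f v) by [].
  apply: hh; split; last by rewrite fv -ev.
  split=> [d u1 u2|a n v']; first by rewrite fL bL scalerDr !scalerA mulrC.
  by rewrite fs /gact bs (lmZ (gYr _ _)).
split=> [v1 v2|v|x hx].
- by rewrite !ajE => /(scalerI c0) /(@b_inj _ (B 0)) e; rewrite -[v1]gf e gf.
- by rewrite ajE (lmZ (gactr _ _)) (bi_eig (block_E _)) mulr0 scale0r scaler0.
have [b' eb'] := zero x hx.
by exists (c^-1 *: g b'); rewrite ajE (lmZ fL) (lmZ bL) scalerA divff // scale1r fg.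
Qed.

(** Projection to E_0-weight 0 splits the unit of A, which is what makes [eta] injective. *)
Lemma A_to_tone (T : HLZ V) : exists F : ghom A (tone T),
  heven F /\ forall v, F (aj A v) = tu T v.
Proof.
have [ajI aj0 ajS] := A_zero.
have hE x : gact gE 0 (epr 0 x : A) = 0 by rewrite epr_eig ?scale0r.
pose ajV x := projT1 (cid (ajS _ (hE x))).
have ajVE x : aj A (ajV x) = epr 0 x by rewrite /ajV; case: cid.
have [pL ps] := epr_strict 0 dE.
pose f x := tu T (ajV x).
have fs : strict f.
  split=> [c u v|v n w]; rewrite /f.
    rewrite -tu_lin; congr (tu T _); apply: ajI.
    by rewrite (@aj_lin _ _ A) !ajVE pL.
  by rewrite -tuY; congr (tu T _); apply: ajI; rewrite ajVE ps -ajVE aj_gY.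
have fp w : f (par w) = par (f w).
  by rewrite /f -tu_par; congr (tu T _); apply: ajI; rewrite aj_par !ajVE epr_par.
have [F [eF Fe]] := strict_even_ghom fs fp; exists F; split=> // v.
rewrite eF /f; congr (tu T _); apply: ajI; rewrite ajVE epr_id //.
by rewrite scale0r.
Qed.

End ExtStructure.

(** * Locality of the induced cover *)

Section Locality.
Context {R : realType} {V : V1gl11 R} {T : HLZ V} {A : sl21_ext V} (M : alg_struct T A).
Local Notation C := R[i].
Local Notation obj := (indO V).
Local Notation "W ** X" := (tens T W X) (at level 40).
Local Notation ip := ('i * pi%:C : C).
Local Notation eta_ W := (@eta _ _ T A W).
Local Notation tYf W := (@tY _ _ T A (fin_ind W)).

Lemma eta_inj (W : obj) : injective (eta_ W).
Proof.
have [F [Fe hF]] := A_to_tone A T => w1 w2 e.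
have key w : tl T W (tmap T F (hid W) (eta_ W w)) = w.
  rewrite /eta (tmapE0 _ F (g := hid W)) ?hid_even; last exact: heven_id.
  by rewrite -aj_vac hF tl_vac.
by rewrite -[w1]key e key.
Qed.

Lemma aj_eta (W : obj) v h k (w : W) :
  tY T (aj A v) h k w = eta_ W (int_modes (@gY _ V W) v h k w).
Proof.
have ie := @heven_id _ _ W.
have e : tY T (tu T v) h k w =
    tY T (tu T (vac V)) (-1) 0 (int_modes (@gY _ V W) v h k w).
  by apply: (bij_inj (tl_bij T W)); rewrite tlE tl_vac.
rewrite -(unitAE M) -[RHS](congr1 (fun x => tY T x (-1) 0 _) (aj_vac A)) -(unitAE M).
by rewrite -[X in tY T _ h k X]/(hid W w) -tmapE0 // e tmapE0.
Qed.

(* The vectors of A annihilated by tY(-, x) W form an ideal of the simple algebra A. *)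
Lemma tY_faithful (W : obj) (w0 : W) : w0 <> 0 ->
  forall c : A, (forall w h k, tY T c h k w = 0 :> A ** W) -> c = 0.
Proof.
move=> w00; pose K : set A := [set c | forall w h k, tY T c h k w = 0 :> A ** W].
have Kv : vstable K.
  apply: (it_stable_left (tY_intw T A W) (A := fun _ _ => [set 0])) => //.
  - by move=> _ _; apply: vstable0.
  - by move=> _ _ _ ->; apply: (lm0 (@par_lin _ _)).
have Kp u : K u -> K (par u).
  by move=> Ku w h k; rewrite -[w]parK -tYp Ku (lm0 (@par_lin _ _)).
have [Z [i [iS iI iU iX ip]]] := ind_subobj Kv Kp.
have [io [eio ioe]] := strict_even_ghom iS ip.
have KY v n u : K u -> K (aY v n u).
  move=> /iX[z <-] w h k.
  (* By associativity the product of v and z acts on W through A (x) (K (x) W), and K (x) W goes to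
     0. *)
  have -> : aY v n (i z) = mu M (tmap T (hid A) io (tY T v n%:~R 0 z)).
    by rewrite tmapE0 // eio muE int_modes_int.
  pose y := tY T v n%:~R 0 z.
  have -> : tY T (mu M (tmap T (hid A) io y)) h k w =
      tmap T (mu M) (hid W) (tmap T (tmap T (hid A) io) (hid W) (tY T y h k w)).
    by rewrite !tmapE0 //; exact: heven_id.
  rewrite -[tY T y h k w](taVK (h0 := T)); move: (taV _ _ _ _ _) => s.
  rewrite -ta_nat (_ : tmap T (hid A) _ s = 0) ?(lm0 (hlin _)) //.
  move: s; apply: tens_ext; [exact: hlin|by move=> c u1 v1; rewrite scaler0 addr0|].
  move=> a1 g q x; rewrite tmapE0; last by apply: tmap_even => //; exact: heven_id.
  rewrite (_ : tmap T io (hid W) x = 0) ?(lm0 (tYr _ _ _ _)) //.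
  move: x; apply: tens_ext; [exact: hlin|by move=> c u1 v1; rewrite scaler0 addr0|].
  by move=> z1 g1 q1 w1; rewrite tmapE0 ?eio //; [exact: iU|exact: heven_id].
have sK : submod (@aY _ V A) K.
  by split=> //; [apply: ss0; exact: vs_sp|move=> c u v; apply: ssl; exact: vs_sp].
case: ((a_simple A).2 K sK) => eK; first by move=> c hc; have : K c by []; rewrite eK.
exfalso; apply: w00; apply: (@eta_inj W); rewrite (lm0 (eta_strict _).1).
have hK : K (avac A) by rewrite eK.
exact: hK.
Qed.

Lemma monodromy_par (W1 W2 : obj) (w1 : W1) (w2 : W2) h :
  (forall b1 b2 g k, (0 < k)%N -> tY T (parb b1 w1) g k (parb b2 w2) = 0) ->
  tR T W2 W1 (tR T W1 W2 (tY T w1 h 0 w2)) = cexp (- ip * (2 * (h + 1))) *: tY T w1 h 0 w2.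
Proof.
move=> hz.
have pp (W : obj) (w : W) (b : bool) :
    (if b then pod w else pev w) = 2^-1 *: (w + (-1) ^+ b *: par w).
  by case: b; rewrite ?pevE ?podE ?expr0 ?expr1 ?scale1r ?scaleN1r.
have hz' b1 b2 g k : (0 < k)%N -> tY T (if b1 then pod w1 else pev w1) g k
    (if b2 then pod w2 else pev w2) = 0.
  move=> k0; have := hz false false g k k0; have := hz true false g k k0.
  have := hz false true g k k0; have := hz true true g k k0; rewrite /parb => z1 z2 z3 z4.
  have L w := @tYl _ _ T W1 W2 g k w; have r w := @tYr _ _ T W1 W2 w g k.
  rewrite !pp (lmZ (L _)) (lmD (L _)) (lmZ (L _)) !(lmZ (r _)) !(lmD (r _)) !(lmZ (r _)).
  by rewrite z1 z2 z3 z4 !scaler0 !addr0 !scaler0 addr0 scaler0.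
have hb (W : obj) (w : W) (b : bool) : homog b (if b then pod w else pev w).
  by case: b; [exact: homog_pod|exact: homog_pev].
have key b1 b2 := monodromy h (hb W1 w1 b1) (hb W2 w2 b2) (fun g k => hz' b1 b2 g k).
have := key false false; have := key false true; have := key true false; have := key true true.
move=> /= k1 k2 k3 k4; rewrite -[w1]pevpod -[w2]pevpod.
have L w := @tYl _ _ T W1 W2 h 0 w; have r w := @tYr _ _ T W1 W2 w h 0.
rewrite !(lmD (L _)) !(lmD (r _)) !(lmD (hlin _)) k1 k2 k3 k4.
by rewrite !scalerDr.
Qed.

(* With e and n integers, the sums of eigenvectors of N_0 on which the zero mode
   e N_0 + n E_0 (E_0 acting by e0) has integral eigenvalues. *)
Definition integral_part (e n : int) (e0 : C) (W : gmod V) : set W :=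
  spanset [set w : W | exists nu : C, gact gN 0 w = nu *: w /\
    exists mu : int, e%:~R * nu + n%:~R * e0 = mu%:~R].

(** Odd modes change nu by 1 or -1, hence e nu + n e0 by the integer e or -e. *)
Lemma vstable_integral_part e n e0 (W : gmod V) : vstable (integral_part e n e0 (W := W)).
Proof.
have sU := subsp_span [set w : W | exists nu : C, gact gN 0 w = nu *: w /\
    exists mu : int, e%:~R * nu + n%:~R * e0 = mu%:~R].
apply: vstable_gi => // a r w; move: w; apply: span_min.
  by apply: subsp_preim => //; exact: gactr.
move=> w [nu [hw [mu hmu]]]; apply: span_sub.
exists (nu + (match a with gP => 1 | gM => -1 | _ => 0 end)); split; first exact: gactN0.
rewrite mulrDr addrAC hmu; case: a; rewrite ?mulr0 ?addr0 ?mulr1 ?mulrN1.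
- by exists mu.
- by exists mu.
- by exists (mu + e); rewrite rmorphD.
- by exists (mu - e); rewrite rmorphB.
Qed.

Definition int_powers (g : C) (k : nat) (W : gmod V) : set W :=
  [set x | ~ (k = 0%N /\ exists m : int, g = m%:~R) -> x = 0].

Lemma vstable_int_powers g k (W : gmod V) : vstable (@int_powers g k W).
Proof.
split; first split.
- by [].
- by move=> c u v hu hv h; rewrite hu // hv // scaler0 addr0.
by move=> v n w hw h; rewrite hw // (lm0 (gYr _ _)).
Qed.

Lemma int_powers_shift (W : gmod V) h k (m : int) (x : W) :
  int_powers (h + m%:~R) k x -> int_powers h k x.
Proof.
move=> hx hn; apply: hx => -[k0 [m' e]]; apply: hn; split=> //; exists (m' - m).
by rewrite rmorphB /= -e addrK.
Qed.

Lemma int_powers_par (W : gmod V) h k (x : W) : int_powers h k x -> int_powers h k (par x).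
Proof. by move=> hx /hx ->; apply: (lm0 (@par_lin _ _)). Qed.

Lemma KZ_integral (W : finO V) s j (n : int) (m : int) (a : A) (e0 : C) (w : W) :
  vaclike (@gY _ V A) s j n%:~R m%:~R a -> m%:~R = (-1) ^+ (~~ s) * j%:R :> C ->
  m != 0 -> n != 0 -> (forall w : W, gact gE 0 w = e0 *: w) ->
  integral_part m n e0 w ->
  forall h k, int_powers h k (tYf W a h k w).
Proof.
move=> ha he m0 n0 hE hw h k; move: w hw; apply: span_min.
  apply: (subsp_preim (@tYr _ _ T A (fin_ind W) a h k)); exact: vs_sp (vstable_int_powers _ _ _).
move=> w [nu [hN [mu hmu]]] hg.
have w0 : gY (curr m%:~R n%:~R : V) 0 w = mu%:~R *: w.
  by rewrite curr_mode hN hE !scalerA -scalerDl hmu.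
have mn : m%:~R * n%:~R != 0 :> C by rewrite mulf_neq0 ?intr_eq0.
apply: (KZ_eigen (tY_intw T A (fin_ind W)) (fP W) ha he mn w0).
case: k hg => [|k] hg; last by left.
by right=> q eq; apply: hg; split=> //; exists (- mu + q); rewrite rmorphD rmorphN.
Qed.

Lemma local_integral (S : finO V) s j (n m : int) (a : A) (e0 : C) :
  (exists w : S, w <> 0) -> is_local (repF M (fin_ind S)) -> a <> 0 ->
  vaclike (@gY _ V A) s j n%:~R m%:~R a -> m%:~R = (-1) ^+ (~~ s) * j%:R :> C ->
  m != 0 -> n != 0 -> (forall w : S, gact gE 0 w = e0 *: w) ->
  exists w : S, w <> 0 /\ integral_part m n e0 w.
Proof.
move=> [w0 w00] loc a0 ha he m0 n0 hE.
have [w [h [k aw]]] : exists (w : S) h k, tYf S a h k w <> 0.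
  apply: contrapT => hn; apply: a0; apply: (tY_faithful (W := fin_ind S) w00) => w h k.
  by apply: contrapT => hz; apply: hn; exists w, h, k.
have [nu [v hw aw']] : exists nu, exists2 w : S, gact gN 0 w = nu *: w &
    tYf S a h k w <> 0.
  apply: contrapT => hn; apply: aw; have [l [-> hl]] := O1fin_ndiag (fP S) w.
  rewrite (lm_sum (@tYr _ _ T A (fin_ind S) a h k)) big_seq big1 // => p pl; apply: contrapT => hz.
  by apply: hn; exists p.1, p.2 => //; exact: hl.
exists v; split; first by move=> w0'; apply: aw'; rewrite w0' (lm0 (tYr _ _ _ _)).
apply: span_sub; exists nu; split=> //; set lam := _ + _.
have cw : gY (curr m%:~R n%:~R : V) 0 v = lam *: v.
  by rewrite curr_mode hw hE !scalerA -scalerDl.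
have cpw : gY (curr m%:~R n%:~R : V) 0 (par v) = lam *: par v.
  have := vm_par (gax S) (curr m%:~R n%:~R) 0 v.
  by rewrite (homog_curr _ _ : par _ = _) scale1r cw parZ => ->.
have mn : m%:~R * n%:~R != 0 :> C by rewrite mulf_neq0 ?intr_eq0.
have g1 := KZ_eigen (tY_intw T A (fin_ind S)) (fP S) ha he mn cw.
have g2 := KZ_eigen (tY_intw T A (fin_ind S)) (fP S) ha he mn cpw.
have ek : k = 0%N.
  by apply: contrapT => /eqP; rewrite -lt0n => k0; apply: aw'; apply: g1; left.
have eh : exists q : int, h = - lam + q%:~R.
  apply: contrapT => hn; apply: aw'; apply: g1; right=> q eq; apply: hn; exists q; exact: eq.
have [q eq] := eh; subst k.
have := @monodromy_par A (fin_ind S) a v h.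
rewrite (local_monodromy loc) => mon.
have {}mon : tYf S a h 0 v = cexp (- ip * (2 * (h + 1))) *: tYf S a h 0 v.
  apply: mon => b1 b2 g k k0.
  have pz (x : S) : par (tYf S a g k (par x)) = tYf S (par a) g k x.
    by rewrite tYp parK.
  by case: b1; case: b2; rewrite /parb -?pz ?parK ?g1 ?g2 ?(lm0 (@par_lin _ _)) //; left.
(* The trivial monodromy multiplies a nonzero coefficient by this scalar, so the scalar is 1 and h +
   1, hence lam, is an integer. *)
have : cexp (- ip * (2 * (h + 1))) = 1 :> C.
  apply/eqP; rewrite -subr_eq0; have : (cexp (- ip * (2 * (h + 1))) - 1) *: tYf S a h 0 v = 0.
    by rewrite scalerBl -mon scale1r subrr.
  by move/eqP; rewrite scaler_eq0 => /orP[//|/eqP].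
move/cexp_eq1 => [r er]; exists (q + 1 - r).
by rewrite rmorphB rmorphD /= -er eq; ring.
Qed.

End Locality.

(** * Transfer of integrality from S to its cover *)

Section CoverLocality.
Context {R : realType} {V : V1gl11 R} {T : HLZ V} {A : sl21_ext V} (M : alg_struct T A).
Local Notation C := R[i].
Local Notation "W ** X" := (tens T W X) (at level 40).
Local Notation tYf W := (@tY _ _ T A (fin_ind W)).
Variables (S P : finO V) (pi : P -> S).
Hypothesis simS : simple_mod S.
Hypothesis cov : scover pi.

Let dS : diagz (@gact _ V S gE 0) := @in_ind_ediag _ _ _ (@iP _ _ (fin_ind S)).
Let dP : diagz (@gact _ V P gE 0) := @in_ind_ediag _ _ _ (@iP _ _ (fin_ind P)).
Let nS : ndiag S := O1fin_ndiag (fP S).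
Let nP : ndiag P := O1fin_ndiag (fP P).
Let piL := (sc_strict cov).1.

Lemma simple_E : exists e0 : C, forall s : S, gact gE 0 s = e0 *: s.
Proof.
have [s0 s00] := simS.1; have [l [el hl]] := dS s0.
have [p pl p0] : exists2 p, p \in l & p.2 <> 0.
  apply: contrapT => hn; apply: s00; rewrite el big_seq big1 // => p pl.
  by apply: contrapT => p0; apply: hn; exists p.
exists p.1; apply: (simple_strict nS simS (vstable_eigE S p.1)).
by exists p.2 => //; exact: hl.
Qed.

(** E_0 is central, so its e0-eigenspace is a submodule; it maps onto S, since projecting a preimage
    to weight e0 does not change its image. *)
Lemma cover_E e0 : (forall s : S, gact gE 0 s = e0 *: s) ->
  forall w : P, gact gE 0 w = e0 *: w.
Proof.
move=> hE; apply: (essential cov (vstable_eigE P e0)) => s.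
have [w ew] := sc_surj cov s; exists (epr e0 w); first exact: epr_eig.
by rewrite -(epr_nat e0 dP dS (sc_strict cov)) ew epr_id.
Qed.

Lemma cover_integral (e n : int) e0 : (forall s : S, gact gE 0 s = e0 *: s) ->
  (exists s : S, s <> 0 /\ integral_part e n e0 s) ->
  forall w : P, integral_part e n e0 w.
Proof.
move=> hE [s0 [s00 hs0]]; have vP := @vstable_integral_part _ _ e n e0 P.
apply: (essential cov vP) => s.
have : integral_part e n e0 s.
  by apply: (simple_strict nS simS (vstable_integral_part e n e0 S)); exists s0.
suff key : integral_part e n e0 (W := S) `<=` pi @` (integral_part e n e0 (W := P)).
  by move=> /key[w hw ew]; exists w.
apply: span_min; first exact: (vs_sp (vstable_image (sc_strict cov) vP)).
move=> x [nu [hx hmu]]; have [w ew] := sc_surj cov x.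
pose phi (l : C) : C := (l == nu)%:R.
have NL (W : gmod V) := @gactr _ _ W gN 0.
exists (fcalc (@gact _ V P gN 0) phi w).
  have [l hl] := nP w; rewrite (fcalcE (NL P) phi hl).
  apply: (ss_sum (vs_sp vP)) => p pl _ /=; rewrite /phi.
  case: eqP => [ep|_]; last by rewrite scale0r; exact: (ss0 (vs_sp vP)).
  by rewrite scale1r; apply: span_sub; exists nu; split=> //; rewrite -ep; exact: hl.2.
rewrite -(fcalc_comm (T' := @gact _ V S gN 0) (phi := phi) (c := 0) (NL P) (NL S) nP nS piL).
- by rewrite ew (fcalc_eig (NL S) phi hx) /phi eqxx scale1r.
- by move=> l u hu; rewrite /gact -(sc_strict cov).2 -/(gact gN 0 u) hu addr0 (lmZ piL).
- by move=> l; rewrite addr0.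
Qed.

(** The claim is checked by E_0-weight in A: weight 0 is V, which acts by integral modes, and every
    other weight space is generated by a spectral flow, covered by [KZ_integral]. *)
Lemma cover_int_powers : is_local (repF M (fin_ind S)) ->
  forall (b : A) h k (w : P), int_powers h k (tYf P b h k w).
Proof.
move=> loc b h k w; have [e0 hE] := simple_E; have hEP := cover_E hE.
have vU : vstable [set x : A | forall w h k, int_powers h k (tYf P x h k w)].
  apply: (it_stable_left (tY_intw T A (fin_ind P)) (A := fun h k => int_powers h k (W := A ** fin_ind P))).
  - by move=> h' k'; exact: vstable_int_powers.
  - by move=> h' k' m x; exact: int_powers_shift.
  - by move=> h' k' x; exact: int_powers_par.
suff : [set x : A | forall w h k, int_powers h k (tYf P x h k w)] b by exact.
have [l [-> hl]] := A_sum b; apply: (ss_sum (vs_sp vU)) => y yl _.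
have [m hy] := hl y yl; have [m0|m0] := eqVneq m 0.
  have [_ _ aj0] := A_zero A.
  have [|v <-] := aj0 y; first by rewrite hy m0 mulr0 scale0r.
  move=> w' h' k' hn; rewrite (aj_eta M).
  have -> : int_modes (@gY _ V P) v h' k' w' = 0.
    rewrite /int_modes; case: k' hn => [|//] hn; case: pselect => // -[m' em'].
    by case: hn; split=> //; exists m'.
  exact: (lm0 (eta_strict (A := A) (T := T) (fin_ind P)).1).
have [s [j [q [a [a0 ha he q0 hgen]]]]] := A_block A m0.
apply: (hgen _ vU _ y hy) => w' h' k'.
have m20 : -2 * m != 0 by rewrite mulf_neq0.
apply: (KZ_integral ha he m20 q0 hEP).
apply: (cover_integral hE).
exact: (local_integral simS.1 loc a0 ha he m20 q0 hE).
Qed.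

Lemma cover_local : is_local (repF M (fin_ind S)) -> is_local (repF M (fin_ind P)).
Proof.
move=> loc; apply: repF_local; apply: (tens_ext_homog (T := T)).
- by move=> c u v; rewrite !hlin.
- by [].
move=> b1 b2 a h k w ha hw; have hz := cover_int_powers loc.
have [[ek [m em]]|hn] := pselect (k = 0%N /\ exists m : int, h = m%:~R); last first.
  by rewrite (hz a h k w hn) !(lm0 (hlin _)).
rewrite ek (monodromy h ha hw); last first.
  by move=> g k' k0; apply: hz => -[e _]; rewrite e in k0.
by rewrite em -(rmorphD _ m 1) cexp_int scale1r.
Qed.

End CoverLocality.

(** * The induced projective cover *)

Section RepProjective.
Context {R : realType} {V : V1gl11 R} {T : HLZ V} {A : sl21_ext V} (M : alg_struct T A).
Local Notation C := R[i].
Local Notation "W ** X" := (tens T W X) (at level 40).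
Local Notation eta_ W := (@eta _ _ T A W).

Lemma eigE_tens (W1 W2 : indO V) (w1 : W1) (w2 : W2) h k (e1 e2 : C) :
  gact gE 0 w1 = e1 *: w1 -> gact gE 0 w2 = e2 *: w2 ->
  gact gE 0 (tY T w1 h k w2) = (e1 + e2) *: tY T w1 h k w2.
Proof.
move=> h1 h2; have := it_comm (tY_intw T W1 W2) w1 h k w2 0 (@gi_par _ V gE).
move=> [K0 /(_ K0.+1 (leqnSn _))]; rewrite big_ord_recl big1 => [|i _]; last first.
  by rewrite gbin0S scale0r.
rewrite gbin0 scale1r /= add0r subr0 addr0 -/(gact gE 0 w1) -/(gact gE 0 w2) h1 h2.
rewrite (lmZ (tYl T h k w2)) (lmZ (tYr T w1 h k)) => /eqP.
by rewrite subr_eq -scalerDl => /eqP.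
Qed.

(* The weights of E_0 on A are -2m, and its zero eigenspace is V. *)
Lemma eigE_eta (W : indO V) (e0 : C) : (forall w : W, gact gE 0 w = e0 *: w) ->
  forall t : A ** W, gact gE 0 t = e0 *: t -> exists w, eta_ W w = t.
Proof.
move=> hE t ht; have dt := @in_ind_ediag _ _ _ (@iP _ _ (A ** W)).
have [eL _] := epr_strict e0 dt.
suff key : forall t, range (eta_ W) (epr e0 t).
  by have [w _ ew] := key t; exists w; rewrite ew epr_id.
have sR : subsp (range (eta_ W)) := vs_sp (vstable_range (eta_strict W)).
move=> {ht}t; refine (@span_min _ _ _ [set t | range (eta_ W) (epr e0 t)] (subsp_preim eL sR) _ _ (tens_span t)).
move=> _ [b [h [k [w ->]]]] /=; have [l [-> hl]] := A_sum b.
rewrite (lm_sum (tYl T h k w)) (lm_sum eL); apply: (ss_sum sR) => y yl _.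
have [m hy] := hl y yl; have ey := eigE_tens h k hy (hE w).
have [m0|m0] := eqVneq m 0.
  have [_ _ aj0] := A_zero A.
  have [|v <-] := aj0 y; first by rewrite hy m0 mulr0 scale0r.
  rewrite (aj_eta M) epr_id; first by eexists.
  by rewrite /gact -(eta_strict W).2 -/(gact gE 0 _) hE (lmZ (eta_strict W).1).
rewrite /epr (fcalc_eig (@gactr _ _ _ gE 0) _ ey) -subr_eq0 addrK intr_eq0.
by rewrite mulf_eq0 (negPf m0) scale0r; exact: (ss0 sR).
Qed.

(** X and Y are only unions of objects of O_1^fin, so the restriction of f to P is lifted by
    [sproj_ind] before it is extended to A (x) P. *)
Lemma projective_repF (P : finO V) : sproj P -> is_local (repF M (fin_ind P)) ->
  @projective (repobj T A) (fun X => rX X) (in_rep0 M) (@rep_mor R V T A)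
    (repF M (fin_ind P)).
Proof.
move=> pP loc; have rP := repF_rep M (fin_ind P); split=> // X Y p f [rX_ _] [rY _] [pm pS] fm.
have pa := rep_mor_astrict rX_ rY pm; have fa := rep_mor_astrict rP rY fm.
have ps := astrict_strict rX_ rY pa; have fs := astrict_strict rP rY fa.
have [g0 [g0s hg0]] := sproj_ind pP (@iP _ _ (rX X)) (@iP _ _ (rX Y)) ps (surj_strict pS)
  (strict_comp fs (eta_strict (fin_ind P))).
have [F [Fa hF]] := @frobenius _ _ _ _ M (fin_ind P) _ _ rX_ g0s.
exists (conjJ (- 'i) F); split; first exact: (astrict_rep_mor rP rX_ Fa).
move=> u; rewrite -[LHS](conjJK (fun u => p (conjJ (- 'i) F u))) -[RHS](conjJK f).
apply: conjJ_eq => {}u; rewrite (conjJ_comp p (conjJ (- 'i) F)) conjJVK; move: u.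
apply: tens_ext; [exact: (lin_comp pa.1 Fa.1)|exact: fa.1|] => a h k w.
by rewrite hF pa.2 hg0 -fa.2 act_eta.
Qed.

Lemma repF_map (P S : finO V) (pi : P -> S) : strict pi ->
  (forall s, exists w, pi w = s) ->
  exists F : rX (repF M (fin_ind P)) -> rX (repF M (fin_ind S)),
    [/\ astrict F, forall w, F (eta_ (fin_ind P) w) = eta_ (fin_ind S) (pi w) &
     forall t, exists u, F u = t].
Proof.
move=> ps pS; have rS := repF_rep M (fin_ind S).
have [F [Fa hF]] := @frobenius _ _ _ _ M (fin_ind P) _ _ rS (strict_comp (eta_strict (fin_ind S)) ps).
have hF' a h k w : F (tY T a h k w) = @tY _ _ T A (fin_ind S) a h k (pi w) by rewrite hF act_eta.
exists F; split=> // [w|t]; first exact: hF'.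
suff : range F t by case=> u _ <-; exists u.
have sF : subsp (range F).
  exact: (vs_sp (vstable_range (astrict_strict (repF_rep M (fin_ind P)) rS Fa))).
move: (tens_span t); apply: span_min => // _ [a [h [k [s ->]]]].
by have [w <-] := pS s; exists (@tY _ _ T A (fin_ind P) a h k w).
Qed.

Lemma repF_essential (P S : finO V) (pi : P -> S) e0 :
  scover pi -> (forall s : S, gact gE 0 s = e0 *: s) -> (forall w : P, gact gE 0 w = e0 *: w) ->
  forall F : rX (repF M (fin_ind P)) -> rX (repF M (fin_ind S)), astrict F ->
  (forall w, F (eta_ (fin_ind P) w) = eta_ (fin_ind S) (pi w)) ->
  forall U : set (rX (repF M (fin_ind P))), vstable U ->
  (forall a h k x, U x -> U (rmu (repF M (fin_ind P)) (tY T a h k x))) ->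
  (forall t, exists2 u, U u & F u = t) -> forall u, U u.
Proof.
move=> cov hES hEP F Fa hF U Uv Ua UF u.
have Fs := astrict_strict (repF_rep M (fin_ind P)) (repF_rep M (fin_ind S)) Fa.
have dP := @in_ind_ediag _ _ _ (@iP _ _ (A ** fin_ind P)).
have dS := @in_ind_ediag _ _ _ (@iP _ _ (A ** fin_ind S)).
have eP := eta_strict (A := A) (T := T) (fin_ind P).
have eS := eta_strict (A := A) (T := T) (fin_ind S).
have Ueta : forall w : P, U (eta_ (fin_ind P) w).
  apply: (essential cov (vstable_preim eP Uv)) => s.
  have [x Ux ex] := UF (eta_ (fin_ind S) s).
  (* The projection to weight e0 keeps x in U, moves it into 1 (x) P by [eigE_eta], and does not
     change its image, which already has weight e0. *)
  have Ux' : U (epr e0 x).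
    apply: fcalc_sub => //; [exact: gactr|exact: vs_sp|by move=> y Uy; apply: vs_act].
  have [w ew] := @eigE_eta (fin_ind P) e0 hEP _ (epr_eig e0 x dP).
  exists w; first by rewrite -/(eta_ (fin_ind P) w) ew.
  apply: (@eta_inj _ _ T A (fin_ind S)); rewrite -hF ew -(epr_nat e0 dP dS Fs) ex epr_id //.
  by rewrite /gact -eS.2 -/(gact gE 0 s) hES (lmZ eS.1).
move: (tens_span u); apply: span_min; first exact: vs_sp.
by move=> _ [a [h [k [w ->]]]]; rewrite -(act_eta M); apply: Ua.
Qed.

End RepProjective.

Theorem proposition5p0p4 (R : realType) (V : V1gl11 R) (T : HLZ V)
    (A : sl21_ext V) (M : alg_struct T A) (S P : finO V) :
  simple_mod S ->
  projective_cover_O1fin P S ->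
  in_rep0 M (indF M S) ->
  projective_cover_rep0 M (indF M P) (indF M S).
Proof.
move=> simS /cover_strict[pi cov] hS.
have rP := repF_rep M (fin_ind P); have rS := repF_rep M (fin_ind S).
have locP := cover_local simS cov hS.2.
have [e0 hES] := simple_E simS; have hEP := cover_E cov hES.
have pF := projective_repF (sc_proj cov) locP.
have [F [Fa hF FS]] := repF_map M (sc_strict cov) (sc_surj cov).
have Fm : surjection (@rep_mor R V T A) (X := indF M P) (Y := indF M S) (conjJ (- 'i) F).
  by split; [exact: (astrict_rep_mor rP rS Fa)|exact: surj_super].
split; first exact: hS; split; first exact: pF.
exists (conjJ (- 'i) F); split=> // Q q [[rQ lQ] pQ] [qm qS].
(* The factorization comes from projectivity of Q; only its surjectivity uses that the induced cover
   is essential. *)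
have [q' [q'm hq']] := pQ _ _ _ _ (conj rP locP) hS Fm qm.
exists q'; split=> //.
split=> // t; have q'a := rep_mor_astrict rQ rP q'm.
have q's := astrict_strict rQ rP q'a.
have Fq u : F (conjJ 'i q' u) = conjJ 'i q u.
  rewrite -[F _](conjJVK F) -(conjJ_comp (conjJ (- 'i) F) q').
  exact: conjJ_eq.
have qE : forall u, range (conjJ 'i q') u.
  apply: (repF_essential cov hES hEP Fa hF (vstable_range q's)).
  - by move=> a h k _ [x _ <-]; exists (rmu Q (tY T a h k x)); rewrite ?q'a.2.
  by move=> y; have [x ex] := surj_strict qS y; exists (conjJ 'i q' x); [exists x|rewrite Fq].
have qE' : forall y, exists x, conjJ 'i q' x = y by move=> y; have [x _ <-] := qE y; exists x.
by have [x ex] := surj_super qE' t; exists x; rewrite -ex conjJK.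
Qed.
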